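(* Let $2\le p<\infty$, let $q$ be given by $1/p+1/q=1$ (so $q\le 2$), and let $k\in\mathbb{N}=\{1,2,\dots\}$. Then $$\|R^k\|_p\;\ge\;\frac{\Gamma(1/p)\,\Gamma(1/q+k/2)}{\Gamma(1/q)\,\Gamma(1/p+k/2)}\;\ge\;\frac12\,k^{1-2/p}(p-1).$$
   Context: Identify $\mathbb{R}^2\equiv\mathbb{C}$. $R=R_2+iR_1$, where $R_1,R_2$ are the classical scalar Riesz transforms on $\mathbb{R}^2$. Equivalently, with $\hat f(\xi)=\int f(x)e^{-2\pi i x\cdot\xi}\,dx$, $R^k$ is the Fourier multiplier operator with symbol $(\bar\zeta/|\zeta|)^k$. It extends to a bounded operator on $L^p(\mathbb{C})$ (complex-valued functions) for all $1<p<\infty$; $\|R^k\|_p$ denotes its operator norm on $L^p(\mathbb{C})$. $\Gamma$ is the Euler gamma-function. *)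

(* Defs.v *)
From HB Require Import structures.
From mathcomp Require Import all_boot all_order all_algebra.
From mathcomp Require Import complex.
From mathcomp Require Import all_classical all_reals all_analysis.

Set Implicit Arguments.
Unset Strict Implicit.
Unset Printing Implicit Defensive.

Import Order.TTheory GRing.Theory Num.Theory.
Import numFieldNormedType.Exports.

Local Open Scope classical_set_scope.
Local Open Scope ring_scope.

(* The plane is the measurable space R * R; (x1, x2) stands for x1 + i x2.
   Functions on it take values in R[i]. *)

Definition plane_measure (R : realType) :
    {measure set (measurableTypeR R * measurableTypeR R) -> \bar R} :=
  ((@lebesgue_measure R) \x (@lebesgue_measure R))%E.

Definition plane_point (R : realType) (x : R * R) : R[i] := Complex x.1 x.2.

Definition cmodulus (R : realType) (z : R[i]) : R := ComplexField.Normc.normc z.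

Definition cmeasurable (R : realType) (f : R * R -> R[i]) : Prop :=
  measurable_fun [set: measurableTypeR R * measurableTypeR R]
    (fun x => complex.Re (f x) : measurableTypeR R) /\
  measurable_fun [set: measurableTypeR R * measurableTypeR R]
    (fun x => complex.Im (f x) : measurableTypeR R).

Definition cintegrable (R : realType) (f : R * R -> R[i]) : Prop :=
  (plane_measure R).-integrable setT (fun x => (complex.Re (f x))%:E) /\
  (plane_measure R).-integrable setT (fun x => (complex.Im (f x))%:E).

Definition cintegral (R : realType) (f : R * R -> R[i]) : R[i] :=
  Complex (Rintegral (plane_measure R) setT (fun x => complex.Re (f x)))
          (Rintegral (plane_measure R) setT (fun x => complex.Im (f x))).

Definition Lp_norm (R : realType) (p : R) (f : R * R -> R[i]) : \bar R :=
  Lnorm (plane_measure R) p%:E (fun x => (cmodulus (f x))%:E).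

Definition in_Lp (R : realType) (p : R) (f : R * R -> R[i]) : Prop :=
  cmeasurable f /\ (Lp_norm p f < +oo)%E.

Definition cis (R : realType) (t : R) : R[i] := Complex (cos t) (sin t).

Definition dot (R : realType) (x xi : R * R) : R := x.1 * xi.1 + x.2 * xi.2.

Definition fourier (R : realType) (f : R * R -> R[i]) (xi : R * R) : R[i] :=
  cintegral (fun x => f x * cis (- (2 * pi * dot x xi))).

Definition inv_fourier (R : realType) (h : R * R -> R[i]) (x : R * R) : R[i] :=
  cintegral (fun xi => h xi * cis (2 * pi * dot x xi)).

(* Integrable functions with integrable Fourier transform: they include the
   Schwartz functions, hence are dense in L^p for finite p, and on them a
   multiplier operator with bounded symbol is an absolutely convergent
   integral. *)
Definition fourier_class (R : realType) (f : R * R -> R[i]) : Prop :=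
  cintegrable f /\ cintegrable (fourier f).

Definition multiplier_op (R : realType) (m : R * R -> R[i])
    (f : R * R -> R[i]) : R * R -> R[i] :=
  inv_fourier (fun xi => m xi * fourier f xi).

(* [multiplier_Lp p m f g]: the extension by continuity to L^p of the
   multiplier operator with symbol m maps f to g (almost everywhere). *)
Definition multiplier_Lp (R : realType) (p : R) (m : R * R -> R[i])
    (f g : R * R -> R[i]) : Prop :=
  [/\ in_Lp p f, in_Lp p g &
      exists u : nat -> (R * R -> R[i]),
        [/\ forall n, fourier_class (u n) /\ in_Lp p (u n),
            Lp_norm p (fun x => u n x - f x) @[n --> \oo] --> (0 : \bar R)%E &
            Lp_norm p (fun x => multiplier_op m (u n) x - g x)
              @[n --> \oo] --> (0 : \bar R)%E]].

Definition multiplier_opnorm (R : realType) (p : R) (m : R * R -> R[i]) :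
    \bar R :=
  ereal_sup [set y | exists f g : R * R -> R[i],
    [/\ multiplier_Lp p m f g, (Lp_norm p f <= 1)%E & y = Lp_norm p g]].

(* The value at the origin is irrelevant (a null set). *)
Definition riesz_symbol (R : realType) (xi : R * R) : R[i] :=
  conjc (plane_point xi) / real_complex R (cmodulus (plane_point xi)).

(* The norm on L^p of R^k, for R = R_2 + i R_1. *)
Definition riesz_power_norm (R : realType) (k : nat) (p : R) : \bar R :=
  multiplier_opnorm p (fun xi => riesz_symbol xi ^+ k).

(* Euler's integral, convergent for 0 < s. *)
Definition Gamma (R : realType) (s : R) : R :=
  Rintegral (@lebesgue_measure R) `]0, +oo[
    (fun t => t `^ (s - 1) * expR (- t)).

(* Main.v *)
(* Put a = 1/p, b = k/2 - a and, for 0 < d < 1, test R^k on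
     f(z) = z^k \int_0^oo ((v-d)_+^b - (v-1)_+^b) v^(-k-1) e^(-pi |z|^2/v) dv.
   Being a mixture of functions z^k e^(-c|z|^2), f has the Fourier transform
     (-i)^k zeta^k Gamma(b+1) (pi r)^(-b-1) (e^(-pi d r) - e^(-pi r)),
   with r = |zeta|^2. Multiplication by the symbol turns zeta^k r^(-b-1) into
   the radial factor r^(a-1), and (pi r)^(a-1) e^(-pi d r) is in turn a mixture
   of Gaussians, with weight (v-d)_+^(-a) / Gamma(1-a); so R^k f is explicit as
   well. On d <= |z|^2 <= 1 both |f| and |R^k f| are close to multiples of
   |z|^(-2/p); elsewhere their p-th powers have integrals bounded in d. Hence
   both p-th powers of norms grow like ln(1/d), and the ratio of the constants
   is the p-th power of the Gamma quotient.
   For the second inequality, Gamma(x+s) <= x^s Gamma(x) for 0 <= s <= 1 implies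
   Gamma(2-a) <= 4^a Gamma(1+a), as well as x^(1-2a) Gamma(x+a) <= Gamma(x+1-a),
   which is used at x = k/2. *)

Require Import Defs.
From HB Require Import structures.
From mathcomp Require Import all_boot all_order all_algebra.
From mathcomp Require Import complex.
From mathcomp Require Import all_classical all_reals all_analysis.
From mathcomp Require Import measurable_realfun.
From mathcomp Require Import ring lra.

Set Implicit Arguments.
Unset Strict Implicit.
Unset Printing Implicit Defensive.

Import Order.TTheory GRing.Theory Num.Theory.
Import numFieldNormedType.Exports.

Local Open Scope classical_set_scope.
Local Open Scope ring_scope.

Local Notation Re := complex.Re.
Local Notation Im := complex.Im.

(** With d = 0 and without the second term, f would be a multiple of z^k |z|^(-k-2/p), homogeneous
    of the critical degree -2/p. The operator sends it to a multiple of |z|^(-2/p), and the Gamma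
    quotient is the ratio of the two moduli. This pair fails to lie in L^p, logarithmically at 0 and
    at infinity, which forces a cutoff. The cutoff shifts the power, (v-d)_+^b, and does not
    restrict v: the Laplace transform of a shifted power is a power of r times e^(-pi d r), and
    multiplication by r^(k/2) only moves the exponent, so the image stays explicit. Subtracting the
    term at 1 lowers the weight by one power of v at infinity and gives p-integrability there. The
    condition p >= 2 enters as a <= 1/2, which makes b >= 0 for every k >= 1. The estimates are
    one-sided, from above for f and from below for its image; in the latter the error terms enter
    linearly, by Bernoulli's inequality, so that their integrals stay bounded in d. *)

Lemma le_of_eq {disp} {T : porderType disp} (x y : T) : x = y -> (x <= y)%O.
Proof. by move=> ->. Qed.

Lemma measurable_expRN d (T : measurableType d) (R : realType) (f : T -> R) :
  measurable_fun setT f -> measurable_fun setT (fun x => expR (- f x)).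
Proof.
move=> mf; apply: (measurableT_comp (@measurable_expR R)).
exact: measurable_funN.
Qed.

(** * Integrals on the line *)

Section Ge0Integral.
Context d (T : measurableType d) (R : realType) {m : {measure set T -> \bar R}}.
Implicit Types (f g : T -> R) (r : R).

Lemma ge0_integralZl_EFin r f : measurable_fun setT f -> (forall x, 0 <= f x) -> 0 <= r ->
  (\int[m]_x (r * f x)%:E = r%:E * \int[m]_x (f x)%:E)%E.
Proof.
move=> mf f0 r0; under eq_integral do rewrite EFinM.
rewrite ge0_integralZl; [by []|by []|by apply/measurable_EFinP
  |by move=> x _; rewrite lee_fin|by rewrite lee_fin].
Qed.

Lemma ge0_integralD_EFin f g : measurable_fun setT f -> measurable_fun setT g ->
  (forall x, 0 <= f x) -> (forall x, 0 <= g x) ->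
  (\int[m]_x (f x + g x)%:E = \int[m]_x (f x)%:E + \int[m]_x (g x)%:E)%E.
Proof.
move=> mf mg f0 g0; under eq_integral do rewrite EFinD.
rewrite ge0_integralD; [by []|by []|by move=> x _; rewrite lee_fin
  |by apply/measurable_EFinP|by move=> x _; rewrite lee_fin|by apply/measurable_EFinP].
Qed.

Lemma integral_EFin_ge0 f : (forall x, 0 <= f x) -> (0 <= \int[m]_x (f x)%:E)%E.
Proof. by move=> f0; apply: integral_ge0 => x _; rewrite lee_fin. Qed.

Lemma Rintegral_ge0 f : (forall x, 0 <= f x) -> 0 <= \int[m]_x f x.
Proof. by move=> f0; exact/fine_ge0/integral_EFin_ge0. Qed.

Lemma ge0_le_integral_EFin f g : measurable_fun setT f -> measurable_fun setT g ->
  (forall x, 0 <= f x <= g x) -> (\int[m]_x (f x)%:E <= \int[m]_x (g x)%:E)%E.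
Proof.
move=> mf mg fg; apply: ge0_le_integral; [by []| | | |].
- by move=> x _; have /andP[] := fg x; rewrite lee_fin.
- by apply/measurable_EFinP.
- by apply/measurable_EFinP.
- by move=> x _; have /andP[] := fg x; rewrite lee_fin.
Qed.

Lemma ge0_integral_lty_le f g : measurable_fun setT f -> measurable_fun setT g ->
  (forall x, 0 <= f x <= g x) ->
  (\int[m]_x (g x)%:E < +oo)%E -> (\int[m]_x (f x)%:E < +oo)%E.
Proof. by move=> mf mg fg; apply: le_lt_trans; exact: ge0_le_integral_EFin. Qed.

Lemma ge0_integralZl_lty r f : 0 <= r -> measurable_fun setT f -> (forall x, 0 <= f x) ->
  (\int[m]_x (f x)%:E < +oo)%E -> (\int[m]_x (r * f x)%:E < +oo)%E.
Proof. by move=> r0 mf f0 fi; rewrite ge0_integralZl_EFin// lte_mul_pinfty. Qed.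

Lemma ge0_integralD_lty f g : measurable_fun setT f -> measurable_fun setT g ->
  (forall x, 0 <= f x) -> (forall x, 0 <= g x) ->
  (\int[m]_x (f x)%:E < +oo)%E -> (\int[m]_x (g x)%:E < +oo)%E ->
  (\int[m]_x (f x + g x)%:E < +oo)%E.
Proof. by move=> mf mg f0 g0 fi gi; rewrite ge0_integralD_EFin// lte_add_pinfty. Qed.

Lemma ge0_le_Rintegral f g : measurable_fun setT f -> measurable_fun setT g ->
  (forall x, 0 <= f x <= g x) ->
  (\int[m]_x (g x)%:E < +oo)%E -> \int[m]_x f x <= \int[m]_x g x.
Proof.
move=> mf mg fg gi; have fi := ge0_integral_lty_le mf mg fg gi.
have f0 x : 0 <= f x by case/andP: (fg x).
have g0 x : 0 <= g x by exact: le_trans (f0 x) (proj2 (andP (fg x))).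
by apply: fine_le; rewrite ?ge0_fin_numE ?integral_EFin_ge0// ge0_le_integral_EFin.
Qed.

Lemma ge0_RintegralD f g : measurable_fun setT f -> measurable_fun setT g ->
  (forall x, 0 <= f x) -> (forall x, 0 <= g x) ->
  (\int[m]_x (f x)%:E < +oo)%E -> (\int[m]_x (g x)%:E < +oo)%E ->
  \int[m]_x (f x + g x) = \int[m]_x f x + \int[m]_x g x.
Proof.
move=> mf mg f0 g0 fi gi; rewrite /Rintegral ge0_integralD_EFin//.
by rewrite fineD// ge0_fin_numE// integral_EFin_ge0.
Qed.

(** [fine] sends an infinite integral to 0, so the identity survives divergence: both sides are then
    0. A negative [r] is reduced to [- r] by taking the sign out of the integral. *)
Lemma ge0_RintegralZl r f : measurable_fun setT f -> (forall x, 0 <= f x) ->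
  \int[m]_x (r * f x) = r * \int[m]_x f x.
Proof.
move=> mf f0.
have H s : 0 <= s -> \int[m]_x (s * f x) = s * \int[m]_x f x.
  move=> s0; rewrite /Rintegral ge0_integralZl_EFin//.
  have := integral_EFin_ge0 f0; case: (\int[m]_x (f x)%:E)%E => //= _.
  move: s0; rewrite le_eqVlt => /predU1P[<-|s0]; first by rewrite mul0e mul0r.
  by rewrite gt0_muley ?lte_fin// mulr0.
have [r0|r0] := leP 0 r; first exact: H.
have -> : \int[m]_x (r * f x) = - \int[m]_x (- r * f x).
  rewrite /Rintegral -fineN -integral_ge0N; last first.
    by move=> x _; rewrite lee_fin mulr_ge0// oppr_ge0 ltW.
  by congr fine; apply: eq_integral => x _; rewrite -EFinN mulNr opprK.
by rewrite H ?oppr_ge0 ?ltW// mulNr opprK.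
Qed.
End Ge0Integral.

(** * The fundamental theorem of calculus on sets exhausted by segments *)

Section ExhaustionFTC.
Context {R : realType}.
Notation mu := (@lebesgue_measure R).
Implicit Types (h g : R -> R) (a b l : R) (D : set R).

Lemma FTC2_segment h g a b : a < b ->
  (forall x, a <= x <= b -> is_derive x 1 h (g x)) ->
  (forall x, a <= x <= b -> {for x, continuous g}) ->
  (\int[mu]_(x in `[a, b]) (g x)%:E = (h b - h a)%:E)%E.
Proof.
move=> ab dh cg; rewrite EFinB; apply: continuous_FTC2 => //.
- apply: continuous_in_subspaceT => x; rewrite inE/= in_itv/= => xab.
  exact: cg.
- have ch x : a <= x <= b -> {for x, continuous h}.
    by move=> /dh hx; apply/differentiable_continuous/derivable1_diffP.
  split.
  + by move=> x /[!in_itv]/= /andP[ax xb]; have := dh x; rewrite !ltW//= => /(_ isT)[].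
  + apply: cvg_at_right_filter; apply: ch; lra.
  + apply: cvg_at_left_filter; apply: ch; lra.
- move=> x /[!in_itv]/= /andP[ax xb]; have := dh x; rewrite !ltW//= => /(_ isT).
  by move=> hx; rewrite derive1E derive_val.
Qed.

Section exhaustion.
Variables (D : set R) (a_ b_ : nat -> R).
Hypothesis ab : forall n, a_ n < b_ n.
Hypothesis nonincr_a : forall n, a_ n.+1 <= a_ n.
Hypothesis nondecr_b : forall n, b_ n <= b_ n.+1.
Hypothesis DE : \bigcup_n `[a_ n, b_ n]%classic = D.
Variables (h g : R -> R) (l : R).
Hypothesis dh : forall x, D x -> is_derive x 1 h (g x).
Hypothesis cg : forall x, D x -> {for x, continuous g}.
Hypothesis hl : h (b_ n) - h (a_ n) @[n --> \oo] --> l.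

Let subD n x : a_ n <= x <= b_ n -> D x.
Proof. by move=> xab; rewrite -DE; exists n => //=; rewrite in_itv. Qed.

Let FTCn n : (\int[mu]_(x in `[a_ n, b_ n]) (g x)%:E =
  (h (b_ n) - h (a_ n))%:E)%E.
Proof.
by apply: FTC2_segment => // x /subD; [exact: dh|exact: cg].
Qed.

Let mD : measurable D.
Proof. by rewrite -DE; apply: bigcup_measurable => n _; exact: measurable_itv. Qed.

Let nd : nondecreasing_seq (fun n => `[a_ n, b_ n]%classic).
Proof.
apply/nondecreasing_seqP => n; rewrite subsetEset => x /=; rewrite !in_itv/=.
move=> /andP[ax xb]; rewrite (le_trans _ ax)//= (le_trans xb)//.
Qed.

Let mg : measurable_fun D g.
Proof.
rewrite -DE; apply/measurable_fun_bigcup; first by move=> n; exact: measurable_itv.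
move=> n; apply: subspace_continuous_measurable_fun; first exact: measurable_itv.
apply: continuous_in_subspaceT => x; rewrite inE/= in_itv/= => /subD.
exact: cg.
Qed.

Let subn n : `[a_ n, b_ n]%classic `<=` D.
Proof. by move=> x /=; rewrite in_itv/= => /subD. Qed.

(** Monotone convergence along the segments, on each of which the integral is an increment of [h];
    finiteness comes out as a result. *)
Lemma ge0_exhaustion_FTC2 : (forall x, D x -> 0 <= g x) ->
  (\int[mu]_(x in D) (g x)%:E = l%:E)%E.
Proof.
move=> g0.
have cv : (\int[mu]_(x in `[a_ n, b_ n]) (g x)%:E @[n --> \oo] -->
    \int[mu]_(x in D) (g x)%:E)%E.
  have := @ge0_nondecreasing_set_cvg_integral _ (measurableTypeR R) R
    (fun n => `[a_ n, b_ n]%classic) (EFin \o g) (@lebesgue_measure R) nd (fun n => measurable_itv _).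
  rewrite DE; apply.
    move=> n; apply/measurable_EFinP; exact: (measurable_funS mD (@subn n)).
  by move=> n x /subn /g0; rewrite lee_fin.
rewrite (eq_cvg _ _ FTCn) in cv.
apply: cvg_unique cv _ => //.
exact: cvg_comp hl _.
Qed.

(** For a [g] without sign, dominated convergence: the restrictions to the segments are bounded by
    [|g|], and at each point of [D] they are eventually equal to [g]. *)
Lemma exhaustion_FTC2 : mu.-integrable D (EFin \o g) ->
  (\int[mu]_(x in D) (g x)%:E = l%:E)%E.
Proof.
move=> ig.
pose f_ n := (EFin \o g) \_ `[a_ n, b_ n]%classic.
have mf : measurable_fun D (EFin \o g) by exact/measurable_EFinP.
have [] := @dominated_convergence _ _ R (@lebesgue_measure R) D mD f_ (EFin \o g)
  (abse \o (EFin \o g)).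
- move=> n; apply: (measurable_funS measurableT) => //.
  apply/(measurable_restrictT _ (measurable_itv _)).
  exact: (measurable_funS mD (@subn n)).
- exact: mf.
- apply: aeW => x Dx.
  have := Dx; rewrite -{1}DE => -[N _ /= xN].
  apply: cvg_near_cst; exists N => // n /= Nn.
  rewrite /f_ patchE mem_set//.
  by have := nd Nn; rewrite subsetEset; exact.
- exact: integrable_abse.
- apply: aeW => x n Dx; rewrite /f_ patchE; case: ifPn => // _.
  by rewrite (_ : point = 0%E :> \bar R)// abse0 abse_ge0.
move=> _ _ cv.
apply: cvg_unique cv _ => //=.
rewrite (_ : (fun n => _) = (fun n => (h (b_ n) - h (a_ n))%:E)).
  exact: cvg_comp hl _.
apply/funext => n /=; rewrite -FTCn /f_ -integral_mkcondr.
by rewrite (setIidr (@subn n)).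
Qed.
End exhaustion.
End ExhaustionFTC.

(** * Affine substitutions and inversion *)

Section ChangeOfVariables.
Context {R : realType}.
Notation mu := (@lebesgue_measure R).

(** The image of Lebesgue measure under x -> a x + b, multiplied by a, has the right value on every
    interval ]u, v], hence is Lebesgue measure by uniqueness. The formula is then the one for
    push-forward measures. *)
Lemma ge0_integral_affine (a b : R) (f : R -> \bar R) : 0 < a ->
  measurable_fun [set: R] f -> (forall x, (0 <= f x)%E) ->
  (a%:E * \int[mu]_x f (a * x + b)%R = \int[mu]_x f x)%E.
Proof.
move=> a0 mf f0.
pose phi (x : measurableTypeR R) : measurableTypeR R := a * x + b.
have mphi : measurable_fun setT phi.
  by apply: measurable_funD => //; exact: mulrl_measurable.
pose m0 : {measure set (measurableTypeR R) -> \bar R} :=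
  measure_function_pushforward__canonical__measure_function_Measure mu mphi.
pose m : {measure set (measurableTypeR R) -> \bar R} :=
  mscale (NngNum (ltW a0)) m0.
have mE A : measurable A -> mu A = m A.
  apply: (@lebesgue_measure_unique R m) => _ [[u v]] _ <-.
  pose I : set R := `](u - b) / a, (v - b) / a]%classic.
  have -> : m `]u, v]%classic = (a%:E * mu I)%E.
    congr (_ * mu _)%E; rewrite /I; apply/seteqP; split => x /=;
      rewrite !in_itv/= /phi ltr_pdivrMr// ler_pdivlMr//;
      by rewrite ltrBlDr lerBrDr mulrC.
  rewrite /I !lebesgue_measure_itv/= !lte_fin ltr_pM2r ?invr_gt0// ltrD2r.
  rewrite /I; case: ifPn => _; last by rewrite mule0.
  by rewrite -!EFinB -EFinM; congr EFin; field; rewrite gt_eqF.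
rewrite [RHS](@eq_measure_integral _ _ _ _ m); last by move=> A mA _; exact: mE.
rewrite ge0_integral_mscale//=.
by rewrite (@ge0_integral_pushforward _ _ _ _ _ phi mphi mu setT f).
Qed.

Lemma ge0_integral_scale (a : R) (f : R -> \bar R) : 0 < a ->
  measurable_fun [set: R] f -> (forall x, (0 <= f x)%E) ->
  (a%:E * \int[mu]_x f (a * x)%R = \int[mu]_x f x)%E.
Proof.
move=> a0 mf f0; have := ge0_integral_affine 0 a0 mf f0.
by under eq_integral do rewrite addr0.
Qed.

Lemma ge0_integral_shift (b : R) (f : R -> \bar R) :
  measurable_fun [set: R] f -> (forall x, (0 <= f x)%E) ->
  (\int[mu]_x f (x + b)%R = \int[mu]_x f x)%E.
Proof.
move=> mf f0; have := ge0_integral_affine b ltr01 mf f0.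
by rewrite mul1e; under eq_integral do rewrite mul1r.
Qed.

(** Starting at 2 makes the endpoints strictly ordered for every n; the segments are also stable
    under inversion, which [ge0_integral_inv] uses. *)
Lemma bigcup_itv_inv_gt0 :
  \bigcup_n `[n.+2%:R^-1, n.+2%:R]%classic = `]0, +oo[%classic :> set R.
Proof.
apply/seteqP; split=> [x [n _ /=]|x /=]; rewrite !in_itv/= ?andbT.
  by move=> /andP[+ _]; apply: lt_le_trans; rewrite invr_gt0.
move=> x0; pose y := Num.max x x^-1.
exists (Num.truncn y) => //=; rewrite in_itv/=.
have yn : y <= (Num.truncn y).+2%:R.
  by rewrite (le_trans (ltW (truncnS_gt _)))// ler_nat.
apply/andP; split.
  rewrite -[leRHS]invrK lef_pV2 ?posrE ?invr_gt0//.
  by rewrite (le_trans _ yn)// /y le_max lexx orbT.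
by rewrite (le_trans _ yn)// /y le_max lexx.
Qed.

Lemma nat2_inv_lt (n : nat) : (n.+2%:R)^-1 < n.+2%:R :> R.
Proof. by rewrite (@lt_trans _ _ 1)// ?invf_lt1 ?ltr1n. Qed.

Lemma nat2_inv_noninc (n : nat) : (n.+3%:R)^-1 <= (n.+2%:R)^-1 :> R.
Proof. by rewrite lef_pV2 ?posrE// ler_nat. Qed.

Lemma cvg_nat2 : (n.+2%:R : R) @[n --> \oo] --> +oo.
Proof.
apply/cvgryPge => A; near=> n.
rewrite (@le_trans _ _ n%:R) ?ler_nat//; last by rewrite ltnW.
near: n; exact: nbhs_infty_ger.
Unshelve. end_near. Qed.

Lemma cvg_nat2V : (n.+2%:R^-1 : R) @[n --> \oo] --> 0.
Proof. by apply/gtr0_cvgV0; [exact: nearW|exact: cvg_nat2]. Qed.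

(** Decreasing substitution x -> 1/x on the segments [1/N, N], which inversion maps to themselves;
    both sides then pass to the half-line by monotone convergence. *)
Lemma ge0_integral_inv (g : R -> R) :
  (forall x : R, 0 < x -> {for x, continuous g}) -> (forall x : R, 0 < x -> 0 <= g x) ->
  (\int[mu]_(x in `]0%R, +oo[) (g x^-1 * x ^- 2)%:E =
   \int[mu]_(x in `]0%R, +oo[) (g x)%:E)%E.
Proof.
move=> cg g0.
pose D n : set R := `[n.+2%:R^-1, n.+2%:R]%classic.
have D0 n (x : R) : x \in `[n.+2%:R^-1, n.+2%:R] -> 0 < x.
  by rewrite in_itv/= => /andP[+ _]; apply: lt_le_trans; rewrite invr_gt0.
have nd : nondecreasing_seq D.
  apply/nondecreasing_seqP => n; rewrite subsetEset => x; rewrite /D/= !in_itv/=.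
  move=> /andP[ax xb]; rewrite (le_trans _ ax)//= ?nat2_inv_noninc//.
  by rewrite (le_trans xb)// ler_nat.
have mc (h : R -> R) : (forall x : R, 0 < x -> {for x, continuous h}) ->
    forall n, measurable_fun (D n) (EFin \o h).
  move=> ch n; apply/measurable_EFinP.
  apply: subspace_continuous_measurable_fun; first exact: measurable_itv.
  by apply: continuous_in_subspaceT => x; rewrite inE => /D0; exact: ch.
have cgV (x : R) : 0 < x -> {for x, continuous (fun y : R => g y^-1 * y ^- 2)}.
  move=> x0; apply: cvgM.
    apply: (@continuous_comp _ _ _ (fun y : R => y^-1) g).
      by apply: inv_continuous; rewrite gt_eqF.
    by apply: cg; rewrite invr_gt0.
  apply: (@continuous_comp _ _ _ (fun y : R => y ^+ 2) (fun y : R => y^-1)).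
    exact: exprn_continuous.
  by apply: inv_continuous; rewrite expf_eq0/= gt_eqF.
have cv (h : R -> R) : (forall x : R, 0 < x -> {for x, continuous h}) ->
    (forall x : R, 0 < x -> 0 <= h x) ->
    (\int[mu]_(x in D n) (h x)%:E @[n --> \oo] -->
     \int[mu]_(x in `]0%R, +oo[) (h x)%:E)%E.
  move=> ch h0.
  have := @ge0_nondecreasing_set_cvg_integral _ (measurableTypeR R) R
    D (EFin \o h) (@lebesgue_measure R) nd (fun n => measurable_itv _).
  rewrite bigcup_itv_inv_gt0; apply; first exact: mc.
  by move=> n x /D0 x0; rewrite lee_fin h0.
have cv1 := cv _ cgV (fun x x0 => mulr_ge0 (g0 _ (etrans (invr_gt0 x) x0))
  (etrans (invr_ge0 _) (exprn_ge0 _ (ltW x0)))).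
have cv2 := cv g cg g0.
have E n : (\int[mu]_(x in D n) (g x^-1 * x ^- 2)%:E =
             \int[mu]_(x in D n) (g x)%:E)%E.
    have dV (x : R) : 0 < x -> is_derive x 1 (fun y : R => y^-1) (- x ^- 2).
      move=> x0; have := @is_deriveV _ id x 1 1 (lt0r_neq0 x0) _.
      by rewrite /GRing.scale/= mulr1; apply; exact: is_derive_id.
    have dVE (x : R) : 0 < x -> derive1 (fun y : R => y^-1) x = - x ^- 2.
      by move=> x0; rewrite derive1E; have := dV _ x0 => ?; exact: derive_val.
    have cVE (x : R) : 0 < x -> {for x, continuous (fun y : R => - y ^- 2)}.
      move=> x0; apply: cvgN.
      apply: (@continuous_comp _ _ _ (fun y : R => y ^+ 2) (fun y : R => y^-1)).
        exact: exprn_continuous.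
      by apply: inv_continuous; rewrite expf_eq0/= gt_eqF.
    have cV (x : R) : 0 < x -> {for x, continuous (derive1 (fun y : R => y^-1))}.
      move=> x0; rewrite /prop_for /continuous_at dVE//.
      apply: cvg_trans (cVE _ x0); apply: near_eq_cvg; near=> y.
      by rewrite dVE//; near: y; exact: lt_nbhsr.
    have iV (x : R) : 0 < x -> {for x, continuous (fun y : R => y^-1)}.
      by move=> x0; apply: inv_continuous; rewrite gt_eqF.
    have n0 : 0 < (n.+2%:R : R) by [].
    have n'0 : 0 < (n.+2%:R^-1 : R) by rewrite invr_gt0.
  have := @integration_by_substitution_decreasing R (fun y => y^-1) g
      n.+2%:R^-1 n.+2%:R (ltW (nat2_inv_lt n)).
    rewrite invrK -/(D n) => ->.
    - apply: eq_integral => x; rewrite inE => /D0 x0.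
      congr EFin.
      rewrite -[RHS]/(g x^-1 * - derive1 (fun y : R => y^-1) x).
      by rewrite dVE// opprK.
    - move=> x y /D0 x0 /D0 y0 xy; by rewrite ltf_pV2.
    - move=> x /[!in_itv]/= /andP[ax _]; apply: cV; exact: lt_trans ax.
    - by apply/cvg_ex; eexists; apply/cvg_at_right_filter; exact: cV.
    - by apply/cvg_ex; eexists; apply/cvg_at_left_filter; exact: cV.
    - split.
      + move=> x /[!in_itv]/= /andP[ax _].
        by have ? := dV x (lt_trans n'0 ax); exact: ex_derive.
      + by apply/cvg_at_right_filter; exact: iV.
      + by apply/cvg_at_left_filter; exact: iV.
    - apply: continuous_in_subspaceT => x; rewrite inE/= => /D0; exact: cg.
rewrite (eq_cvg _ _ E) in cv1.
exact: cvg_unique cv1 cv2.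
Unshelve. all: end_near. Qed.
End ChangeOfVariables.

Section HalfLineFTC.
Context {R : realType}.
Notation mu := (@lebesgue_measure R).
Variables (h g : R -> R) (l0 l1 : R).
Hypothesis dh : forall x : R, 0 < x -> is_derive x 1 h (g x).
Hypothesis cg : forall x : R, 0 < x -> {for x, continuous g}.
Hypothesis hl0 : h x @[x --> 0^'+] --> l0.
Hypothesis hl1 : h x @[x --> +oo] --> l1.

Let hl : h n.+2%:R - h n.+2%:R^-1 @[n --> \oo] --> l1 - l0.
Proof.
apply: cvgB.
  by move/cvg_pinftyP : hl1; apply; exact: cvg_nat2.
move/cvg_at_rightP : hl0; apply; split; last exact: cvg_nat2V.
by move=> n; rewrite invr_gt0.
Qed.

Lemma ge0_FTC2_0y : (forall x, 0 < x -> 0 <= g x) ->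
  (\int[mu]_(x in `]0%R, +oo[) (g x)%:E = (l1 - l0)%:E)%E.
Proof.
move=> g0; apply: (ge0_exhaustion_FTC2 (@nat2_inv_lt R) (@nat2_inv_noninc R)
   _ bigcup_itv_inv_gt0 _ _ hl).
- by move=> n; rewrite ler_nat.
- by move=> x; rewrite /= in_itv/= andbT; exact: dh.
- by move=> x; rewrite /= in_itv/= andbT; exact: cg.
- by move=> x; rewrite /= in_itv/= andbT; exact: g0.
Qed.

Lemma FTC2_0y : mu.-integrable `]0, +oo[ (EFin \o g) ->
  (\int[mu]_(x in `]0%R, +oo[) (g x)%:E = (l1 - l0)%:E)%E.
Proof.
move=> ig; apply: (exhaustion_FTC2 (@nat2_inv_lt R) (@nat2_inv_noninc R)
   _ bigcup_itv_inv_gt0 _ _ hl) => //.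
- by move=> n; rewrite ler_nat.
- by move=> x; rewrite /= in_itv/= andbT; exact: dh.
- by move=> x; rewrite /= in_itv/= andbT; exact: cg.
Qed.
End HalfLineFTC.

Section LineFTC.
Context {R : realType}.
Notation mu := (@lebesgue_measure R).

Lemma bigcup_itv_sym : \bigcup_n `[- n.+1%:R, n.+1%:R]%classic = setT :> set R.
Proof.
apply/seteqP; split => // x _; exists (Num.truncn `|x|) => //=.
by rewrite in_itv/= -ler_norml (le_trans (ltW (truncnS_gt _))).
Qed.

(** The form in which integration by parts against a Gaussian is used: [h] is the boundary term. *)
Lemma FTC2_NyyT (h g : R -> R) :
  (forall x : R, is_derive x 1 h (g x)) -> continuous g ->
  h x @[x --> -oo] --> (0 : R) -> h x @[x --> +oo] --> (0 : R) ->
  mu.-integrable setT (EFin \o g) ->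
  (\int[mu]_x (g x)%:E = 0)%E.
Proof.
move=> dh cg hN hy ig.
have cy : (n.+1%:R : R) @[n --> \oo] --> +oo.
  apply/cvgryPge => A; near=> n.
  rewrite (@le_trans _ _ n%:R) ?ler_nat//.
  near: n; exact: nbhs_infty_ger.
apply: (exhaustion_FTC2 _ _ _ bigcup_itv_sym _ _ _ ig) => //.
- by move=> n; rewrite -subr_gt0 opprK addr_gt0.
- by move=> n; rewrite lerN2 ler_nat.
- by move=> n; rewrite ler_nat.
- by move=> x _; exact: cg.
rewrite -[X in _ --> X]subr0; apply: cvgB.
  by move/cvg_pinftyP : hy; apply.
by move/cvgNy_compNP/cvg_pinftyP : hN; exact.
Unshelve. end_near. Qed.
End LineFTC.

(** * The Gamma function *)

Section RealPowers.
Context {R : realType}.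
Implicit Types (s u x t b : R).

Lemma ler_powRl b x u : 0 <= b -> 0 <= x -> x <= u -> x `^ b <= u `^ b.
Proof.
move=> b0 x0 xu; apply: ge0_ler_powR => //; rewrite nnegrE//.
exact: le_trans xu.
Qed.

(** Concavity: the right-hand side is the tangent of u^s at 1. The proof is Jensen's inequality for
    ln at the points u and 1, with weights s and 1 - s and mean m, reduced to ln x <= x - 1 at x =
    u/m and x = 1/m. *)
Lemma powR_le_affine u s : 0 <= s <= 1 -> 0 <= u -> u `^ s <= 1 - s + s * u.
Proof.
move=> /andP[s0 s1]; rewrite le_eqVlt => /predU1P[<-|u0].
  rewrite mulr0 addr0; have [->|s_neq0] := eqVneq s 0; first by rewrite powRr0 subr0.
  by rewrite powR0// subr_ge0.
have su0 : 0 <= s * u by rewrite mulr_ge0// ltW.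
set m := 1 - s + s * u.
have m0 : 0 < m.
  rewrite /m; have [->|s_neq1] := eqVneq s 1; first by rewrite mul1r; lra.
  have : s < 1 by rewrite lt_neqAle s_neq1.
  lra.
rewrite -ler_ln ?posrE ?powR_gt0// ln_powR.
have h1 : ln (u / m) <= u / m - 1.
  by have := @le_ln1Dx R (u / m - 1); rewrite addrCA subrr addr0; apply;
    rewrite ltrBrDl subrr divr_gt0.
have h2 : ln (m^-1) <= m^-1 - 1.
  by have := @le_ln1Dx R (m^-1 - 1); rewrite addrCA subrr addr0; apply;
    rewrite ltrBrDl subrr invr_gt0.
rewrite lnM ?posrE ?invr_gt0// in h1; rewrite lnV ?posrE// in h1 h2.
(* The weighted mean of the two upper bounds vanishes since m is the mean of u and 1; what is left
   says s ln u <= ln m. *)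
have e : s * (u / m - 1) + (1 - s) * (m^-1 - 1) = 0.
  by rewrite /m; field; rewrite -/m gt_eqF.
have := ler_wpM2l s0 h1.
have s1' : 0 <= 1 - s by lra.
have := ler_wpM2l s1' h2.
nra.
Qed.

(** [powR_le_affine] with exponent 1/b at the point 1 - b x gives (1 - b x)^(1/b) <= 1 - x, and
    raising to the power b finishes. A negative left-hand side is trivial. *)
Lemma bernoulli_powR b x : 1 <= b -> 0 <= x <= 1 -> 1 - b * x <= (1 - x) `^ b.
Proof.
move=> b1 /andP[x0 x1].
have [h|h] := leP (1 - b * x) 0; first by rewrite (le_trans h)// powR_ge0.
have b0 : 0 < b by lra.
have := @powR_le_affine (1 - b * x) b^-1.
rewrite invr_ge0 ltW//= invf_le1// => /(_ b1 (ltW h)).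
have -> : 1 - b^-1 + b^-1 * (1 - b * x) = 1 - x by field; rewrite gt_eqF.
move=> h1; have -> : 1 - b * x = ((1 - b * x) `^ b^-1) `^ b.
  by rewrite -powRrM mulVf ?gt_eqF// powRr1 ?ltW.
by apply: ler_powRl h1; rewrite ?powR_ge0 ?ltW.
Qed.

(** The m-th power of 1 + t <= m (1 + t/m) <= m e^(t/m). It bounds e^(-t) by a negative power of 1 +
    t. *)
Lemma powR1D_le_expR (m t : R) : 1 <= m -> 0 <= t ->
  (1 + t) `^ m <= m `^ m * expR t.
Proof.
move=> m1 t0; have m0 : 0 < m by lra.
have -> : expR t = (expR (t / m)) `^ m.
  by rewrite /powR gt_eqF ?expR_gt0// expRK mulrC divfK// gt_eqF.
rewrite -powRM ?expR_ge0 ?(ltW m0)//; apply: ler_powRl; rewrite ?addr_ge0 ?(ltW m0)//.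
rewrite (@le_trans _ _ (m * (1 + t / m)))//.
  by rewrite mulrDr mulr1 mulrCA divff ?gt_eqF// mulr1 lerD2r.
by rewrite ler_pM2l// expR_ge1Dx.
Qed.
End RealPowers.

Section GammaFunction.
Context {R : realType}.
Notation mu := (@lebesgue_measure R).
Implicit Types (s t x : R).

Lemma continuous_powRl (a x : R) : 0 < x -> {for x, continuous (@powR R ^~ a)}.
Proof.
move=> x0; apply/differentiable_continuous/derivable1_diffP.
by apply: derivable_powR; rewrite in_itv/= andbT.
Qed.

Lemma continuous_gamma_integrand s t : 0 < t ->
  {for t, continuous (fun t : R => t `^ (s - 1) * expR (- t))}.
Proof.
move=> t0; apply: cvgM; first exact: continuous_powRl.
apply: (@continuous_comp _ _ _ (fun y : R => - y) expR).
  exact: opp_continuous.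
exact: continuous_expR.
Qed.

Lemma measurable_itvR (i : interval R) :
  measurable ([set` i] : set (measurableTypeR R)).
Proof. exact: measurable_itv. Qed.

Lemma measurable_fun_0y (g : R -> R) :
  (forall x : R, 0 < x -> {for x, continuous g}) ->
  measurable_fun (`]0, +oo[%classic : set R) g.
Proof.
move=> cg; apply: open_continuous_measurable_fun; first exact: interval_open.
by move=> x; rewrite inE/= in_itv/= andbT; exact: cg.
Qed.

Lemma measurable_gamma_integrand s (D : set R) :
  measurable_fun D (fun t : R => t `^ (s - 1) * expR (- t)).
Proof.
apply: (measurable_funS measurableT) => //; apply: measurable_funM.
  exact: measurable_powR.
by apply: measurableT_comp => //; exact: measurable_expR.
Qed.

(** The derivative of (t/(1+t))^s, which grows from 0 to 1 on the half-line. It behaves like t^(s-1)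
    at 0 and like t^(-2) at infinity, so it can dominate Euler's integrand at both ends. *)
Let majorant s t := s * (t / (1 + t)) `^ (s - 1) * (1 + t) ^- 2.

Let continuous_majorant s (t : R) : 0 < t -> {for t, continuous (majorant s)}.
Proof.
move=> t0; apply: cvgM; last first.
  apply: (@continuous_comp _ _ _ (fun t : R => (1 + t) ^+ 2) (fun y : R => y^-1)).
    apply: (@continuous_comp _ _ _ (fun t : R => 1 + t) (fun y : R => y ^+ 2)).
      by apply: cvgD; [exact: cvg_cst|exact: cvg_id].
    exact: exprn_continuous.
  by apply: inv_continuous; rewrite expf_eq0/= gt_eqF// addr_gt0.
apply: cvgM; first exact: cvg_cst.
apply: (@continuous_comp _ _ _ (fun t : R => t / (1 + t)) (@powR R ^~ (s - 1))).
  apply: cvgM; first exact: cvg_id.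
  apply: (@continuous_comp _ _ _ (fun t : R => 1 + t) (fun y : R => y^-1)).
    by apply: cvgD; [exact: cvg_cst|exact: cvg_id].
  by apply: inv_continuous; rewrite gt_eqF// addr_gt0.
by apply: continuous_powRl; rewrite divr_gt0// addr_gt0.
Qed.

Let integral_majorant s : 0 < s ->
  (\int[mu]_(t in `]0%R, +oo[) (majorant s t)%:E = 1)%E.
Proof.
move=> s0.
have pos (t : R) : 0 < t -> 0 < 1 - (1 + t)^-1.
  by move=> t0; rewrite subr_gt0 invf_lt1; lra.
have posE (t : R) : 0 < t -> t / (1 + t) = 1 - (1 + t)^-1.
  by move=> t0; field; lra.
have := @ge0_FTC2_0y R (fun t => (1 - (1 + t)^-1) `^ s) (majorant s) 0 1.
rewrite subr0; apply.
- move=> t t0; have t1 : 1 + t != 0 by lra.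
  have d1 : is_derive t (1 : R) (fun t : R => 1 - (1 + t)^-1) ((1 + t) ^- 2).
    have d0 : is_derive t (1 : R) (fun t : R => 1 + t) 1.
      by apply: is_derive_eq; rewrite add0r mulr1.
    have := @is_deriveV _ (fun t : R => 1 + t) t 1 1 t1 d0.
    rewrite /GRing.scale/= mulr1 => d2.
    by apply: is_derive_eq; rewrite /GRing.scale/=; ring.
  have := @is_derive1_comp R (@powR R ^~ s) (fun t : R => 1 - (1 + t)^-1) t _ _
    (is_derive1_powR s (pos _ t0)) d1.
  by rewrite /majorant posE.
- exact: continuous_majorant.
- apply: (@squeeze_cvgr _ _ _ _ (cst 0) (fun t : R => t `^ s)).
  + near=> t; rewrite powR_ge0/=.
    have t0 : 0 < t by near: t; exact: nbhs_right_gt.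
    apply: ler_powRl; rewrite ?ltW ?pos//.
    rewrite -posE// ltr_pdivrMr; nra.
  + exact: cvg_cst.
  + exact: powR_cvg0.
- have c1 : 1 - (1 + x)^-1 @[x --> +oo] --> (1 : R).
    rewrite -[X in _ --> X]subr0; apply: cvgB; first exact: cvg_cst.
    apply/gtr0_cvgV0; first by near=> x; rewrite addr_gt0//; near: x; exact: nbhs_pinfty_gt.
    by apply: cvg_addrl; exact: cvg_id.
  have := @continuous_powRl s 1 ltr01.
  rewrite /prop_for /continuous_at powR1 => c2.
  exact: (cvg_comp _ _ c1 c2).
- move=> t t0; rewrite /majorant !mulr_ge0 ?powR_ge0 ?(ltW s0)//.
  by rewrite invr_ge0 exprn_ge0// addr_ge0// ltW.
Unshelve. all: end_near. Qed.

Lemma integrable_gamma s : 0 < s ->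
  mu.-integrable `]0, +oo[ (EFin \o (fun t => t `^ (s - 1) * expR (- t))).
Proof.
move=> s0.
(* The factor 1/s cancels the one in [majorant]; (s+1)^(s+1) is the constant of [powR1D_le_expR] for
   the exponent m = s + 1. *)
pose C := s^-1 * (s + 1) `^ (s + 1).
have i1 : mu.-integrable `]0, +oo[ (EFin \o majorant s).
  apply/integrableP; split.
    apply/measurable_EFinP; apply: measurable_fun_0y; exact: continuous_majorant.
  under eq_integral => t.
    rewrite inE/= in_itv/= andbT => t0; rewrite ger0_norm; last first.
      by rewrite /majorant !mulr_ge0 ?powR_ge0 ?invr_ge0 ?exprn_ge0 ?addr_ge0// ltW.
    over.
  by rewrite integral_majorant// ltry.
have iC := integrableZl (measurable_itvR _) C i1.
apply: le_integrable iC => //.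
- by apply/measurable_EFinP; exact: measurable_gamma_integrand.
- move=> t; rewrite /= in_itv/= andbT => t0.
  have t1 : 0 < 1 + t by lra.
  have s1 : 1 <= s + 1 by lra.
  have m0 : 0 <= majorant s t.
    by rewrite /majorant !mulr_ge0 ?powR_ge0 ?invr_ge0 ?exprn_ge0// ltW.
  rewrite lee_fin !ger0_norm ?mulr_ge0 ?powR_ge0 ?expR_ge0 ?invr_ge0 ?(ltW s0) ?exprn_ge0 ?(ltW t1)//.
  have -> : C * majorant s t =
      t `^ (s - 1) * ((s + 1) `^ (s + 1) / (1 + t) `^ (s + 1)).
    rewrite /C /majorant powRM ?invr_ge0 ?(ltW t0) ?(ltW t1)//.
    have -> : (1 + t)^-1 `^ (s - 1) = (1 + t) `^ 2 / (1 + t) `^ (s + 1).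
      rewrite -powR_inv1 ?(ltW t1)// -powRrM -powRB ?(gt_eqF t1) ?implybT//.
      by congr (_ `^ _); lra.
    rewrite powR_mulrn ?(ltW t1)//; field; rewrite !gt_eqF ?powR_gt0//.
  rewrite ler_wpM2l ?powR_ge0// ler_pdivlMr ?powR_gt0//.
  by rewrite expRN mulrC ler_pdivrMr ?expR_gt0// powR1D_le_expR// ltW.
Qed.

Lemma GammaE s : 0 < s ->
  (\int[mu]_(t in `]0%R, +oo[) (t `^ (s - 1) * expR (- t))%:E = (Gamma s)%:E)%E.
Proof.
move=> s0; rewrite /Gamma /Rintegral fineK//.
exact: (integrable_fin_num (measurable_itvR _) (integrable_gamma s0)).
Qed.

Lemma Gamma_gt0 s : 0 < s -> 0 < Gamma s.
Proof.
move=> s0; rewrite lt_neqAle -lee_fin -GammaE// integral_ge0 ?andbT; last first.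
  by move=> t _; rewrite lee_fin mulr_ge0 ?powR_ge0 ?expR_ge0.
rewrite eq_sym; apply/eqP => G0.
have := GammaE s0; rewrite G0 => I0.
(* A positive constant below the integrand on [1, 2]; the absolute value covers both signs of s -
   1. *)
have : (\int[mu]_(t in `[1%R, 2%R]) (expR (- 2) * 2 `^ (- `|s - 1|))%:E <= (0 : R)%:E)%E.
  rewrite -I0; apply: (@le_trans _ _
    (\int[mu]_(t in `[1%R, 2%R]) (t `^ (s - 1) * expR (- t))%:E)%E).
    apply: ge0_le_integral => //.
    - by apply/measurable_EFinP; exact: measurable_gamma_integrand.
    - move=> t; rewrite /= in_itv/= => /andP[t1 t2]; rewrite lee_fin mulrC.
      rewrite ler_pM ?powR_ge0 ?expR_ge0//; last by rewrite ler_expR lerN2.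
      rewrite (@le_trans _ _ (t `^ (- `|s - 1|)))//; last first.
        by rewrite ler_powR// lerNl ler_normr lexx orbT.
      rewrite !powRN lef_pV2 ?posrE ?powR_gt0 ?(lt_le_trans _ t1)//.
      by rewrite ler_powRl// (le_trans _ t1).
  apply: ge0_subset_integral => //.
  - by apply/measurable_EFinP; exact: measurable_gamma_integrand.
  - by move=> t _; rewrite lee_fin mulr_ge0 ?powR_ge0 ?expR_ge0.
  - by move=> t; rewrite /= !in_itv/= andbT => /andP[t1 _]; rewrite (lt_le_trans _ t1).
rewrite integral_cst//= lebesgue_measure_itv/= lte_fin ltr1n/= -EFinB -EFinM lee_fin.
by rewrite leNgt mulr_gt0// ?mulr_gt0 ?expR_gt0 ?powR_gt0// subr_gt0 ltr1n.
Qed.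

(** The function t^s e^(-t) vanishes at 0 and at infinity, so its derivative s t^(s-1) e^(-t) - t^s
    e^(-t) has integral 0. *)
Lemma GammaD1 s : 0 < s -> Gamma (s + 1) = s * Gamma s.
Proof.
move=> s0.
pose g1 t : R := t `^ (s - 1) * expR (- t).
pose g2 t : R := t `^ (s + 1 - 1) * expR (- t).
have i1 := integrable_gamma s0.
have s10 : 0 < s + 1 by lra.
have i2 := integrable_gamma s10.
have i1s := integrableZl (measurable_itvR _) s i1.
have i12 : mu.-integrable `]0, +oo[ (EFin \o (fun t => s * g1 t - g2 t)).
  exact: (integrableB (measurable_itvR _) i1s i2).
pose h (t : R) := t `^ s * expR (- t).
have I0 : (\int[mu]_(t in `]0%R, +oo[) (s * g1 t - g2 t)%:E = (0 - 0 : R)%:E)%E.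
  apply: (@FTC2_0y R h) => //.
  - move=> t t0.
    have d2 : is_derive t (1 : R) (fun t : R => expR (- t)) (- expR (- t)).
      by apply: is_derive_eq; rewrite /GRing.scale/=; ring.
    have d1 := is_derive1_powR s t0.
    have -> : h = (@powR R ^~ s) * (fun t : R => expR (- t)) by [].
    apply: is_derive_eq; rewrite /GRing.scale/= /g1 /g2 addrK; ring.
  - move=> t t0; apply: cvgB; last exact: continuous_gamma_integrand.
    by apply: cvgM; [exact: cvg_cst|exact: continuous_gamma_integrand].
  - have c2 : expR (- x) @[x --> (0:R)^'+] --> expR (- 0 : R).
      apply: cvg_at_right_filter.
      apply: (@continuous_comp _ _ _ (fun y : R => - y) expR).
        exact: opp_continuous.
      exact: continuous_expR.
    by have := cvgM (powR_cvg0 s0) c2; rewrite mul0r; exact.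
  (* [powR1D_le_expR] with m = s + 1 bounds t^(s+1) e^(-t), which leaves a spare factor 1/t. *)
  - apply: (@squeeze_cvgr _ _ _ _ (cst 0) (fun t : R => (s + 1) `^ (s + 1) * t^-1)).
    + near=> t.
      have t0 : 0 < t by near: t; exact: nbhs_pinfty_gt.
      rewrite mulr_ge0 ?powR_ge0 ?expR_ge0//= /h.
      rewrite expRN ler_pdivrMr ?expR_gt0// mulrAC ler_pdivlMr//.
      rewrite mulrC -{1}(powRr1 (ltW t0)) -powRD; last by rewrite (gt_eqF t0) implybT.
      have s11 : 1 <= s + 1 by lra.
      apply: (le_trans _ (powR1D_le_expR s11 (ltW t0))).
      by rewrite addrC; apply: ler_powRl => //; lra.
    + exact: cvg_cst.
    + rewrite -[X in _ --> X](mulr0 ((s + 1) `^ (s + 1))).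
      apply: cvgM; first exact: cvg_cst.
      apply/gtr0_cvgV0; last exact: cvg_id.
      by near=> x; near: x; exact: nbhs_pinfty_gt.
have E : (\int[mu]_(t in `]0%R, +oo[) (s * g1 t - g2 t)%:E =
    (s * Gamma s - Gamma (s + 1))%:E)%E.
  have -> := integralB (measurable_itvR _) i1s i2.
  by have -> := integralZl (measurable_itvR _) i1 s; rewrite !GammaE.
by move: I0; rewrite E subrr => -[] /eqP; rewrite subr_eq0 eq_sym => /eqP.
Unshelve. all: end_near. Qed.

End GammaFunction.

Section GammaIntegrals.
Context {R : realType}.
Notation mu := (@lebesgue_measure R).
Implicit Types (s t x : R).

(** Under the integral, (t/x)^s lies below its tangent at t = x ([powR_le_affine]). Integrating the
    tangent yields Gamma(x) and Gamma(x+1), and the functional equation merges them into one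
    term. *)
Lemma Gamma_wendel x s : 0 < x -> 0 <= s <= 1 ->
  Gamma (x + s) <= x `^ s * Gamma x.
Proof.
move=> x0 /[dup] s01 /andP[s0 s1].
have i1 := integrable_gamma x0.
have x10 : 0 < x + 1 by lra.
have i2 := integrable_gamma x10.
have xs0 : 0 < x + s by lra.
have i3 := integrable_gamma xs0.
have i1s := integrableZl (measurable_itvR _) ((1 - s) * x `^ s) i1.
have i2s := integrableZl (measurable_itvR _) (s * x `^ (s - 1)) i2.
have -> : x `^ s * Gamma x =
    (1 - s) * x `^ s * Gamma x + s * x `^ (s - 1) * Gamma (x + 1).
  rewrite GammaD1// powRB ?(gt_eqF x0) ?implybT// powRr1 ?(ltW x0)//.
  by field; rewrite gt_eqF.
rewrite -lee_fin EFinD (EFinM ((1 - s) * x `^ s)) (EFinM (s * x `^ (s - 1))).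
rewrite -(GammaE x0) -(GammaE x10) -(GammaE xs0).
rewrite -!(integralZl (measurable_itvR _))//.
rewrite -(integralD (measurable_itvR _) i1s i2s).
apply: le_integral => //.
  exact: (integrableD _ i1s i2s).
move=> t; rewrite inE/= in_itv/= andbT => t0.
rewrite -EFinM -EFinM -EFinD lee_fin.
have -> : x + s - 1 = s + (x - 1) by ring.
have -> : x + 1 - 1 = (x - 1) + 1 by ring.
rewrite (@powRD _ t s (x - 1)) ?(gt_eqF t0) ?implybT//.
rewrite (@powRD _ t (x - 1) 1) ?(gt_eqF t0) ?implybT// powRr1 ?(ltW t0)//.
have := @powR_le_affine R (t / x) s s01.
rewrite divr_ge0 ?(ltW t0) ?(ltW x0)// => /(_ isT).
rewrite powRM ?(ltW t0) ?invr_ge0 ?(ltW x0)//.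
rewrite -powR_inv1 ?(ltW x0)// -powRrM mulN1r powRN ler_pdivrMr ?powR_gt0// => H.
have k0 : 0 <= t `^ (x - 1) * expR (- t) by rewrite mulr_ge0 ?powR_ge0 ?expR_ge0.
rewrite -(mulrA (t `^ s)); apply: (le_trans (ler_wpM2r k0 H)).
have -> : x `^ (s - 1) = x `^ s / x.
  by rewrite (@powRB _ x s 1) ?(gt_eqF x0) ?implybT// powRr1 ?(ltW x0).
rewrite powR_inv1 ?(ltW x0)//; apply: le_of_eq; field; by rewrite gt_eqF.
Qed.

(** The truncated power (x-a)_+^e. The test is explicit because [powR] does not vanish on negative
    bases. *)
Definition pow_gt (a e x : R) : R := if a < x then (x - a) `^ e else 0.

Lemma pow_gt_ge0 a e x : 0 <= pow_gt a e x.
Proof. by rewrite /pow_gt; case: ifP => // _; exact: powR_ge0. Qed.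

Lemma measurable_pow_gt a e : measurable_fun setT (pow_gt a e).
Proof.
apply: measurable_fun_ifT => //; first exact: measurable_fun_ltr.
apply: (@measurableT_comp _ _ _ _ _ _ (@powR R ^~ e)); first exact: measurable_powR.
exact: measurable_funB.
Qed.

Lemma integral_gtr0 (f : R -> \bar R) :
  (\int[mu]_x ((if 0 < x then 1 else 0)%:E * f x) = \int[mu]_(x in `]0%R, +oo[) f x)%E.
Proof.
rewrite [RHS]integral_mkcond; apply: eq_integral => x _; rewrite patchE.
have [x0|x0] := ltP 0 x; first by rewrite mem_set ?mul1e//= in_itv/= x0.
by rewrite mul0e memNset//= in_itv/= andbT; apply/negP; rewrite -leNgt.
Qed.

(** A Laplace transform: shifting by a produces e^(-c a), scaling by c produces the power of c, and
    Euler's integral remains. *)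
Lemma integral_pow_gt_expR a e c : - 1 < e -> 0 < c ->
  (\int[mu]_x (pow_gt a e x * expR (- (c * x)))%:E =
   (Gamma (e + 1) * c `^ (- (e + 1)) * expR (- (c * a)))%:E)%E.
Proof.
move=> e1 c0.
have mf b d : measurable_fun [set: R] (fun x => (pow_gt b e x * expR (- (d * x)))%:E).
  apply/measurable_EFinP/measurable_funM; first exact: measurable_pow_gt.
  by apply: measurable_expRN; exact: mulrl_measurable.
have f0 b d x : (0 <= (pow_gt b e x * expR (- (d * x)))%:E)%E.
  by rewrite lee_fin mulr_ge0 ?pow_gt_ge0 ?expR_ge0.
have Zc d k : 0 <= k -> (\int[mu]_x (k%:E * (pow_gt 0 e x * expR (- (d * x)))%:E) =
    k%:E * \int[mu]_x (pow_gt 0 e x * expR (- (d * x)))%:E)%E.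
  by move=> k0; apply: ge0_integralZl => //; exact: mf.
rewrite -(ge0_integral_shift a (mf a c) (f0 a c)).
transitivity (\int[mu]_x ((expR (- (c * a)))%:E * (pow_gt 0 e x * expR (- (c * x)))%:E))%E.
  apply: eq_integral => x _; rewrite -EFinM; congr EFin.
  have -> : pow_gt a e (x + a) = pow_gt 0 e x.
    by rewrite /pow_gt addrK subr0; congr (if _ then _ else _); lra.
  by rewrite mulrDr opprD expRD; ring.
rewrite Zc ?expR_ge0//.
have := ge0_integral_scale c0 (mf 0 1) (f0 0 1).
have -> : (\int[mu]_x (pow_gt 0 e x * expR (- (1 * x)))%:E = (Gamma (e + 1))%:E)%E.
  rewrite -GammaE; last by lra.
  rewrite -integral_gtr0; apply: eq_integral => x _.
  rewrite -EFinM; congr EFin; rewrite /pow_gt subr0 mul1r addrK.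
  by case: ifP => _; rewrite ?mul0r ?mul1r.
have -> : (\int[mu]_x (pow_gt 0 e (c * x) * expR (- (1 * (c * x))))%:E =
   (c `^ e)%:E * \int[mu]_x (pow_gt 0 e x * expR (- (c * x)))%:E)%E.
  rewrite -Zc ?powR_ge0//.
  apply: eq_integral => x _; rewrite -EFinM; congr EFin.
  rewrite mul1r /pow_gt pmulr_rgt0// !subr0; case: ifP => [x0|_]; last by ring.
  by rewrite powRM ?(ltW c0) ?(ltW x0)//; ring.
have ce : c * c `^ e = c `^ (e + 1).
  by rewrite -[X in X * _](powRr1 (ltW c0)) -powRD ?(gt_eqF c0) ?implybT// addrC.
rewrite muleA -EFinM ce => E.
have -> : (\int[mu]_x (pow_gt 0 e x * expR (- (c * x)))%:E =
    (Gamma (e + 1) * c `^ (- (e + 1)))%:E)%E.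
  rewrite mulrC EFinM -E muleA -EFinM -powRD ?(gt_eqF c0) ?implybT//.
  by rewrite addNr powRr0 mul1e.
by rewrite -EFinM mulrC.
Qed.

(** The substitution x -> 1/x leads to the Laplace transform of x^(s-1). This evaluates a mixture of
    the e^(-pi t/v) whose weight is a pure power, with which the truncated mixtures are compared. *)
Lemma integral_pow_gt_expR_inv s c : 0 < s -> 0 < c ->
  (\int[mu]_x (pow_gt 0 (- s - 1) x * expR (- (c / x)))%:E =
   (Gamma s * c `^ (- s))%:E)%E.
Proof.
move=> s0 c0.
have := @integral_pow_gt_expR 0 (s - 1) c.
rewrite mulr0 oppr0 expR0 mulr1 subrK => <-; [|lra|by []].
have E (g h : R -> R) : (forall x, h x = (if 0 < x then 1 else 0) * g x) ->
    (\int[mu]_x (h x)%:E = \int[mu]_(x in `]0%R, +oo[) (g x)%:E)%E.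
  move=> gh; rewrite -integral_gtr0; apply: eq_integral => x _.
  by rewrite gh EFinM.
rewrite [RHS](E (fun x => x `^ (s - 1) * expR (- (c * x)))); last first.
  by move=> x; rewrite /pow_gt subr0; case: ifP => _; rewrite ?mul0r ?mul1r.
rewrite -(@ge0_integral_inv R (fun x => x `^ (s - 1) * expR (- (c * x)))).
- apply: E => x; rewrite /pow_gt subr0; case: ifP => [x0|_]; last by rewrite !mul0r.
  rewrite mul1r mulrAC; congr (_ * _).
  rewrite -powR_inv1 ?(ltW x0)// -powRrM -powR_invn ?(ltW x0)//.
  rewrite -powRD ?(gt_eqF x0) ?implybT//; congr (_ `^ _); ring.
- move=> x x0; apply: cvgM; first exact: continuous_powRl.
  apply: (@continuous_comp _ _ _ (fun y : R => - (c * y)) expR).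
    by apply: cvgN; apply: cvgM; [exact: cvg_cst|exact: cvg_id].
  exact: continuous_expR.
- by move=> x x0; rewrite mulr_ge0 ?powR_ge0 ?expR_ge0.
Qed.
End GammaIntegrals.

(** * Radial integrals on the plane *)

Section HalfLineMeasure.
Context {R : realType}.
Notation mu := (@lebesgue_measure R).
Notation mR := (measurableTypeR R).
Variables (nu : {measure set mR -> \bar R}) (c : R).
Hypothesis c_gt0 : 0 < c.
Hypothesis nu_le0 : nu `]-oo, 0]%classic = 0%E.
Hypothesis nu0t : forall t : R, 0 <= t -> nu `]0, t]%classic = (c * t)%:E.

Let nu_itv (u v : R) : 0 <= u -> u <= v -> nu `]u, v]%classic = (c * (v - u))%:E.
Proof.
move=> u0 uv.
have : nu `]0, v]%classic = (nu `]0%R, u]%classic + nu `]u, v]%classic)%E.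
  rewrite -measureU; try exact: measurable_itvR.
    congr (nu _); apply/seteqP; split=> x /=; rewrite !in_itv/=.
      by move=> /andP[? ?]; case: (leP x u) => xu; [left|right]; apply/andP; split; lra.
    by move=> [|] /andP[? ?]; apply/andP; split; lra.
  by apply/seteqP; split=> x //=; rewrite !in_itv/= => -[/andP[? ?] /andP[? ?]]; lra.
rewrite !nu0t//; last exact: le_trans uv.
have nuf : nu `]u, v]%classic \is a fin_num.
  rewrite ge0_fin_numE//; apply: (@le_lt_trans _ _ (nu `]0, v]%classic)).
    apply: le_measure; rewrite ?inE; try exact: measurable_itvR.
    by move=> x /=; rewrite !in_itv/= => /andP[? ?]; apply/andP; split; lra.
  by rewrite nu0t ?ltry//; exact: le_trans uv.
rewrite -(fineK nuf) -EFinD => -[]; rewrite mulrBr => ->.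
by rewrite addrAC subrr add0r.
Qed.

Let nu_max (u v : R) : u <= v ->
  nu `]u, v]%classic = (c * (Num.max v 0 - Num.max u 0))%:E.
Proof.
move=> uv; have nu0 (w : R) : w <= 0 -> nu `]u, w]%classic = 0%E.
  move=> w0; apply/eqP; rewrite eq_le measure_ge0 andbT -nu_le0.
  apply: le_measure; rewrite ?inE; try exact: measurable_itvR.
  by move=> x /=; rewrite !in_itv/= => /andP[? ?]; lra.
have [u0|u0] := leP 0 u.
  have v0 : 0 <= v by lra.
  by rewrite (max_idPl v0) nu_itv.
have [v0|v0] := leP v 0; first by rewrite nu0// subrr mulr0.
have -> : nu `]u, v]%classic = (nu `]u, 0%R]%classic + nu `]0%R, v]%classic)%E.
  rewrite -measureU; try exact: measurable_itvR.
    congr (nu _); apply/seteqP; split=> x /=; rewrite !in_itv/=.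
      by move=> /andP[? ?]; case: (leP x 0) => xu; [left|right]; apply/andP; split; lra.
    by move=> [|] /andP[? ?]; apply/andP; split; lra.
  by apply/seteqP; split=> x //=; rewrite !in_itv/= => -[/andP[? ?] /andP[? ?]]; lra.
by rewrite nu0// add0e nu0t ?(ltW v0)// subr0.
Qed.

(** Uniqueness of Lebesgue measure speaks of the whole line, while [nu] has no mass on the negative
    half. Adding c times Lebesgue measure there and dividing by c gives a measure to which it
    applies. *)
Let negmu : {measure set mR -> \bar R} :=
  mscale (NngNum (ltW c_gt0)) (mrestr mu (measurable_itvR `]-oo, 0])).

Let negmuE (A : set mR) : negmu A = (c%:E * mu (A `&` `]-oo, 0%R]))%E.
Proof. by []. Qed.

Let cV_ge0 : 0 <= c^-1. Proof. by rewrite invr_ge0 ltW. Qed.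

Let m : {measure set mR -> \bar R} :=
  mscale (NngNum cV_ge0) (measure_add nu negmu).

Let mE (A : set mR) : m A = (c^-1%:E * (nu A + negmu A))%E.
Proof. by rewrite /m -measure_addE. Qed.

Let mu_m (A : set mR) : measurable A -> mu A = m A.
Proof.
apply: (@lebesgue_measure_unique R m) => _ [[u v]] _ <-.
rewrite mE negmuE /=.
have [uv|vu] := leP u v; last first.
  by rewrite set_itv_ge ?bnd_simp -?leNgt ?(ltW vu)// set0I !measure0 mule0 adde0 mule0.
rewrite nu_max//.
have -> : `]u, v]%classic `&` `]-oo, 0] = `]u, Num.min v 0]%classic :> set R.
  apply/seteqP; split=> x /=; rewrite !in_itv/=.
    by move=> [/andP[? ?] ?]; apply/andP; split; rewrite ?le_min//; apply/andP.
  by rewrite le_min => /andP[? /andP[? ?]]; split=> //; apply/andP.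
rewrite !lebesgue_measure_itv/= !lte_fin.
have -> : (if u < Num.min v 0 then ((Num.min v 0)%:E + (- u)%:E)%E else 0%E) =
    (Num.max (Num.min v 0 - u) 0)%:E.
  case: ltP => h; rewrite -?EFinD; congr EFin.
    by rewrite max_l// subr_ge0 ltW.
  by rewrite max_r// subr_le0.
have -> : (if u < v then (v%:E + (- u)%:E)%E else 0%E) = (v - u)%:E.
  by case: ltP => h; rewrite -?EFinD; congr EFin; lra.
rewrite -[RHS]/((c^-1 * (c * (Num.max v 0 - Num.max u 0) +
  c * Num.max (Num.min v 0 - u) 0))%:E); congr EFin.
apply: (mulfI (lt0r_neq0 c_gt0)); rewrite mulrA divff ?gt_eqF// mul1r -mulrDr.
congr (_ * _); have [v0|v0] := leP v 0; have [u0|u0] := leP u 0; try lra.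
- by rewrite max_l; lra.
- by rewrite max_l; lra.
- by rewrite max_r; lra.
Qed.

Lemma ge0_integral_halfline_measure (f : R -> \bar R) :
  measurable_fun setT f -> (forall x, (0 <= f x)%E) ->
  (\int[nu]_t f t = c%:E * \int[mu]_(t in `]0%R, +oo[) f t)%E.
Proof.
move=> mf f0.
have -> : setT = `]-oo, 0] `|` `]0, +oo[ :> set mR.
  by apply/seteqP; split=> // x _ /=; rewrite !in_itv/= andbT; case: (leP x 0); [left|right].
rewrite ge0_integral_setU//; try exact: measurable_itvR; last 2 first.
  exact: measurable_funS mf.
  by apply/disj_setPS => x /=; rewrite !in_itv/=; lra.
rewrite null_set_integral//; try exact: measurable_itvR; last exact: measurable_funS mf.
rewrite add0e [LHS](@eq_measure_integral _ _ _ _ (mscale (NngNum (ltW c_gt0)) mu)).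
  by rewrite ge0_integral_mscale//; exact: measurable_funS mf.
move=> A mA A0; rewrite /= /mscale/= mu_m// mE negmuE.
rewrite (_ : A `&` _ = set0) ?measure0 ?mule0 ?adde0; last first.
  by apply/seteqP; split=> // x [/A0] /=; rewrite !in_itv/=; lra.
by rewrite muleA -EFinM divff ?gt_eqF// mul1e.
Qed.

End HalfLineMeasure.

Section Plane.
Context {R : realType}.
Notation mu := (@lebesgue_measure R).
Notation mR := (measurableTypeR R).
Notation plane := (plane_measure R).

Lemma plane_tonelli (f : mR * mR -> \bar R) :
  measurable_fun setT f -> (forall z, (0 <= f z)%E) ->
  (\int[plane]_z f z = \int[mu]_x \int[mu]_y f (x, y))%E.
Proof. by move=> mf f0; rewrite fubini_tonelli1. Qed.

Lemma plane_rectangle (A B : set mR) : measurable A -> measurable B ->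
  plane (A `*` B) = (mu A * mu B)%E.
Proof. by move=> mA mB; rewrite -product_measure1E. Qed.

Lemma plane_integral_scale (a : R) (f : mR * mR -> \bar R) : 0 < a ->
  measurable_fun setT f -> (forall z, (0 <= f z)%E) ->
  ((a ^+ 2)%:E * \int[plane]_z f (a * z.1, a * z.2)%R = \int[plane]_z f z)%E.
Proof.
move=> a0 mf f0.
have mfa : measurable_fun setT (fun z : mR * mR => f (a * z.1, a * z.2)%R).
  apply: measurableT_comp => //; apply/measurable_fun_pair => /=.
    by apply: measurable_funM => //; exact: measurable_fst.
  by apply: measurable_funM => //; exact: measurable_snd.
rewrite !plane_tonelli//=.
have mF : measurable_fun [set: R] (fun x => \int[mu]_y f (x, y))%E.
  exact: (@measurable_fun_fubini_tonelli_F _ _ mR mR R mu f).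
rewrite -(ge0_integral_scale a0 mF); last by move=> x; exact: integral_ge0.
rewrite expr2 EFinM -muleA; congr (_ * _)%E.
rewrite -ge0_integralZl ?lee_fin ?(ltW a0)//; last 2 first.
  exact: (@measurable_fun_fubini_tonelli_F _ _ mR mR R mu _ mfa).
  by move=> x _; exact: integral_ge0.
apply: eq_integral => x _; apply: ge0_integral_scale => //.
by apply: measurableT_comp => //; exact: measurable_fun_pair.
Qed.

Definition sqmod (z : R * R) : R := z.1 ^+ 2 + z.2 ^+ 2.

Lemma measurable_sqmod : measurable_fun [set: mR * mR] (sqmod : mR * mR -> mR).
Proof.
apply: measurable_funD; apply: measurable_funX.
  exact: measurable_fst.
exact: measurable_snd.
Qed.

Let nu : {measure set mR -> \bar R} :=
  measure_function_pushforward__canonical__measure_function_Measure plane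
    measurable_sqmod.

Let nuE (A : set mR) : nu A = plane (sqmod @^-1` A). Proof. by []. Qed.

Let measurable_sqmodV (A : set mR) : measurable A -> measurable (sqmod @^-1` A).
Proof.
by move=> mA; rewrite -[X in measurable X]setTI; exact: measurable_sqmod.
Qed.

Let nu_le0 : nu `]-oo, 0]%classic = 0%E.
Proof.
rewrite nuE (_ : sqmod @^-1` _ = [set 0] `*` [set 0]).
  rewrite plane_rectangle; try exact: measurable_set1.
  by rewrite lebesgue_measure_set1 mul0e.
apply/seteqP; split => [[x y]|[x y]]; rewrite /sqmod/= in_itv/=.
  move=> xy; have : x ^+ 2 = 0 /\ y ^+ 2 = 0 by split; nra.
  by move=> [/eqP + /eqP]; rewrite !expf_eq0/= => /eqP -> /eqP ->.
by move=> [-> ->]; rewrite expr0n/= addr0.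
Qed.

(** The mass of the punctured unit disc, kept abstract: it cancels when the two norms are
    compared. *)
Let c := fine (nu `]0, 1]%classic).

Let nu1_lty : (nu `]0%R, 1%R]%classic < +oo)%E.
Proof.
rewrite nuE; apply: (@le_lt_trans _ _ (plane (`[-1, 1]%classic `*` `[-1, 1]%classic))).
  apply: le_measure; rewrite ?inE//=.
  - by apply: measurable_sqmodV; exact: measurable_itvR.
  - by apply: measurableX; exact: measurable_itvR.
  - move=> [x y]; rewrite /sqmod/= !in_itv/= => /andP[_ xy]; split; apply/andP; split; nra.
rewrite plane_rectangle; try exact: measurable_itvR.
by rewrite lebesgue_measure_itv/=; case: ifP => _; rewrite -?EFinB -?EFinM ltry.
Qed.

Let c_gt0 : 0 < c.
Proof.
rewrite /c fine_gt0// nu1_lty andbT.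
apply: (@lt_le_trans _ _ (plane (`]0, 2^-1]%classic `*` `]0, 2^-1]%classic))).
  rewrite plane_rectangle; try exact: measurable_itvR.
  rewrite lebesgue_measure_itv/= lte_fin invr_gt0 ltr0n/= -EFinB -EFinM lte_fin.
  by rewrite subr0 mulr_gt0// invr_gt0.
rewrite nuE; apply: le_measure; rewrite ?inE//=.
- by apply: measurableX; exact: measurable_itvR.
- by apply: measurable_sqmodV; exact: measurable_itvR.
- move=> [x y]; rewrite /sqmod/= !in_itv/= => -[/andP[x0 x1] /andP[y0 y1]]. nra.
Qed.

Let nu1E : nu `]0, 1]%classic = c%:E.
Proof. by rewrite /c fineK// ge0_fin_numE. Qed.

Let nu0t (t : R) : 0 <= t -> nu `]0, t]%classic = (c * t)%:E.
Proof.
rewrite le_eqVlt => /predU1P[<-|t0].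
  by rewrite set_itv_ge ?bnd_simp ?ltxx// measure0 mulr0.
pose a := Num.sqrt t; have a0 : 0 < a by rewrite sqrtr_gt0.
have a2 : a ^+ 2 = t by rewrite sqr_sqrtr// ltW.
have mI (X : set mR) : measurable X ->
    measurable_fun [set: mR * mR] (fun z => (\1_X (sqmod z))%:E : \bar R).
  move=> mX; apply/measurable_EFinP; apply: measurableT_comp; last exact: measurable_sqmod.
  exact: measurable_indic.
have nuI (X : set mR) : measurable X ->
    (nu X = \int[plane]_z (\1_X (sqmod z))%:E)%E.
  move=> mX; rewrite nuE -[X in plane X]setIT -integral_indic//; last exact: measurable_sqmodV.
rewrite nuI ?measurable_itvR// -(plane_integral_scale a0); last 2 first.
- exact: mI (measurable_itvR _).
- by move=> z; rewrite lee_fin.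
rewrite a2 mulrC EFinM -nu1E; congr (_ * _)%E.
rewrite nuI ?measurable_itvR//; apply: eq_integral => -[x y] _; congr EFin.
rewrite !indicE; congr (nat_of_bool _)%:R.
apply/idP/idP; rewrite !inE/= !in_itv/= /sqmod/= !exprMn a2; nra.
Qed.

(* In place of polar coordinates: by scaling, the image of the plane measure
   under |z|^2 gives mass c t to ]0, t]. *)
Lemma plane_integral_radial : exists2 c : R, 0 < c &
  forall f : R -> \bar R, measurable_fun setT f -> (forall x, (0 <= f x)%E) ->
  (\int[plane]_z f (sqmod z) = c%:E * \int[mu]_(t in `]0%R, +oo[) f t)%E.
Proof.
exists c => // f mf f0.
rewrite -(ge0_integral_halfline_measure c_gt0 nu_le0 nu0t mf f0).
by rewrite (@ge0_integral_pushforward _ _ _ _ _ _ measurable_sqmod plane setT f).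
Qed.

End Plane.

(** * Fourier transforms of Gaussians times harmonic polynomials *)

Section RealIntegrable.
Context d (T : measurableType d) (R : realType).
Variables (m : {measure set T -> \bar R}).
Implicit Types f g : T -> R.

Lemma integrableRZl (k : R) f : m.-integrable setT (EFin \o f) ->
  m.-integrable setT (EFin \o (fun x => k * f x)).
Proof. exact: integrableZl. Qed.

Lemma integrableRD f g : m.-integrable setT (EFin \o f) ->
  m.-integrable setT (EFin \o g) ->
  m.-integrable setT (EFin \o (fun x => f x + g x)).
Proof. exact: integrableD. Qed.

Lemma integrableRB f g : m.-integrable setT (EFin \o f) ->
  m.-integrable setT (EFin \o g) ->
  m.-integrable setT (EFin \o (fun x => f x - g x)).
Proof. exact: integrableB. Qed.
End RealIntegrable.

Lemma is_derive_exprn {R : realType} (x : R) n :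
  is_derive x (1 : R) (fun y : R => y ^+ n) (n%:R * x ^+ n.-1).
Proof.
have := @is_deriveX R R id n x 1 1 (is_derive_id _ _).
rewrite /GRing.scale/= mulr1.
by rewrite (_ : id ^+ n = (fun y : R => y ^+ n))//; apply/funext => y; rewrite exprfctE.
Qed.

Section GaussianMoments.
Context {R : realType}.
Notation mu := (@lebesgue_measure R).
Variable c : R.
Hypothesis c_gt0 : 0 < c.

Let gw (x : R) := expR (- (c * x ^+ 2)).

Let gw_ge0 x : 0 <= gw x. Proof. exact: expR_ge0. Qed.

Lemma continuous_gaussian : continuous (fun x : R => expR (- (c * x ^+ 2))).
Proof.
move=> x; apply: (@continuous_comp _ _ _ (fun x : R => - (c * x ^+ 2)) expR).
  by apply: cvgN; apply: cvgM; [exact: cvg_cst|exact: exprn_continuous].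
exact: continuous_expR.
Qed.

Lemma integral_gaussian :
  (\int[mu]_x (expR (- (c * x ^+ 2)))%:E = (Num.sqrt (pi / c))%:E)%E.
Proof.
have a0 : 0 < Num.sqrt c by rewrite sqrtr_gt0.
have mg : measurable_fun [set: R] (EFin \o @gauss_fun R).
  by apply/measurable_EFinP; exact: measurable_gauss_fun.
have := ge0_integral_scale a0 mg (fun x => gauss_fun_ge0 x).
rewrite integralT_gauss => E.
have -> : (\int[mu]_x (expR (- (c * x ^+ 2)))%:E = \int[mu]_x (EFin \o @gauss_fun R) (Num.sqrt c * x)%R)%E.
  by apply: eq_integral => x _; rewrite /= /gauss_fun exprMn sqr_sqrtr// ltW.
rewrite sqrtrM ?pi_ge0// sqrtrV ?(ltW c_gt0)// mulrC EFinM -E muleA -EFinM.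
by rewrite mulVf ?gt_eqF// mul1e.
Qed.

(** First |x|^n <= 1 + x^(2n); then x^(2n) e^(-c x^2) is bounded by keeping only the n-th term of
    the exponential series of c x^2. *)
Lemma pow_gaussian_le (n : nat) (x : R) :
  `|x| ^+ n * expR (- (c * x ^+ 2)) <= 1 + n`!%:R / c ^+ n.
Proof.
have h1 : `|x| ^+ n <= 1 + (x ^+ 2) ^+ n.
  rewrite -exprM mulnC exprM -[x ^+ n ^+ 2]real_normK ?num_real// normrX.
  by rewrite -subr_ge0; set u := _ ^+ n; nra.
have h2 : (x ^+ 2) ^+ n * gw x <= n`!%:R / c ^+ n.
  rewrite /gw expRN ler_pdivrMr ?expR_gt0// mulrAC ler_pdivlMr ?exprn_gt0//.
  rewrite mulrC -exprMn; case: n {h1} => [|n].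
    by rewrite expr0 fact0 mul1r -expR0 ler_expR mulr_ge0 ?sqr_ge0// ltW.
  have cx0 : 0 <= c * x ^+ 2 by rewrite mulr_ge0 ?sqr_ge0// ltW.
  have := expR_ge1Dxn n cx0; rewrite -ler_pdivrMl ?ltr0n ?fact_gt0//.
  by rewrite mulrC; lra.
have h3 : gw x <= 1.
  by rewrite /gw -expR0 ler_expR oppr_le0 mulr_ge0 ?sqr_ge0// ltW.
have := ler_wpM2r (gw_ge0 x) h1; rewrite mulrDl mul1r => /le_trans; apply.
exact: lerD.
Qed.

End GaussianMoments.

Section GaussianTransforms.
Context {R : realType}.
Notation mu := (@lebesgue_measure R).

Let gw (c x : R) := expR (- (c * x ^+ 2)).

(** The Gaussian is split into two equal factors of rate c/2: one makes the power bounded, the other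
    is integrable. The bounded [b] will be a cosine or a sine. *)
Lemma integrable_gaussian_moment c n (b : R -> R) : 0 < c ->
  measurable_fun [set: R] b -> (forall x, `|b x| <= 1) ->
  mu.-integrable [set: R] (EFin \o (fun x => x ^+ n * expR (- (c * x ^+ 2)) * b x)).
Proof.
move=> c0 mb b1.
have c20 : 0 < c / 2 by lra.
pose K := 1 + n`!%:R / (c / 2) ^+ n.
have mg d : measurable_fun [set: R] (fun x : R => expR (- (d * x ^+ 2))).
  by apply: measurable_expRN; apply: measurable_funM => //; exact: exprn_measurable.
have K0 : 0 <= K by rewrite addr_ge0// divr_ge0 ?exprn_ge0 ?(ltW c20).
have i0 : mu.-integrable [set: R] (EFin \o (fun x => expR (- (c / 2 * x ^+ 2)))).
  apply/integrableP; split; first by apply/measurable_EFinP; exact: mg.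
  under eq_integral do rewrite /= ger0_norm ?expR_ge0//.
  by rewrite integral_gaussian// ltry.
have iK := integrableZl (@measurableT _ (measurableTypeR R)) K i0.
apply: le_integrable iK => //.
  apply/measurable_EFinP; apply: measurable_funM; last exact: mb.
  apply: measurable_funM; first exact: exprn_measurable.
  exact: mg.
move=> x _ /=; rewrite lee_fin !normrM normrX (ger0_norm (expR_ge0 _)).
rewrite (ger0_norm K0) (ger0_norm (expR_ge0 (- (c / 2 * _)))) .
rewrite (@le_trans _ _ (`|x| ^+ n * gw c x))//.
  by rewrite ler_piMr// mulr_ge0 ?exprn_ge0 ?expR_ge0.
have -> : gw c x = gw (c / 2) x * gw (c / 2) x.
  by rewrite /gw -expRD; congr expR; field.
by rewrite mulrA ler_wpM2r ?expR_ge0// pow_gaussian_le.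
Qed.

(** The bound of [pow_gaussian_le] for the exponent n + 1 leaves decay like 1/|x| for the exponent
    n. *)
Lemma cvg_pow_gaussian c n (b : R -> R) : 0 < c -> (forall x, `|b x| <= 1) ->
  x ^+ n * expR (- (c * x ^+ 2)) * b x @[x --> +oo] --> (0 : R) /\
  x ^+ n * expR (- (c * x ^+ 2)) * b x @[x --> -oo] --> (0 : R).
Proof.
move=> c0 b1; pose K := 1 + n.+1`!%:R / c ^+ n.+1.
have K0 : 0 <= K by rewrite addr_ge0// divr_ge0 ?exprn_ge0 ?(ltW c0).
have H x : x != 0 -> `|x ^+ n * expR (- (c * x ^+ 2)) * b x| <= K / `|x|.
  move=> x0; rewrite ler_pdivlMr ?normr_gt0// !normrM normrX (ger0_norm (expR_ge0 _)).
  apply: le_trans (pow_gaussian_le c0 n.+1 x).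
  have -> : `|x| ^+ n * expR (- (c * x ^+ 2)) * `|b x| * `|x| =
    `|x| ^+ n.+1 * expR (- (c * x ^+ 2)) * `|b x|.
    by rewrite (exprSr `|x| n) -!mulrA; congr (_ * _); rewrite mulrA mulrC.
  by rewrite ler_piMr// mulr_ge0 ?exprn_ge0 ?expR_ge0.
split; apply/cvgr0Pnorm_le => e e0; near=> x.
  have x0 : 0 < x by near: x; exact: nbhs_pinfty_gt.
  rewrite (le_trans (H _ (lt0r_neq0 x0)))// ger0_norm ?(ltW x0)// ler_pdivrMr//.
  by rewrite mulrC -ler_pdivrMr//; near: x; apply: nbhs_pinfty_ge; exact: num_real.
have x0 : x < 0 by near: x; exact: nbhs_ninfty_lt.
rewrite (le_trans (H _ (ltr0_neq0 x0)))// ltr0_norm// ler_pdivrMr ?oppr_gt0//.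
rewrite mulrC -ler_pdivrMr// lerNr; near: x; apply: nbhs_ninfty_le; exact: num_real.
Unshelve. all: end_near. Qed.

Section trig.
Variables (c : R) (tr tr' : R -> R).
Hypothesis c_gt0 : 0 < c.
Hypothesis dtr : forall x : R, is_derive x 1 tr (tr' x).
Hypothesis ctr : continuous tr.
Hypothesis ctr' : continuous tr'.
Hypothesis tr_le1 : forall x, `|tr x| <= 1.
Hypothesis tr'_le1 : forall x, `|tr' x| <= 1.

Let continuous_scaled (f : R -> R) (w : R) : continuous f -> continuous (fun x => f (w * x)).
Proof.
move=> cf x; apply: (@continuous_comp _ _ _ (fun x : R => w * x) f); last exact: cf.
by apply: cvgM; [exact: cvg_cst|exact: cvg_id].
Qed.

Let mtr w : measurable_fun [set: R] (fun x => tr (w * x)).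
Proof. by apply: continuous_measurable_fun; exact: continuous_scaled. Qed.

Let mtr' w : measurable_fun [set: R] (fun x => tr' (w * x)).
Proof. by apply: continuous_measurable_fun; exact: continuous_scaled. Qed.

Let moment n (f : R -> R) w := \int[mu]_x (x ^+ n * gw c x * f (w * x)).

(** The derivative of x^n e^(-c x^2) tr(w x) has integral 0. At n = 0 the predecessor 0 is harmless
    because its coefficient is n. The pair [tr], [tr'] is abstract so as to cover cosine, sine and
    their negatives at once. *)
Lemma gaussian_moment_rec n w :
  2 * c * \int[mu]_x (x ^+ n.+1 * expR (- (c * x ^+ 2)) * tr (w * x)) =
  n%:R * \int[mu]_x (x ^+ n.-1 * expR (- (c * x ^+ 2)) * tr (w * x)) +
  w * \int[mu]_x (x ^+ n * expR (- (c * x ^+ 2)) * tr' (w * x)).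
Proof.
have mT := @measurableT _ (measurableTypeR R).
have i1 := integrable_gaussian_moment n.+1 c_gt0 (mtr w) (fun x => tr_le1 (w * x)).
have i2 := integrable_gaussian_moment n.-1 c_gt0 (mtr w) (fun x => tr_le1 (w * x)).
have i3 := integrable_gaussian_moment n c_gt0 (mtr' w) (fun x => tr'_le1 (w * x)).
pose h x : R := x ^+ n * gw c x * tr (w * x).
pose g x : R := n%:R * (x ^+ n.-1 * gw c x * tr (w * x)) +
  w * (x ^+ n * gw c x * tr' (w * x)) - 2 * c * (x ^+ n.+1 * gw c x * tr (w * x)).
have j1 := integrableRZl (2 * c) i1.
have j2 := integrableRZl n%:R i2.
have j3 := integrableRZl w i3.
have j23 := integrableRD j2 j3.
have jg := integrableRB j23 j1.
have [hy hN] := @cvg_pow_gaussian c n (fun x => tr (w * x)) c_gt0 (fun x => tr_le1 (w * x)).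
have g0 : (\int[mu]_x (g x)%:E = 0)%E.
  apply: (@FTC2_NyyT R h) hN hy jg.
  - move=> x; rewrite /h /g.
    have d1 : is_derive x (1 : R) (gw c) (- (2 * c * x) * gw c x).
      have d0 : is_derive x (1 : R) (fun x : R => - (c * x ^+ 2)) (- (2 * c * x)).
        by apply: is_derive_eq; rewrite /GRing.scale/= ?expr1; ring.
      have := @is_derive1_comp R expR (fun x : R => - (c * x ^+ 2)) x _ _ (is_derive_expR _) d0.
      by rewrite mulrC.
    have d2 : is_derive x (1 : R) (fun x : R => tr (w * x)) (tr' (w * x) * w).
      have d0 : is_derive x (1 : R) (fun x : R => w * x) w.
        by apply: is_derive_eq; rewrite /GRing.scale/= mulr1.
      exact: (@is_derive1_comp R tr (fun x : R => w * x) x _ _ (dtr _) d0).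
    have d3 := is_derive_exprn x n.
    have -> : (fun x => x ^+ n * gw c x * tr (w * x)) =
       (fun x : R => x ^+ n) * (gw c) * (fun x : R => tr (w * x)) by [].
    apply: is_derive_eq; rewrite /GRing.scale/= ?mulrfctE (exprS x n).
    have E (a a' e t t' : R) : a * e * (t' * w) +
        t * (a * (- (2 * c * x) * e) + e * (n%:R * a')) =
        n%:R * (a' * e * t) + w * (a * e * t') - 2 * c * (x * a * e * t) by ring.
    exact: E.
  - have cgw := @continuous_gaussian R c.
    have cX m : continuous (fun x : R => x ^+ m) by move=> x; exact: exprn_continuous.
    have cM m (f : R -> R) : continuous f ->
        continuous (fun x : R => x ^+ m * gw c x * f (w * x)).
      move=> cf x; apply: cvgM; last exact: continuous_scaled.
      by apply: cvgM; [exact: cX|exact: cgw].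
    move=> x; apply: cvgB; last by apply: cvgM; [exact: cvg_cst|exact: cM].
    apply: cvgD; first by apply: cvgM; [exact: cvg_cst|exact: cM].
    by apply: cvgM; [exact: cvg_cst|exact: cM].
have E : \int[mu]_x (g x) =
  n%:R * moment n.-1 tr w + w * moment n tr' w - 2 * c * moment n.+1 tr w.
  by rewrite (RintegralB mT j23 j1) (RintegralD mT j2 j3) !RintegralZl.
have : \int[mu]_x (g x) = 0 by rewrite /Rintegral g0.
by move/eqP; rewrite E subr_eq0 => /eqP ->.
Qed.

Let derive_moment0 (x w : R) :
  is_derive w (1 : R) (fun w => gw c x * tr (w * x)) (x * gw c x * tr' (w * x)).
Proof.
have d2 : is_derive w (1 : R) (fun w : R => tr (w * x)) (tr' (w * x) * x).
  have d0 : is_derive w (1 : R) (fun w : R => w * x) x.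
    by apply: is_derive_eq; rewrite /GRing.scale/= mulr0 add0r mulr1.
  exact: (@is_derive1_comp R tr (fun w : R => w * x) w _ _ (dtr _) d0).
by apply: is_derive_eq; rewrite /GRing.scale/= mulrA mulrC mulrA.
Qed.

(** Differentiation under the integral, dominated by |x| e^(-c x^2) since [tr'] is bounded by 1.
    Together with [gaussian_moment1] it gives F' = -(w/(2c)) F for the cosine and sine transforms
    F. *)
Lemma is_derive_gaussian_moment0 (w : R) :
  is_derive w (1 : R)
    (fun w => \int[mu]_x (expR (- (c * x ^+ 2)) * tr (w * x)))
    (\int[mu]_x (x * expR (- (c * x ^+ 2)) * tr' (w * x))).
Proof.
pose f w x := gw c x * tr (w * x).
have intf v : mu.-integrable [set: R] (EFin \o f v).
  have := integrable_gaussian_moment 0 c_gt0 (mtr v) (fun x => tr_le1 (v * x)).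
  by apply: eq_integrable => // x _; rewrite /f /= expr0 mul1r.
have dE v x : partial1of2 f v x = x * gw c x * tr' (v * x).
  by rewrite partial1of2E; have := derive_moment0 x v => ?; exact: derive_val.
pose G x := `|x * gw c x|.
have intG : mu.-integrable [set: R] (EFin \o G).
  have m1 : measurable_fun [set: R] (cst (1 : R)) by exact: measurable_cst.
  have n1 (x : R) : `|cst (1 : R) x| <= 1 by rewrite normr1.
  have := integrable_abse (integrable_gaussian_moment 1 c_gt0 m1 n1).
  by apply: eq_integrable => // x _; rewrite /G /= expr1 mulr1.
have derf v x : w - 1 < v < w + 1 -> True -> derivable (f ^~ x) v 1.
  by move=> _ _; have := derive_moment0 x v => ?; exact: ex_derive.
have G_ub v x : `]w - 1, w + 1[%classic v -> [set: R] x -> `|partial1of2 f v x| <= G x.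
  by move=> _ _; rewrite dE normrM ler_piMr.
have Iw : `]w - 1, w + 1[%classic w by rewrite /= in_itv/=; lra.
have mT := @measurableT _ (measurableTypeR R).
have D := @differentiation_under_integral R _ (measurableTypeR R) mu f setT mT w
  (w - 1) (w + 1) Iw (fun v _ => intf v)
  (fun v x _ _ => @ex_derive _ _ _ _ _ _ _ (derive_moment0 x v)) G (fun x => normr_ge0 _) intG G_ub.
have D' := @derivable_under_integral R _ (measurableTypeR R) mu f setT mT w
  (w - 1) (w + 1) Iw (fun v _ => intf v)
  (fun v x _ _ => @ex_derive _ _ _ _ _ _ _ (derive_moment0 x v)) G (fun x => normr_ge0 _) intG G_ub.
apply: DeriveDef; first exact: D'.
rewrite -derive1E D; apply: eq_Rintegral => x _.
exact: dE.
Qed.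

Lemma gaussian_moment1 (w : R) :
  \int[mu]_x (x * expR (- (c * x ^+ 2)) * tr (w * x)) =
  w / (2 * c) * \int[mu]_x (expR (- (c * x ^+ 2)) * tr' (w * x)).
Proof.
have := gaussian_moment_rec 0 w; rewrite mul0r add0r.
under eq_Rintegral do rewrite expr1.
under [X in _ = w * X -> _]eq_Rintegral do rewrite expr0 mul1r.
by move=> H; apply: (mulfI (x := 2 * c)); rewrite ?H ?gt_eqF ?mulr_gt0//; field;
  rewrite gt_eqF.
Qed.
End trig.

(** The product of f(w) with e^(w^2/(4c)) has derivative 0. *)
Lemma gaussian_ode (c : R) (f : R -> R) : 0 < c ->
  (forall w : R, is_derive w (1 : R) f (- (w / (2 * c)) * f w)) ->
  forall w, f w = f 0 * expR (- (w ^+ 2 / (4 * c))).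
Proof.
move=> c0 df w.
pose h w := f w * expR (w ^+ 2 / (4 * c)).
have dh (v : R) : is_derive v (1 : R) h 0.
  have d1 : is_derive v (1 : R) (fun w : R => w ^+ 2 / (4 * c)) (v / (2 * c)).
    have d00 := is_derive_exprn v 2.
    apply: is_derive_eq; rewrite /GRing.scale/= ?mulr0 ?add0r ?addr0 expr1.
    by field; rewrite gt_eqF.
  have d2 := @is_derive1_comp R expR (fun w : R => w ^+ 2 / (4 * c)) v _ _
    (is_derive_expR _) d1.
  have d3 := df v.
  have -> : h = f * (expR \o (fun w : R => w ^+ 2 / (4 * c))) by [].
  apply: is_derive_eq; rewrite /GRing.scale/=.
  have E (a b d : R) : a * (b * d) + b * (- d * a) = 0 by ring.
  exact: E.
have := @is_derive_0_is_cst R h w 0 dh.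
rewrite /h expr0n/= mul0r expR0 mulr1 => <-.
by rewrite -mulrA -expRD subrr expR0 mulr1.
Qed.

Let cos_le1_norm (x : R) : `|cos x| <= 1.
Proof. by rewrite ler_norml cos_geN1 cos_le1. Qed.

Let sin_le1_norm (x : R) : `|sin x| <= 1.
Proof. by rewrite ler_norml sin_geN1 sin_le1. Qed.

Let dNsin (x : R) : is_derive x 1 (fun x : R => - sin x) (- cos x).
Proof. by apply: is_derive_eq. Qed.

Let cNsin : continuous (fun x : R => - sin x).
Proof. by move=> x; apply: cvgN; exact: continuous_sin. Qed.

Let cNcos : continuous (fun x : R => - cos x).
Proof. by move=> x; apply: cvgN; exact: continuous_cos. Qed.

Let Nsin_le1 (x : R) : `|- sin x| <= 1. Proof. by rewrite normrN. Qed.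

Let Ncos_le1 (x : R) : `|- cos x| <= 1. Proof. by rewrite normrN. Qed.

Let mscaled (f : R -> R) (w : R) : continuous f ->
  measurable_fun [set: R] (fun x => f (w * x)).
Proof.
move=> cf; apply: continuous_measurable_fun => x.
apply: (@continuous_comp _ _ _ (fun x : R => w * x) f); last exact: cf.
by apply: cvgM; [exact: cvg_cst|exact: cvg_id].
Qed.

Lemma integrable_gaussian_cos c n w : 0 < c -> mu.-integrable [set: R]
  (EFin \o (fun x => x ^+ n * expR (- (c * x ^+ 2)) * cos (w * x))).
Proof.
move=> c0; apply: integrable_gaussian_moment => //.
exact: (mscaled w (@continuous_cos R)).
Qed.

Lemma integrable_gaussian_sin c n w : 0 < c -> mu.-integrable [set: R]
  (EFin \o (fun x => x ^+ n * expR (- (c * x ^+ 2)) * sin (w * x))).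
Proof.
move=> c0; apply: integrable_gaussian_moment => //.
exact: (mscaled w (@continuous_sin R)).
Qed.

Let RintegralN_gauss c n w (f : R -> R) : 0 < c -> continuous f ->
  (forall x, `|f x| <= 1) ->
  \int[mu]_x (x ^+ n * expR (- (c * x ^+ 2)) * - f (w * x)) =
  - \int[mu]_x (x ^+ n * expR (- (c * x ^+ 2)) * f (w * x)).
Proof.
move=> c0 cf f1.
have i := integrable_gaussian_moment n c0 (mscaled w cf) (fun x => f1 (w * x)).
rewrite -mulN1r -(RintegralZl (-1) (@measurableT _ (measurableTypeR R)) i).
by apply: eq_Rintegral => x _; rewrite mulN1r mulrN.
Qed.

Let RintegralN_gauss0 c w (f : R -> R) : 0 < c -> continuous f ->
  (forall x, `|f x| <= 1) ->
  \int[mu]_x (expR (- (c * x ^+ 2)) * - f (w * x)) =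
  - \int[mu]_x (expR (- (c * x ^+ 2)) * f (w * x)).
Proof.
move=> c0 cf f1; have := RintegralN_gauss 0 w c0 cf f1.
have A (g : R -> R) : \int[mu]_x (x ^+ 0 * expR (- (c * x ^+ 2)) * g x) =
    \int[mu]_x (expR (- (c * x ^+ 2)) * g x).
  by apply: eq_Rintegral => x _; rewrite expr0 mul1r.
by rewrite (A (fun x => - f (w * x))) (A (fun x => f (w * x))).
Qed.

Lemma gaussian_cos (c w : R) : 0 < c ->
  \int[mu]_x (expR (- (c * x ^+ 2)) * cos (w * x)) =
  Num.sqrt (pi / c) * expR (- (w ^+ 2 / (4 * c))).
Proof.
move=> c0.
pose F w := \int[mu]_x (expR (- (c * x ^+ 2)) * cos (w * x)).
have dF v : is_derive v (1 : R) F (- (v / (2 * c)) * F v).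
  have := is_derive_gaussian_moment0 c0 (@is_derive_cos R) (@continuous_cos R)
    cos_le1_norm Nsin_le1 v.
  rewrite (gaussian_moment1 c0 dNsin cNsin cNcos Nsin_le1 Ncos_le1).
  by rewrite RintegralN_gauss0 ?mulrN ?mulNr//; exact: continuous_cos.
rewrite -/(F w) (gaussian_ode c0 dF) /F.
congr (_ * _); under eq_Rintegral do rewrite mul0r cos0 mulr1.
by rewrite /Rintegral integral_gaussian.
Qed.

(** The same differential equation as for the cosine, now with initial value 0. *)
Lemma gaussian_sin (c w : R) : 0 < c ->
  \int[mu]_x (expR (- (c * x ^+ 2)) * sin (w * x)) = 0.
Proof.
move=> c0.
pose F w := \int[mu]_x (expR (- (c * x ^+ 2)) * sin (w * x)).
have dF v : is_derive v (1 : R) F (- (v / (2 * c)) * F v).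
  have := is_derive_gaussian_moment0 c0 (@is_derive_sin R) (@continuous_sin R)
    sin_le1_norm cos_le1_norm v.
  rewrite (gaussian_moment1 c0 (@is_derive_cos R) (@continuous_cos R) cNsin cos_le1_norm Nsin_le1).
  by rewrite RintegralN_gauss0 ?mulrN ?mulNr//; exact: continuous_sin.
rewrite -/(F w) (gaussian_ode c0 dF) /F.
under eq_Rintegral do rewrite mul0r sin0 mulr0.
by rewrite /Rintegral integral0 mul0r.
Qed.

Lemma gaussian_cos_rec (c w : R) n : 0 < c ->
  2 * c * \int[mu]_x (x ^+ n.+1 * expR (- (c * x ^+ 2)) * cos (w * x)) =
  n%:R * \int[mu]_x (x ^+ n.-1 * expR (- (c * x ^+ 2)) * cos (w * x)) -
  w * \int[mu]_x (x ^+ n * expR (- (c * x ^+ 2)) * sin (w * x)).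
Proof.
move=> c0.
rewrite (gaussian_moment_rec c0 (@is_derive_cos R) (@continuous_cos R) cNsin cos_le1_norm Nsin_le1).
by rewrite RintegralN_gauss ?mulrN//; exact: continuous_sin.
Qed.

Lemma gaussian_sin_rec (c w : R) n : 0 < c ->
  2 * c * \int[mu]_x (x ^+ n.+1 * expR (- (c * x ^+ 2)) * sin (w * x)) =
  n%:R * \int[mu]_x (x ^+ n.-1 * expR (- (c * x ^+ 2)) * sin (w * x)) +
  w * \int[mu]_x (x ^+ n * expR (- (c * x ^+ 2)) * cos (w * x)).
Proof.
move=> c0.
exact: (gaussian_moment_rec c0 (@is_derive_sin R) (@continuous_sin R) (@continuous_cos R)).
Qed.

End GaussianTransforms.

(** * Integration of complex-valued functions, on the line and on the plane *)

Section ComplexIntegral.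
Context d (T : measurableType d) (R : realType).
Variable m : {measure set T -> \bar R}.
Implicit Types f g : T -> R[i].

(** Counterparts of [cintegrable] and [cintegral] over any measure, so that the line and the plane
    share one calculus; over the plane they unfold to the same terms. *)
Definition cintble f := m.-integrable setT (EFin \o (fun x => Re (f x))) /\
  m.-integrable setT (EFin \o (fun x => Im (f x))).

Definition cint f : R[i] :=
  Complex (\int[m]_x Re (f x)) (\int[m]_x Im (f x)).

Lemma Re_mul (x y : R[i]) : Re (x * y) = Re x * Re y - Im x * Im y.
Proof. by case: x => a b; case: y => e h. Qed.

Lemma Im_mul (x y : R[i]) : Im (x * y) = Re x * Im y + Im x * Re y.
Proof. by case: x => a b; case: y => e h. Qed.

Lemma Re_add (x y : R[i]) : Re (x + y) = Re x + Re y.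
Proof. by case: x => a b; case: y => e h. Qed.

Lemma Im_add (x y : R[i]) : Im (x + y) = Im x + Im y.
Proof. by case: x => a b; case: y => e h. Qed.

Lemma complexP (x y : R[i]) : Re x = Re y -> Im x = Im y -> x = y.
Proof. by case: x => a b; case: y => e h /= -> ->. Qed.

Lemma cintbleZ (a : R[i]) f : cintble f -> cintble (fun x => a * f x).
Proof.
move=> [i1 i2]; split.
  have := integrableRB (integrableRZl (Re a) i1) (integrableRZl (Im a) i2).
  by apply: eq_integrable => // x _; rewrite /= Re_mul.
have := integrableRD (integrableRZl (Re a) i2) (integrableRZl (Im a) i1).
by apply: eq_integrable => // x _; rewrite /= Im_mul.
Qed.

Lemma cintZ (a : R[i]) f : cintble f -> cint (fun x => a * f x) = a * cint f.
Proof.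
move=> [i1 i2]; apply: complexP; rewrite /cint ?Re_mul ?Im_mul/=.
  under eq_Rintegral do rewrite Re_mul.
  by rewrite (RintegralB measurableT (integrableRZl (Re a) i1) (integrableRZl (Im a) i2))
    !RintegralZl.
under eq_Rintegral do rewrite Im_mul.
by rewrite (RintegralD measurableT (integrableRZl (Re a) i2) (integrableRZl (Im a) i1))
  !RintegralZl.
Qed.

Lemma cintbleD f g : cintble f -> cintble g -> cintble (fun x => f x + g x).
Proof.
move=> [i1 i2] [j1 j2]; split.
  have := integrableRD i1 j1.
  by apply: eq_integrable => // x _; rewrite /= Re_add.
have := integrableRD i2 j2.
by apply: eq_integrable => // x _; rewrite /= Im_add.
Qed.

Lemma cintD f g : cintble f -> cintble g ->
  cint (fun x => f x + g x) = cint f + cint g.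
Proof.
move=> [i1 i2] [j1 j2]; apply: complexP; rewrite /cint ?Re_add ?Im_add/=.
  under eq_Rintegral do rewrite Re_add.
  by rewrite RintegralD.
under eq_Rintegral do rewrite Im_add.
by rewrite RintegralD.
Qed.

Lemma eq_cint f g : f =1 g -> cint f = cint g.
Proof. by move=> fg; congr cint; apply/funext. Qed.

Lemma cint0 : cint (fun=> 0) = 0.
Proof.
by apply: complexP => /=; rewrite /Rintegral integral0.
Qed.

Lemma cintble0 : cintble (fun=> 0).
Proof. by split; exact: integrable0. Qed.

Lemma cintble_sum n (f : 'I_n -> T -> R[i]) : (forall i, cintble (f i)) ->
  cintble (fun x => \sum_(i < n) f i x).
Proof.
elim: n f => [|n IH] f fi.
  by under eq_fun do rewrite big_ord0; exact: cintble0.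
by under eq_fun do rewrite big_ord_recr/=; apply: cintbleD => //; exact: IH.
Qed.

Lemma cint_sum n (f : 'I_n -> T -> R[i]) : (forall i, cintble (f i)) ->
  cint (fun x => \sum_(i < n) f i x) = \sum_(i < n) cint (f i).
Proof.
elim: n f => [|n IH] f fi.
  by rewrite big_ord0 -[RHS]cint0; apply: eq_cint => x; rewrite big_ord0.
rewrite big_ord_recr/= -IH// -cintD//; last exact: cintble_sum.
by apply: eq_cint => x; rewrite big_ord_recr.
Qed.

End ComplexIntegral.

Section PlaneProduct.
Context {R : realType}.
Notation mu := (@lebesgue_measure R).
Notation mR := (measurableTypeR R).
Notation plane := (plane_measure R).

Lemma plane_integrable_prod (f g : mR -> R) :
  mu.-integrable setT (EFin \o f) -> mu.-integrable setT (EFin \o g) ->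
  plane.-integrable setT (EFin \o (fun z => f z.1 * g z.2)).
Proof.
move=> fi gi.
have mf : measurable_fun setT f by apply/measurable_EFinP; exact: measurable_int fi.
have mg : measurable_fun setT g by apply/measurable_EFinP; exact: measurable_int gi.
have mfg : measurable_fun [set: mR * mR] (EFin \o (fun z => f z.1 * g z.2)).
  apply/measurable_EFinP/measurable_funM.
    exact: (measurableT_comp mf measurable_fst).
  exact: (measurableT_comp mg measurable_snd).
apply/(integrable12ltyP mu mu mfg).
have -> : (\int[mu]_x \int[mu]_y `|(EFin \o (fun z : mR * mR => (f z.1 * g z.2)%R)) (x, y)| =
  \int[mu]_x (`|(f x)%:E| * \int[mu]_y `|(g y)%:E|))%E.
  apply: eq_integral => x _; rewrite -ge0_integralZl//; last first.
    by apply: measurableT_comp => //; exact/measurable_EFinP.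
  by apply: eq_integral => y _; rewrite /= normrM EFinM.
rewrite ge0_integralZr//; last 2 first.
  by apply: measurableT_comp => //; exact/measurable_EFinP.
  exact: integral_ge0.
move/integrableP : fi => [_ fi]; move/integrableP : gi => [_ gi].
rewrite lte_mul_pinfty//; first exact: integral_ge0.
by rewrite ge0_fin_numE// integral_ge0.
Qed.

Lemma plane_Rintegral_prod (f g : mR -> R) :
  mu.-integrable setT (EFin \o f) -> mu.-integrable setT (EFin \o g) ->
  \int[plane]_z (f z.1 * g z.2) = \int[mu]_x f x * \int[mu]_y g y.
Proof.
move=> fi gi; have fgi := plane_integrable_prod fi gi.
rewrite {1}/Rintegral -(integral12_prod_meas1 fgi) /fubini_F/=.
have -> : (\int[mu]_x \int[mu]_y (f x * g y)%:E =
   \int[mu]_x ((\int[mu]_y g y)%:E * (f x)%:E))%E.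
  apply: eq_integral => x _; rewrite muleC -EFinM -(RintegralZl _ measurableT gi).
  rewrite /Rintegral fineK//.
  exact: (integrable_fin_num measurableT (integrableRZl (f x) gi)).
rewrite integralZl// -(fineK (integrable_fin_num _ fi))//.
by rewrite -EFinM/= mulrC.
Qed.

Lemma plane_cintble_prod (f g : mR -> R[i]) : cintble mu f -> cintble mu g ->
  cintble plane (fun z => f z.1 * g z.2).
Proof.
move=> [f1 f2] [g1 g2]; split.
  have := integrableRB (plane_integrable_prod f1 g1) (plane_integrable_prod f2 g2).
  by apply: eq_integrable => // x _; rewrite /= Re_mul.
have := integrableRD (plane_integrable_prod f1 g2) (plane_integrable_prod f2 g1).
by apply: eq_integrable => // x _; rewrite /= Im_mul.
Qed.

Lemma plane_cint_prod (f g : mR -> R[i]) : cintble mu f -> cintble mu g ->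
  cint plane (fun z => f z.1 * g z.2) = cint mu f * cint mu g.
Proof.
move=> [f1 f2] [g1 g2].
have h11 := plane_integrable_prod f1 g1.
have h22 := plane_integrable_prod f2 g2.
have h12 := plane_integrable_prod f1 g2.
have h21 := plane_integrable_prod f2 g1.
apply: complexP; rewrite ?Re_mul ?Im_mul/=.
  under eq_Rintegral do rewrite Re_mul.
  by rewrite (RintegralB measurableT h11 h22); congr (_ - _); exact: plane_Rintegral_prod.
under eq_Rintegral do rewrite Im_mul.
by rewrite (RintegralD measurableT h12 h21); congr (_ + _); exact: plane_Rintegral_prod.
Qed.

End PlaneProduct.

(** The expanded form of (d/dx + I d/dy) (x + I y)^k = 0, with x^n and y^n replaced by arbitrary
    sequences [X] and [Y]. After a shift of the index in the second sum the terms cancel in pairs,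
    by C(k,j) (k-j) = C(k,j+1) (j+1) and I^2 = -1. *)
Lemma binomial_gradient_cancel (A : comNzRingType) (I : A) (X Y : nat -> A) k :
  I ^+ 2 = -1 ->
  \sum_(j < k.+1) 'C(k, j)%:R * I ^+ j * ((k - j)%:R * (X (k - j).-1 * Y j)) +
  \sum_(j < k.+1) 'C(k, j)%:R * I ^+ j * (I * j%:R * (X (k - j)%N * Y j.-1)) = 0.
Proof.
move=> I2; case: k => [|k].
  by rewrite !big_ord1/= !(mul0r, mulr0) addr0.
rewrite big_ord_recr/= subnn mul0r mulr0 addr0.
rewrite [X in _ + X]big_ord_recl/= !(mulr0, mul0r) add0r -big_split/= big1// => j _.
rewrite /bump leq0n add1n subSS.
have jk : (j <= k)%N by rewrite -ltnS.
rewrite subSn//=.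
have e1 : 'C(k.+1, j)%:R * ((k - j).+1)%:R = 'C(k.+1, j.+1)%:R * j.+1%:R :> A.
  by rewrite -!natrM mulnC [in RHS]mulnC mul_bin_left subSn.
have -> : 'C(k.+1, j)%:R * I ^+ j * ((k - j).+1%:R * (X (k - j)%N * Y j)) =
  'C(k.+1, j)%:R * (k - j).+1%:R * (I ^+ j * X (k - j)%N * Y j) by ring.
rewrite e1.
have -> : 'C(k.+1, j.+1)%:R * I ^+ j.+1 * (I * j.+1%:R * (X (k - j)%N * Y j)) =
  I ^+ 2 * ('C(k.+1, j.+1)%:R * j.+1%:R * (I ^+ j * X (k - j)%N * Y j)).
  by rewrite exprS; ring.
by rewrite I2 mulN1r subrr.
Qed.

Section GaussianHarmonic.
Context {R : realType}.
Notation mu := (@lebesgue_measure R).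
Notation mR := (measurableTypeR R).
Notation plane := (plane_measure R).
Local Notation "x %:C" := (real_complex R x).

Lemma cisD (s t : R) : cis (s + t) = cis s * cis t.
Proof. by apply: complexP; rewrite ?Re_mul ?Im_mul/= ?cosD ?sinD// addrC. Qed.

Lemma Re_realM (x : R) (z : R[i]) : Re (x%:C * z) = x * Re z.
Proof. by rewrite Re_mul/= mul0r subr0. Qed.

Lemma Im_realM (x : R) (z : R[i]) : Im (x%:C * z) = x * Im z.
Proof. by rewrite Im_mul/= mul0r addr0. Qed.

Variable c : R.
Hypothesis c_gt0 : 0 < c.

Let e n w (x : R) : R[i] := (x ^+ n * expR (- (c * x ^+ 2)))%:C * cis (- (w * x)).

Let Re_e n w x : Re (e n w x) = x ^+ n * expR (- (c * x ^+ 2)) * cos (w * x).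
Proof. by rewrite /e Re_realM /cis/= cosN. Qed.

Let Im_e n w x : Im (e n w x) = - 1 * (x ^+ n * expR (- (c * x ^+ 2)) * sin (w * x)).
Proof. by rewrite /e Im_realM /cis/= sinN mulrN mulN1r. Qed.

Let cintble_e n w : cintble mu (e n w).
Proof.
split.
  apply: eq_integrable (integrable_gaussian_cos n w c_gt0) => // x _.
  by rewrite /comp Re_e.
apply: eq_integrable (integrableRZl (-1) (integrable_gaussian_sin n w c_gt0)) => // x _.
by rewrite /comp Im_e.
Qed.

Let E n w : R[i] := cint mu (e n w).

Let ReE n w : Re (E n w) = \int[mu]_x (x ^+ n * expR (- (c * x ^+ 2)) * cos (w * x)).
Proof. by apply: eq_Rintegral => x _; rewrite Re_e. Qed.

Let ImE n w : Im (E n w) = - \int[mu]_x (x ^+ n * expR (- (c * x ^+ 2)) * sin (w * x)).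
Proof.
rewrite -mulN1r -(RintegralZl (-1) measurableT (integrable_gaussian_sin n w c_gt0)).
by apply: eq_Rintegral => x _; rewrite Im_e.
Qed.

Let E_rec n w : E n.+1 w =
  (n%:R / (2 * c))%:C * E n.-1 w + Complex 0 (- (w / (2 * c))) * E n w.
Proof.
have c2 : 2 * c != 0 by rewrite mulf_neq0// gt_eqF.
have hc := gaussian_cos_rec w n c_gt0.
have hs := gaussian_sin_rec w n c_gt0.
apply: complexP; rewrite ?Re_add ?Im_add ?Re_realM ?Im_realM ?Re_mul ?Im_mul !(ReE, ImE)/=.
  by apply: (mulfI c2); rewrite hc; field; rewrite gt_eqF.
by apply: (mulfI c2); rewrite mulrN hs; field; rewrite gt_eqF.
Qed.

Let E_0 w : E 0 w = (Num.sqrt (pi / c) * expR (- (w ^+ 2 / (4 * c))))%:C.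
Proof.
apply: complexP; rewrite ?ReE ?ImE.
  by under eq_Rintegral do rewrite expr0 mul1r; exact: gaussian_cos.
under eq_Rintegral do rewrite expr0 mul1r.
by rewrite gaussian_sin// oppr0.
Qed.

(** The phase is part of the definition, so that the plain integral is the Fourier transform of z^k
    e^(-c|z|^2) at the angular frequency (a, b). *)
Definition gaussian_harmonic (k : nat) (a b : R) (z : R * R) : R[i] :=
  plane_point z ^+ k * (expR (- (c * sqmod z)))%:C * cis (- (a * z.1 + b * z.2)).

Let I : R[i] := Complex 0 1.
Let I2 : I ^+ 2 = -1.
Proof. by apply: complexP; rewrite expr2 ?Re_mul ?Im_mul/=; ring. Qed.

Let plane_pointE (z : R * R) : plane_point z = z.1%:C + I * z.2%:C.
Proof. by apply: complexP; rewrite ?Re_add ?Im_add ?Re_mul ?Im_mul/=; ring. Qed.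

Let harmonicE k a b z : gaussian_harmonic k a b z =
  \sum_(j < k.+1) 'C(k, j)%:R * I ^+ j * (e (k - j) a z.1 * e j b z.2).
Proof.
rewrite /gaussian_harmonic plane_pointE exprDn !mulr_suml; apply: eq_bigr => j _.
rewrite /e /sqmod mulrDr opprD expRD opprD cisD exprMn -mulr_natl !rmorphM/= !rmorphXn/=.
ring.
Qed.

Let harmonicS k a b z : gaussian_harmonic k.+1 a b z =
  \sum_(j < k.+1) ('C(k, j)%:R * I ^+ j * (e (k - j).+1 a z.1 * e j b z.2) +
     'C(k, j)%:R * I ^+ j * I * (e (k - j) a z.1 * e j.+1 b z.2)).
Proof.
transitivity (plane_point z * gaussian_harmonic k a b z).
  by rewrite /gaussian_harmonic exprS -!mulrA.
rewrite harmonicE mulr_sumr; apply: eq_bigr => j _.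
by rewrite plane_pointE /e !exprS !rmorphM/=; ring.
Qed.

Let cintble_ee n m a b : cintble plane (fun z => e n a z.1 * e m b z.2).
Proof. exact: (plane_cintble_prod (cintble_e n a) (cintble_e m b)). Qed.

Lemma cintble_gaussian_harmonic k a b : cintble plane (gaussian_harmonic k a b).
Proof.
rewrite (_ : gaussian_harmonic k a b = fun z => \sum_(j < k.+1) 'C(k, j)%:R * I ^+ j * (e (k - j) a z.1 * e j b z.2)).
  by apply: cintble_sum => j; apply: cintbleZ; exact: cintble_ee.
by apply/funext => z; exact: harmonicE.
Qed.

Let S k a b := cint plane (gaussian_harmonic k a b).

Let SE k a b : S k a b = \sum_(j < k.+1) 'C(k, j)%:R * I ^+ j * (E (k - j) a * E j b).
Proof.
rewrite /S (_ : gaussian_harmonic k a b = fun z => \sum_(j < k.+1)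
  'C(k, j)%:R * I ^+ j * (e (k - j) a z.1 * e j b z.2)); last first.
  by apply/funext => z; exact: harmonicE.
rewrite cint_sum; last first.
  by move=> j; apply: cintbleZ; exact: cintble_ee.
apply: eq_bigr => j _; rewrite cintZ; last exact: cintble_ee.
by rewrite (plane_cint_prod (cintble_e _ _) (cintble_e _ _)).
Qed.

(** Each one-dimensional moment splits by [E_rec] into a multiple of the same order and one of lower
    order. The lower orders sum to 0 by [binomial_gradient_cancel], because z^k is holomorphic; the
    others carry the common factor -i(a + ib)/(2c). *)
Let S_rec k a b : S k.+1 a b =
  Complex 0 (-1) * (a%:C + I * b%:C) / (2 * c)%:C * S k a b.
Proof.
have i1 n m (x : R[i]) : cintble plane (fun z => x * (e n a z.1 * e m b z.2)).
  by apply: cintbleZ; exact: cintble_ee.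
have c1 n m (x : R[i]) : cint plane (fun z => x * (e n a z.1 * e m b z.2)) = x * (E n a * E m b).
  rewrite cintZ; last exact: cintble_ee.
  by rewrite (plane_cint_prod (cintble_e _ _) (cintble_e _ _)).
rewrite {1}/S (_ : gaussian_harmonic k.+1 a b = fun z => \sum_(j < k.+1)
  ('C(k, j)%:R * I ^+ j * (e (k - j).+1 a z.1 * e j b z.2) +
  'C(k, j)%:R * I ^+ j * I * (e (k - j) a z.1 * e j.+1 b z.2))); last first.
  by apply/funext => z; exact: harmonicS.
rewrite cint_sum; last first.
  by move=> j; apply: cintbleD; exact: i1.
under eq_bigr => j _ do rewrite (cintD (i1 _ _ _) (i1 _ _ _)) !c1 !E_rec.
pose u : R[i] := ((2 * c)%:C)^-1.
have r1 n : (n%:R / (2 * c))%:C = n%:R * u.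
  by rewrite /u rmorphM/= rmorph_nat fmorphV.
have r2 w : Complex 0 (- (w / (2 * c))) = - I * w%:C * u.
  rewrite /u -fmorphV; apply: complexP; rewrite ?Re_mul ?Im_mul/=; ring.
have := binomial_gradient_cancel (fun n => E n a) (fun n => E n b) k I2.
rewrite SE.
set s1 := \sum_(j < _) _; set s2 := \sum_(j < _) _ => s12.
have -> : Complex 0 (-1) = - I :> R[i] by rewrite /I; apply: complexP => /=; rewrite ?oppr0.
transitivity (u * (s1 + s2) + - I * (a%:C + I * b%:C) / (2 * c)%:C *
  (\sum_(j < k.+1) 'C(k, j)%:R * I ^+ j * (E (k - j) a * E j b))).
  rewrite /s1 /s2 -big_split/= !mulr_sumr -big_split/=; apply: eq_bigr => j _.
  rewrite !r1 !r2 -/u; ring.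
by rewrite s12 mulr0 add0r.
Qed.

Lemma cint_gaussian_harmonic k a b : cint plane (gaussian_harmonic k a b) =
  (Complex 0 (-1) * (a%:C + Complex 0 1 * b%:C) / (2 * c)%:C) ^+ k *
  (pi / c * expR (- ((a ^+ 2 + b ^+ 2) / (4 * c))))%:C.
Proof.
rewrite -/(S k a b); elim: k => [|k IH]; last by rewrite S_rec IH [in RHS]exprS -[RHS]mulrA.
rewrite SE big_ord1/= !expr0 bin0 !mul1r subn0 !E_0 -rmorphM/=; congr (_%:C).
rewrite mulrACA -expr2 sqr_sqrtr; last by rewrite divr_ge0 ?pi_ge0// ltW.
by rewrite -expRD -opprD -mulrDl.
Qed.
End GaussianHarmonic.

(** * Fubini's theorem for mixtures of exponentials *)

Section Mixture.
Context d (T : measurableType d) (R : realType).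
Notation mu := (@lebesgue_measure R).
Notation mR := (measurableTypeR R).
Variable P : {sigma_finite_measure set T -> \bar R}.
Variables (h q : T -> R) (w c : mR -> R).
Hypothesis mh : measurable_fun setT h.
Hypothesis mq : measurable_fun setT q.
Hypothesis mw : measurable_fun setT w.
Hypothesis mc : measurable_fun setT c.
Hypothesis w0 : forall v, 0 <= w v.
Hypothesis mix_fin : forall z, h z != 0 ->
  (\int[mu]_v (w v * expR (- (c v * q z)))%:E < +oo)%E.
Hypothesis slice : forall v, w v != 0 ->
  P.-integrable setT (EFin \o (fun z => h z * expR (- (c v * q z)))).
Hypothesis total :
  (\int[mu]_v ((w v)%:E * \int[P]_z (`|h z| * expR (- (c v * q z)))%:E) < +oo)%E.

Let F (zv : T * mR) : R := h zv.1 * (w zv.2 * expR (- (c zv.2 * q zv.1))).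

Let mE : measurable_fun [set: T * mR] (fun zv => expR (- (c zv.2 * q zv.1))).
Proof.
apply: measurable_expRN; apply: measurable_funM.
  exact: (measurableT_comp mc measurable_snd).
exact: (measurableT_comp mq measurable_fst).
Qed.

Let mF : measurable_fun setT (EFin \o F).
Proof.
apply/measurable_EFinP; apply: measurable_funM.
  exact: (measurableT_comp mh measurable_fst).
apply: measurable_funM; last exact: mE.
exact: (measurableT_comp mw measurable_snd).
Qed.

Let mEz z : measurable_fun setT (fun v : mR => (w v * expR (- (c v * q z)))%:E).
Proof.
apply/measurable_EFinP; apply: measurable_funM; first exact: mw.
by apply: measurable_expRN; apply: measurable_funM.
Qed.

Let iF : (P \x mu)%E.-integrable setT (EFin \o F).
Proof.
apply/(integrable21ltyP P mu mF); apply: le_lt_trans total.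
apply: ge0_le_integral => //.
- by move=> v _; exact: integral_ge0.
- apply: (@measurable_fun_fubini_tonelli_G _ _ T mR R P (abse \o (EFin \o F))).
    exact: measurableT_comp.
  by move=> x; exact: abse_ge0.
- apply: (@emeasurable_funM _ mR R setT (fun v => (w v)%:E)); first exact/measurable_EFinP.
  apply: (@measurable_fun_fubini_tonelli_G _ _ T mR R P
    (fun zv => (`|h zv.1| * expR (- (c zv.2 * q zv.1)))%:E)).
    apply/measurable_EFinP; apply: measurable_funM; last exact: mE.
    by apply: measurableT_comp => //; exact: (measurableT_comp mh measurable_fst).
  by move=> zv; rewrite lee_fin mulr_ge0// expR_ge0.
- move=> v _; rewrite -ge0_integralZl.
  + apply: le_of_eq; apply: eq_integral => z _ /=.
    rewrite /F/= !normrM (ger0_norm (w0 _)) (ger0_norm (expR_ge0 _)) -EFinM.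
    by congr EFin; ring.
  + by [].
  + apply/measurable_EFinP; apply: measurable_funM; first exact: measurableT_comp.
    by apply: measurable_expRN; apply: measurable_funM.
  + by move=> z _; rewrite lee_fin mulr_ge0// expR_ge0.
  + by rewrite lee_fin.
Qed.

(** Where [h] vanishes the mixture may be infinite, but both sides are 0; elsewhere [mix_fin] makes
    it a real number. This is why finiteness is asked only off the zeros of [h]. *)
Let FE z : fubini_F mu (EFin \o F) z =
  (h z * \int[mu]_v (w v * expR (- (c v * q z))))%:E.
Proof.
rewrite /fubini_F/=; have [hz|hz] := eqVneq (h z) 0.
  rewrite hz mul0r -[RHS](integral0 mu setT).
  by apply: eq_integral => v _; rewrite /F/= hz mul0r.
have iz : mu.-integrable setT (EFin \o (fun v => w v * expR (- (c v * q z)))).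
  apply/integrableP; split; first exact: mEz.
  under eq_integral do rewrite /= ger0_norm ?mulr_ge0 ?expR_ge0//.
  exact: mix_fin.
rewrite -(RintegralZl (h z) measurableT iz) /Rintegral fineK//.
exact: (integrable_fin_num measurableT (integrableRZl (h z) iz)).
Qed.

Let GE v : fubini_G P (EFin \o F) v =
  (w v * \int[P]_z (h z * expR (- (c v * q z))))%:E.
Proof.
rewrite /fubini_G/=; have [wv|wv] := eqVneq (w v) 0.
  rewrite wv mul0r -[RHS](integral0 P setT).
  by apply: eq_integral => z _; rewrite /F/= wv mul0r mulr0.
have iz := slice wv.
rewrite -(RintegralZl (w v) measurableT iz) /Rintegral fineK//.
  by apply: eq_integral => z _; congr EFin; rewrite /F/=; ring.
exact: (integrable_fin_num measurableT (integrableRZl (w v) iz)).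
Qed.

Lemma integrable_mixture : P.-integrable setT
  (EFin \o (fun z => h z * \int[mu]_v (w v * expR (- (c v * q z))))).
Proof.
by apply: eq_integrable (integrable_fubini_F iF) => // z _; rewrite FE.
Qed.

Lemma Rintegral_mixture :
  \int[P]_z (h z * \int[mu]_v (w v * expR (- (c v * q z)))) =
  \int[mu]_v (w v * \int[P]_z (h z * expR (- (c v * q z)))).
Proof.
congr fine; under eq_integral do rewrite -FE.
rewrite (integral12_prod_meas1 iF) -(integral21_prod_meas1 iF).
by apply: eq_integral => v _; rewrite GE.
Qed.
End Mixture.

Section PlaneSigmaFinite.
Context {R : realType}.
Notation mu := (@lebesgue_measure R).
Notation mR := (measurableTypeR R).

Lemma plane_sigma_finite : sigma_finite setT (plane_measure R).
Proof.
exists (fun n => `[- n.+1%:R, n.+1%:R]%classic `*` `[- n.+1%:R, n.+1%:R]%classic).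
  apply/esym/seteqP; split => // -[x y] _.
  have /= [[n _ nx] [m _ my]] : (\bigcup_n `[- n.+1%:R, n.+1%:R]%classic) x /\
    (\bigcup_n `[- n.+1%:R, n.+1%:R]%classic) y by rewrite bigcup_itv_sym.
  exists (maxn n m) => //; split => /=; move: nx my; rewrite /= !in_itv/= -!ler_norml.
    by move=> nx _; rewrite (le_trans nx)// ler_nat ltnS leq_maxl.
  by move=> _ my; rewrite (le_trans my)// ler_nat ltnS leq_maxr.
move=> n; split; first by apply: measurableX; exact: measurable_itvR.
rewrite plane_rectangle; try exact: measurable_itvR.
by rewrite lebesgue_measure_itv/=; case: ifP => _; rewrite -?EFinB -?EFinM ltry.
Qed.

(* A copy of [plane_measure] (convertible to it) with the sigma-finite structure
   required by Fubini's theorem. *)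
Definition plane_sigma : {sigma_finite_measure set (mR * mR)%type -> \bar R} :=
  HB.pack (mu \x mu)%E
   (Measure_isSigmaFinite.Build _ _ _ _ plane_sigma_finite).
End PlaneSigmaFinite.

(** * Lower bounds for quotients of Gamma functions *)

Section GammaRatio.
Context {R : realType}.
Implicit Types (a s x y : R).

(** The quotient (2+(1+s)u)/(2+(1-s)u) is the Pade approximant of order [1/1] of (1+u)^s. Equality
    holds at u = 0, and the difference of the two sides has derivative s (1-s^2) u^2 over a positive
    denominator. *)
Lemma ln_ratio_ge s u : 0 <= s <= 1 -> 0 <= u ->
  ln (2 + (1 + s) * u) - ln (2 + (1 - s) * u) <= s * ln (1 + u).
Proof.
move=> /andP[s0 s1] u0.
pose f v := s * ln (1 + v) - ln (2 + (1 + s) * v) + ln (2 + (1 - s) * v) : R.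
pose df v := s * (1 + v)^-1 - (1 + s) * (2 + (1 + s) * v)^-1 +
  (1 - s) * (2 + (1 - s) * v)^-1 : R.
have dln (k l v : R) : 0 < k + l * v ->
    is_derive v (1 : R) (fun v => ln (k + l * v)) ((k + l * v)^-1 * l).
  move=> h; have d0 : is_derive v (1 : R) (fun v : R => k + l * v) l.
    by apply: is_derive_eq; rewrite /GRing.scale/= ?(mulr0, mulr1, add0r, addr0) ?mul1r.
  exact: (@is_derive1_comp R (@ln R) (fun v : R => k + l * v) v _ _ (is_derive1_ln h) d0).
have dfE (v : R) : 0 <= v -> is_derive v (1 : R) f (df v).
  move=> v0.
  have h1 : 0 < 1 + 1 * v by rewrite mul1r; lra.
  have h2 : 0 < 2 + (1 + s) * v by nra.
  have h3 : 0 < 2 + (1 - s) * v by nra.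
  have := dln 1 1 v h1; under eq_fun do rewrite mul1r; rewrite mul1r mulr1 => d1.
  have d2 := dln _ _ _ h2.
  have d3 := dln _ _ _ h3.
  apply: is_derive_eq; rewrite /GRing.scale/= /df; ring.
have [||c c0 fE] := @MVT_segment R f df 0 u u0.
- by move=> v; rewrite in_itv/= => /andP[v0 _]; apply: dfE; exact: ltW.
- apply: continuous_in_subspaceT => v; rewrite inE/= in_itv/= => /andP[v0 _].
  apply/differentiable_continuous/derivable1_diffP.
  by have ? := dfE v v0; exact: ex_derive.
have c00 : 0 <= c by move: c0; rewrite in_itv/= => /andP[].
have df0 : 0 <= df c.
  have h1 : 0 < 1 + c by lra.
  have h2 : 0 < 2 + (1 + s) * c by nra.
  have h3 : 0 < 2 + (1 - s) * c by nra.
  have -> : df c = s * (1 - s ^+ 2) * c ^+ 2 /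
      ((1 + c) * (2 + (1 + s) * c) * (2 + (1 - s) * c)).
    by rewrite /df; field; rewrite !gt_eqF.
  rewrite divr_ge0 ?mulr_ge0 ?sqr_ge0 ?(ltW h1) ?(ltW h2) ?(ltW h3)//.
  by rewrite subr_ge0 expr_le1.
have : 0 <= f u - f 0 by rewrite fE subr0 mulr_ge0.
rewrite /f !mulr0 !addr0 ln1 mulr0; lra.
Qed.

(** [ln_ratio_ge] at u = 1/x. It is exactly what one step x -> x + 1 of the induction for the Gamma
    ratio requires. *)
Lemma powR_ratio_ge s x : 0 <= s <= 1 -> 0 < x ->
  x `^ s * (x + (1 + s) / 2) <= (x + 1) `^ s * (x + (1 - s) / 2).
Proof.
move=> /[dup] s01 /andP[s0 s1] x0.
have h1 : 0 < x + (1 + s) / 2 by lra.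
have h2 : 0 < x + (1 - s) / 2 by lra.
have x10 : 0 < x + 1 by lra.
have xV : 0 <= x^-1 by rewrite invr_ge0 ltW.
have := ln_ratio_ge s01 xV.
have -> : 2 + (1 + s) / x = 2 / x * (x + (1 + s) / 2) by field; rewrite gt_eqF.
have -> : 2 + (1 - s) / x = 2 / x * (x + (1 - s) / 2) by field; rewrite gt_eqF.
have -> : 1 + x^-1 = (x + 1) / x by field; rewrite gt_eqF.
have x2 : 0 < 2 / x by rewrite divr_gt0.
rewrite !lnM ?posrE ?invr_gt0// lnV ?posrE// => H.
rewrite -ler_ln ?posrE ?mulr_gt0 ?powR_gt0//.
rewrite !lnM ?posrE ?powR_gt0// !ln_powR; lra.
Qed.

(* The induction moves x to x + n, where the remaining factor tends to 1. *)
Lemma Gamma_ratio_ge_aux s x n : 0 <= s <= 1 -> 0 < x ->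
  x `^ s * Gamma (x + (1 - s) / 2) *
    ((x + (1 - s) / 2 + n%:R) / (x + (1 - s) / 2 + n%:R + s)) <=
  Gamma (x + (1 - s) / 2 + s).
Proof.
move=> /[dup] s01 /andP[s0 s1]; elim: n x => [|n IH] x x0; set y := x + (1 - s) / 2.
  have y0 : 0 < y by rewrite /y; lra.
  have ys0 : 0 < y + s by lra.
  have G0 := Gamma_gt0 y0; have Gs0 := Gamma_gt0 ys0.
  rewrite addr0 mulrA ler_pdivrMr//.
  (* Base case: Wendel's inequality from y + s to y + 1, whose power of y + s is then combined with
     x <= y + s. *)
  have := @Gamma_wendel R (y + s) (1 - s) ys0.
  rewrite subr_ge0 s1 lerBlDr lerDl s0 => /(_ isT).
  have -> : y + s + (1 - s) = y + 1 by ring.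
  rewrite GammaD1// => H.
  apply: (@le_trans _ _ (x `^ s * ((y + s) `^ (1 - s) * Gamma (y + s)))).
    by rewrite -mulrA (mulrC (Gamma y)) ler_wpM2l ?powR_ge0.
  rewrite mulrA mulrC ler_wpM2l ?(ltW Gs0)//.
  apply: (@le_trans _ _ ((y + s) `^ s * (y + s) `^ (1 - s))).
    rewrite ler_wpM2r ?powR_ge0//; apply: ler_powRl; rewrite /y; clear -x0 s0 s1; lra.
  rewrite -powRD; last by rewrite (gt_eqF ys0) implybT.
  have -> : s + (1 - s) = 1 by ring.
  by rewrite powRr1// ltW.
have y0 : 0 < y by rewrite /y; lra.
have ys0 : 0 < y + s by lra.
have x10 : 0 < x + 1 by lra.
have := IH (x + 1) x10.
have -> : x + 1 + (1 - s) / 2 = y + 1 by rewrite /y; ring.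
have -> : y + 1 + s = y + s + 1 by ring.
rewrite !GammaD1//.
have -> : y + 1 + n%:R = y + n.+1%:R by rewrite -natr1; ring.
set c := (_ / _) => H.
have n0 : 0 <= (n.+1%:R : R) by [].
have c0 : 0 <= c by rewrite /c divr_ge0//; clear -n0 y0 s0; lra.
have K := @powR_ratio_ge s x s01 x0.
rewrite -(ler_pM2l ys0); apply: le_trans H.
have -> : (y + s) * (x `^ s * Gamma y * c) = x `^ s * (x + (1 + s) / 2) * (Gamma y * c).
  by rewrite /y; field.
have -> : (x + 1) `^ s * (y * Gamma y) * c = (x + 1) `^ s * (x + (1 - s) / 2) * (Gamma y * c).
  by rewrite /y; field.
by rewrite ler_wpM2r// mulr_ge0// ltW// Gamma_gt0.
Qed.

(** The limit of [Gamma_ratio_ge_aux] for large n, with s = 1 - 2a, for which the shift (1-s)/2 is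
    a. *)
Lemma Gamma_ratio_ge a x : 0 <= a <= 2^-1 -> 0 < x ->
  x `^ (1 - 2 * a) * Gamma (x + a) <= Gamma (x + 1 - a).
Proof.
move=> /andP[a0 a1] x0; pose s := 1 - 2 * a.
have s01 : 0 <= s <= 1 by rewrite /s; apply/andP; split; lra.
have aE : (1 - s) / 2 = a by rewrite /s; field.
have xa : 0 < x + a by lra.
have L0 : 0 <= x `^ s * Gamma (x + a) by rewrite mulr_ge0 ?powR_ge0// ltW// Gamma_gt0.
rewrite -/s; apply/ler_addgt0Pr => e e0.
pose M := x `^ s * Gamma (x + a).
(* The correction factor costs M s/(x + a + N + s) with N = n + 1, which is at most M/N and hence at
   most e. *)
pose n := Num.truncn (M / e).
have nM : M / e < n.+1%:R by exact: truncnS_gt.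
have := @Gamma_ratio_ge_aux s x n.+1 s01 x0; rewrite aE -/M.
have -> : x + a + s = x + 1 - a by rewrite /s; ring.
move=> H.
have [s0 s1] := andP s01.
have n0 : 0 < (n.+1%:R : R) by rewrite ltr0n.
have d0 : 0 < x + a + n.+1%:R + s by clear -n0 xa s0; lra.
rewrite -lerBlDr; apply: le_trans H.
move: (n.+1%:R : R) n0 d0 nM => N n0 d0 nM.
have xaN : x + a + N = x + a + N + s - s by rewrite addrK.
rewrite {1}xaN mulrBl divff ?gt_eqF// mulrBr mulr1 mulrA.
rewrite lerB// ler_pdivrMr//.
apply: (@le_trans _ _ M); first by rewrite ler_piMr.
have := ltW nM; rewrite ler_pdivrMr// => /le_trans; apply.
by rewrite mulrC ler_wpM2l ?(ltW e0)//; lra.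
Qed.

End GammaRatio.

Section GammaQuotient.
Context {R : realType}.

Lemma Gamma_quotient_ge (p q : R) (k : nat) : 2 <= p -> p^-1 + q^-1 = 1 -> (0 < k)%N ->
  2^-1 * k%:R `^ (1 - 2 / p) * (p - 1) <=
    (Gamma p^-1 * Gamma (q^-1 + k%:R / 2)) /
    (Gamma q^-1 * Gamma (p^-1 + k%:R / 2)).
Proof.
move=> hp hpq hk; have p0 : 0 < p by lra.
pose a := p^-1; have a0 : 0 < a by rewrite invr_gt0.
have a1 : a <= 2^-1 by rewrite lef_pV2 ?posrE.
have qE : q^-1 = 1 - a by rewrite /a; lra.
have pE : p = a^-1 by rewrite invrK.
rewrite qE -/a pE.
clearbody a; clear hpq pE qE hp p0 p q.
have k0 : 0 < (k%:R : R) by rewrite ltr0n.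
have x0 : 0 < (k%:R / 2 : R) by rewrite divr_gt0.
have a01 : 0 <= a <= 2^-1 by rewrite (ltW a0).
have K := Gamma_ratio_ge a01 x0.
have a10 : 0 < 1 - a by clear -a1; lra.
have G1 := Gamma_gt0 a0; have G2 := Gamma_gt0 a10.
have xa0 : 0 < k%:R / 2 + a by rewrite addr_gt0.
have G3 := Gamma_gt0 xa0.
have W : 4 `^ (- a) * ((1 - a) * Gamma (1 - a)) <= a * Gamma a.
  rewrite -(GammaD1 a0) -(GammaD1 a10).
  have s01 : 0 <= 1 - 2 * a <= 1 by clear -a0 a1; apply/andP; split; lra.
  have a11 : 0 < a + 1 by rewrite addr_gt0.
  have := @Gamma_wendel R (a + 1) (1 - 2 * a) a11 s01.
  have -> : a + 1 + (1 - 2 * a) = 1 - a + 1 by ring.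
  move=> H; apply: (le_trans (ler_wpM2l (powR_ge0 _ _) H)).
  rewrite mulrA ler_piMl ?(ltW (Gamma_gt0 a11))//.
  (* What remains is 4^(-a) (1+a)^(1-2a) <= 1. Tangent bounds give (1+a)^(1-2a) <= 1 + (1-2a)a <= 1
     + a and 2^(-a) <= 1 - a/2, and (1-a/2)^2 (1+a) = 1 - 3a^2/4 + a^3/4. *)
  have h1 : (a + 1) `^ (1 - 2 * a) <= 1 + a.
    have := @powR_le_affine R (a + 1) (1 - 2 * a) s01; rewrite (ltW a11) => /(_ isT).
    by clear -a0 a1; nra.
  have h2 : 4 `^ (- a) <= (1 - a / 2) ^+ 2.
    have -> : (4 : R) = 2^-1 ^- 2 by field.
    rewrite -powR_invn// -powRrM.
    have -> : - 2%:R * - a = a * 2%:R by ring.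
    rewrite powRrM powR_mulrn ?powR_ge0//.
    rewrite ler_pXn2r ?nnegrE ?powR_ge0//; last by clear -a0 a1; lra.
    have a02 : 0 <= a <= 1 by clear -a0 a1; apply/andP; split; lra.
    have := @powR_le_affine R 2^-1 a a02; rewrite invr_ge0 ler0n => /(_ isT); clear; lra.
  apply: (le_trans (ler_pM (powR_ge0 _ _) (powR_ge0 _ _) h2 h1)).
  clear -a0 a1; nra.
(* Origin of the constant 1/2: it equals 4^(-a) 2^(-(1-2a)), where the first factor is consumed by
   [W] and the second turns k into k/2. The factor p - 1 = (1-a)/a supplies the 1 - a of [W]. *)
have e1 : 2^-1 * k%:R `^ (1 - 2 * a) = 4 `^ (- a) * (k%:R / 2) `^ (1 - 2 * a).
  rewrite powRM ?invr_ge0// -powR_inv1// -powRrM.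
  have -> : (4 : R) = 2 ^+ 2 by ring.
  rewrite -powR_mulrn// -powRrM mulrCA -powRD; last by rewrite pnatr_eq0 implybT.
  rewrite mulrC; congr (_ * _ `^ _); ring.
have G4 : 0 < Gamma (1 - a + k%:R / 2) by apply: Gamma_gt0; rewrite addr_gt0.
rewrite ler_pdivlMr; last by apply: mulr_gt0; [exact: G2|rewrite addrC; exact: G3].
rewrite [a + _]addrC.
have -> : 1 - a + k%:R / 2 = k%:R / 2 + 1 - a by ring.
rewrite e1.
have -> : 4 `^ (- a) * (k%:R / 2) `^ (1 - 2 * a) * (a^-1 - 1) *
   (Gamma (1 - a) * Gamma (k%:R / 2 + a)) =
   a^-1 * (4 `^ (- a) * ((1 - a) * Gamma (1 - a))) *
   ((k%:R / 2) `^ (1 - 2 * a) * Gamma (k%:R / 2 + a)) by field; rewrite gt_eqF.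
have -> : Gamma a * Gamma (k%:R / 2 + 1 - a) =
  a^-1 * (a * Gamma a) * Gamma (k%:R / 2 + 1 - a) by field; rewrite gt_eqF.
apply: ler_pM.
- apply: mulr_ge0; first by rewrite invr_ge0 ltW.
  exact: mulr_ge0 (powR_ge0 _ _) (mulr_ge0 (ltW a10) (ltW G2)).
- by rewrite mulr_ge0 ?powR_ge0 ?(ltW G3).
- by rewrite ler_wpM2l ?invr_ge0 ?(ltW a0).
- exact: K.
Qed.
End GammaQuotient.

(** * Mixtures of Gaussians *)

Section Modulus.
Context {R : realType}.
Implicit Types z w : R[i].

Lemma cmodulusE z : cmodulus z = Num.sqrt (Re z ^+ 2 + Im z ^+ 2).
Proof. by case: z. Qed.

Lemma cmodulus_ge0 z : 0 <= cmodulus z.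
Proof. by rewrite cmodulusE sqrtr_ge0. Qed.

Lemma cmodulusM z w : cmodulus (z * w) = cmodulus z * cmodulus w.
Proof. exact: ComplexField.Normc.normcM. Qed.

Lemma cmodulus1 : cmodulus (1 : R[i]) = 1.
Proof. by rewrite cmodulusE/= expr1n expr0n addr0 sqrtr1. Qed.

Lemma cmodulusX z n : cmodulus (z ^+ n) = cmodulus z ^+ n.
Proof. by elim: n => [|n IH]; rewrite ?expr0 ?cmodulus1// !exprS cmodulusM IH. Qed.

Lemma cmodulus_real (x : R) : cmodulus (real_complex R x) = `|x|.
Proof. by rewrite cmodulusE/= expr0n addr0 sqrtr_sqr. Qed.

Lemma cmodulus_cis (t : R) : cmodulus (cis t) = 1.
Proof. by rewrite cmodulusE/= cos2Dsin2 sqrtr1. Qed.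

Lemma cmodulus_point (z : R * R) : cmodulus (plane_point z) = Num.sqrt (sqmod z).
Proof. by rewrite cmodulusE. Qed.

Lemma Re_le_cmodulus z : `|Re z| <= cmodulus z.
Proof. by rewrite cmodulusE -sqrtr_sqr ler_wsqrtr// lerDl sqr_ge0. Qed.

Lemma Im_le_cmodulus z : `|Im z| <= cmodulus z.
Proof. by rewrite cmodulusE -sqrtr_sqr ler_wsqrtr// lerDr sqr_ge0. Qed.

Lemma sqmod_ge0 (z : R * R) : 0 <= sqmod z.
Proof. by rewrite /sqmod addr_ge0 ?sqr_ge0. Qed.

Lemma cmodulus_pointX (z : R * R) n :
  cmodulus (plane_point z ^+ n) = sqmod z `^ (n%:R / 2).
Proof.
rewrite cmodulusX cmodulus_point -powR12_sqrt ?sqmod_ge0//.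
by rewrite -powR_mulrn ?powR_ge0// -powRrM mulrC.
Qed.
End Modulus.

Section MeasurableReal.
Context {R : realType}.
Notation mR := (measurableTypeR R).

(** Inversion is total and sends 0 to 0; as x (x^2)^(-1) it reduces to the measurability of real
    powers. *)
Lemma measurable_invr : measurable_fun [set: R] (fun x : R => x^-1).
Proof.
rewrite (_ : (fun x : R => x^-1) = (fun x => x * (x ^+ 2) `^ (-1))).
  apply: measurable_funM => //.
  apply: (@measurableT_comp _ _ _ _ _ _ (@powR R ^~ (-1))).
    exact: measurable_powR.
  exact: exprn_measurable.
apply/funext => x; rewrite powR_inv1 ?sqr_ge0//.
have [->|x0] := eqVneq x 0; first by rewrite invr0 mul0r.
by field.
Qed.

Lemma measurable_plane_pointX k :
  measurable_fun [set: mR * mR] (fun z => Re (plane_point z ^+ k)) /\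
  measurable_fun [set: mR * mR] (fun z => Im (plane_point z ^+ k)).
Proof.
elim: k => [|k [IHr IHi]]; first by split; exact: measurable_cst.
have m1 : measurable_fun [set: mR * mR] (fun z : mR * mR => z.1) by exact: measurable_fst.
have m2 : measurable_fun [set: mR * mR] (fun z : mR * mR => z.2) by exact: measurable_snd.
split.
  under eq_fun do rewrite exprS Re_mul/=.
  by apply: measurable_funB; apply: measurable_funM.
under eq_fun do rewrite exprS Im_mul/=.
by apply: measurable_funD; apply: measurable_funM.
Qed.

Lemma measurable_cis_linear (a b : R) :
  measurable_fun [set: mR * mR] (fun z => Re (cis (- (a * z.1 + b * z.2)))) /\
  measurable_fun [set: mR * mR] (fun z => Im (cis (- (a * z.1 + b * z.2)))).
Proof.
have m1 : measurable_fun [set: mR * mR] (fun z : mR * mR => z.1) by exact: measurable_fst.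
have m2 : measurable_fun [set: mR * mR] (fun z : mR * mR => z.2) by exact: measurable_snd.
have m : measurable_fun [set: mR * mR] (fun z : mR * mR => - (a * z.1 + b * z.2) : R).
  by apply: measurable_funN; apply: measurable_funD; apply: measurable_funM.
split=> /=.
  apply: (@measurableT_comp _ _ _ _ _ _ (@cos R)) => //.
  exact: (continuous_measurable_fun (@continuous_cos R)).
apply: (@measurableT_comp _ _ _ _ _ _ (@sin R)) => //.
exact: (continuous_measurable_fun (@continuous_sin R)).
Qed.
End MeasurableReal.

Section PlanePatch.
Context {R : realType}.
Notation mR := (measurableTypeR R).
Notation plane := (plane_measure R).

(** The origin is a null set. This reconciles the convention that mixtures vanish there with the
    integrals of Gaussians, which need not. *)
Lemma Rintegral_plane_ne0 (f : mR * mR -> R) :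
  plane.-integrable setT (EFin \o f) ->
  \int[plane]_z f z = \int[plane]_z (if sqmod z == 0 then 0 else f z).
Proof.
move=> fi; pose N : set (mR * mR) := sqmod @^-1` [set 0].
have mN : measurable N.
  by rewrite -[N]setTI; apply: measurable_sqmod => //; exact: measurable_set1.
have N0 : plane N = 0%E.
  have -> : N = [set 0] `*` [set 0].
    apply/seteqP; split => [[x y]|[x y]]; rewrite /N/sqmod/=.
      move=> xy; have : x ^+ 2 = 0 /\ y ^+ 2 = 0 by split; nra.
      by move=> [/eqP + /eqP]; rewrite !expf_eq0/= => /eqP -> /eqP ->.
    by move=> [-> ->]; rewrite expr0n/= addr0.
  rewrite plane_rectangle; try exact: measurable_set1.
  by rewrite lebesgue_measure_set1 mul0e.
rewrite /Rintegral (negligible_integral mN measurableT fi N0) setTD integral_mkcond.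
congr fine; apply: eq_integral => z _; rewrite patchE.
have [z0|z0] := eqVneq (sqmod z) 0; first by rewrite memNset//= => /(_ z0).
by rewrite mem_set//= => /= z1; rewrite z1 eqxx in z0.
Qed.
End PlanePatch.

Section RadialMoment.
Context {R : realType}.
Notation mu := (@lebesgue_measure R).
Notation mR := (measurableTypeR R).
Notation plane := (plane_measure R).

Lemma measurable_radial (g : R -> R) : measurable_fun [set: R] g ->
  measurable_fun [set: mR * mR] (fun z => g (sqmod z)).
Proof. by move=> mg; exact: (measurableT_comp mg (@measurable_sqmod R)). Qed.

Lemma plane_gaussian_moment : exists2 C : R, 0 < C & forall s c : R,
  0 <= s -> 0 < c ->
  (\int[plane]_z (sqmod z `^ s * expR (- (c * sqmod z)))%:E =
   (C * (Gamma (s + 1) * c `^ (- (s + 1))))%:E)%E.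
Proof.
have [C C0 H] := @plane_integral_radial R; exists C => // s c s0 c0.
have mg : measurable_fun [set: R] (fun t => (t `^ s * expR (- (c * t)))%:E).
  apply/measurable_EFinP; apply: measurable_funM; first exact: measurable_powR.
  by apply: measurable_expRN; exact: mulrl_measurable.
have g0 t : (0 <= (t `^ s * expR (- (c * t)))%:E)%E.
  by rewrite lee_fin mulr_ge0 ?powR_ge0 ?expR_ge0.
rewrite (H _ mg g0) EFinM; congr (_ * _)%E.
have s1 : -1 < s by lra.
have := integral_pow_gt_expR 0 s1 c0.
rewrite mulr0 oppr0 expR0 mulr1 => <-.
rewrite -integral_gtr0; apply: eq_integral => t _.
rewrite -EFinM; congr EFin; rewrite /pow_gt subr0.
by case: ifP => _; rewrite ?mul0r ?mul1r.
Qed.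
End RadialMoment.

(** * Fourier transforms of z^k times a radial mixture of Gaussians *)

Section MixtureHarmonic.
Context {R : realType}.
Notation mu := (@lebesgue_measure R).
Notation mR := (measurableTypeR R).
Notation plane := (plane_measure R).
Local Notation "x %:C" := (real_complex R x).
Variables (k : nat) (w c : mR -> R).
Hypothesis mw : measurable_fun setT w.
Hypothesis mc : measurable_fun setT c.
Hypothesis w0 : forall v, 0 <= w v.
Hypothesis wc : forall v, w v != 0 -> 0 < c v.
Hypothesis fin : forall t, 0 < t ->
  (\int[mu]_v (w v * expR (- (c v * t)))%:E < +oo)%E.
Hypothesis tot :
  (\int[mu]_v (w v * c v `^ (- (k%:R / 2 + 1)))%:E < +oo)%E.

Definition mixture (t : R) : R := \int[mu]_v (w v * expR (- (c v * t))).

(* At the origin the mixture may diverge; the value there is set to 0. *)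
Definition mixture_harmonic (a b : R) (z : R * R) : R[i] :=
  if sqmod z == 0 then 0 else
  plane_point z ^+ k * (mixture (sqmod z))%:C * cis (- (a * z.1 + b * z.2)).

Section part.
Variables (a b : R) (P : R[i] -> R).
Hypothesis P0 : P 0 = 0.
Hypothesis P_le : forall z, `|P z| <= cmodulus z.
Hypothesis P_real : forall (x : R) z, P (x%:C * z) = x * P z.
Hypothesis P_harm : measurable_fun [set: mR * mR]
  (fun z => P (plane_point z ^+ k * cis (- (a * z.1 + b * z.2)))).
Hypothesis P_int : forall d, 0 < d -> plane.-integrable setT
  (EFin \o (fun z => P (gaussian_harmonic d k a b z))).
Hypothesis P_cint : forall d, 0 < d ->
  \int[plane]_z P (gaussian_harmonic d k a b z) = P (cint plane (gaussian_harmonic d k a b)).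

(** [P] stands for [Re] or [Im], so that Fubini's theorem is applied once, to real functions. As [h]
    is 0 at the origin, finiteness of the mixture at positive arguments suffices. *)
Let h (z : mR * mR) : R := if sqmod z == 0 then 0 else
  P (plane_point z ^+ k * cis (- (a * z.1 + b * z.2))).

Let mh : measurable_fun setT h.
Proof.
apply: measurable_fun_ifT => //.
by apply: measurable_fun_eqr => //; exact: measurable_sqmod.
Qed.

Let h_le z : `|h z| <= sqmod z `^ (k%:R / 2).
Proof.
rewrite /h; case: ifP => _; first by rewrite normr0 powR_ge0.
by rewrite (le_trans (P_le _))// cmodulusM cmodulus_cis mulr1 cmodulus_pointX.
Qed.

Let hE d z : h z * expR (- (d * sqmod z)) =
  if sqmod z == 0 then 0 else P (gaussian_harmonic d k a b z).
Proof.
rewrite /h; case: ifP => _; first by rewrite mul0r.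
by rewrite /gaussian_harmonic mulrAC mulrC -P_real mulrC.
Qed.

Let ih d : 0 < d -> plane.-integrable setT (EFin \o (fun z => h z * expR (- (d * sqmod z)))).
Proof.
move=> d0; apply: le_integrable (P_int d0) => //.
  apply/measurable_EFinP; apply: measurable_funM; first exact: mh.
  apply: (@measurable_radial R (fun t => expR (- (d * t)))).
  by apply: measurable_expRN; exact: mulrl_measurable.
move=> z _ /=; rewrite lee_fin hE; case: ifP => // _.
by rewrite normr0.
Qed.

Let integral_h d : 0 < d -> \int[plane]_z (h z * expR (- (d * sqmod z))) =
  P (cint plane (gaussian_harmonic d k a b)).
Proof.
move=> d0; rewrite -(P_cint d0) (Rintegral_plane_ne0 (P_int d0)).
by apply: eq_Rintegral => z _; rewrite hE.
Qed.

(** Since |h| <= |z|^k, the inner integral is at most the Gaussian moment C Gamma(k/2+1)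
    c^(-(k/2+1)); this is where the hypothesis [tot] gets its exponent. *)
Let total :
  (\int[mu]_v ((w v)%:E * \int[plane_sigma]_z (`|h z| * expR (- (c v * sqmod z)))%:E) < +oo)%E.
Proof.
have [C C0 HC] := @plane_gaussian_moment R.
have G0 : 0 < k%:R / 2 + 1 :> R by rewrite ltr_pwDr// divr_ge0.
have mc' : measurable_fun [set: mR] (fun v : mR => c v `^ (- (k%:R / 2 + 1))).
  exact: (measurableT_comp (@measurable_powR R (- (k%:R / 2 + 1))) mc).
have mE : measurable_fun [set: (mR * mR) * mR] (fun zv : (mR * mR) * mR => expR (- (c zv.2 * sqmod zv.1)) : mR).
  apply: measurable_expRN; apply: measurable_funM.
    exact: (measurableT_comp mc measurable_snd).
  exact: (measurableT_comp (@measurable_sqmod R) measurable_fst).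
apply: (@le_lt_trans _ _ ((C * Gamma (k%:R / 2 + 1))%:E *
    \int[mu]_v (w v * c v `^ (- (k%:R / 2 + 1)))%:E)%E); last first.
  have CG : (0 <= (C * Gamma (k%:R / 2 + 1))%:E)%E.
    by rewrite lee_fin mulr_ge0 ?(ltW C0)// ltW// Gamma_gt0.
  exact: lte_mul_pinfty.
rewrite -ge0_integralZl; [|by []| | |]; last 3 first.
- by apply/measurable_EFinP; apply: measurable_funM.
- by move=> v _; rewrite lee_fin mulr_ge0 ?powR_ge0.
- by rewrite lee_fin mulr_ge0 ?(ltW C0)// ltW// Gamma_gt0.
have T1 (v : mR) : (0 <= (w v)%:E * \int[plane_sigma]_z (`|h z| * expR (- (c v * sqmod z)))%:E)%E.
  by rewrite mule_ge0 ?lee_fin// integral_ge0// => z _; rewrite lee_fin mulr_ge0// expR_ge0.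
have T2 : measurable_fun [set: mR] (fun v : mR =>
    (w v)%:E * \int[plane_sigma]_z (`|h z| * expR (- (c v * sqmod z)))%:E)%E.
  apply: (@emeasurable_funM _ mR R setT (fun v => (w v)%:E)); first by apply/measurable_EFinP.
  apply: (@measurable_fun_fubini_tonelli_G _ _ _ mR R plane_sigma
    (fun zv => (`|h zv.1| * expR (- (c zv.2 * sqmod zv.1)))%:E)).
    apply/measurable_EFinP; apply: measurable_funM; last exact: mE.
    by apply: measurableT_comp => //; exact: (measurableT_comp mh measurable_fst).
  by move=> zv; rewrite lee_fin mulr_ge0// expR_ge0.
have T3 : measurable_fun [set: mR] (fun v : mR =>
   (C * Gamma (k%:R / 2 + 1))%:E * (w v * c v `^ (- (k%:R / 2 + 1)))%:E)%E.
  by apply/measurable_EFinP; apply: measurable_funM => //; apply: measurable_funM.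
apply: ge0_le_integral; [exact: measurableT | by move=> v ? ; exact: T1 | exact: T2 | exact: T3 |].
move=> v _; have [wv|wv] := eqVneq (w v) 0; first by rewrite wv mul0e mul0r mule0.
have cv := wc wv.
have -> : ((C * Gamma (k%:R / 2 + 1))%:E * (w v * c v `^ (- (k%:R / 2 + 1)))%:E =
  (w v)%:E * (C * (Gamma (k%:R / 2 + 1) * c v `^ (- (k%:R / 2 + 1))))%:E)%E.
  by rewrite -!EFinM; congr EFin; ring.
apply: lee_wpmul2l; first by rewrite lee_fin.
have k20 : 0 <= k%:R / 2 :> R by rewrite divr_ge0.
have mE1 : measurable_fun [set: mR * mR] (fun z : mR * mR => expR (- (c v * sqmod z)) : mR).
  apply: (@measurable_radial R (fun t => expR (- (c v * t)))).
  by apply: measurable_expRN; exact: mulrl_measurable.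
rewrite -(HC (k%:R / 2) (c v) k20 cv); apply: ge0_le_integral_EFin.
- by apply: measurable_funM => //; exact: measurableT_comp.
- apply: measurable_funM => //.
  by apply: (@measurable_radial R (fun t => t `^ (k%:R / 2))); exact: measurable_powR.
- by move=> z; rewrite mulr_ge0 ?expR_ge0//= ler_wpM2r ?expR_ge0.
Qed.

Let fin' z : h z != 0 -> (\int[mu]_v (w v * expR (- (c v * sqmod z)))%:E < +oo)%E.
Proof.
move=> hz; apply: fin; rewrite lt_neqAle sqmod_ge0 andbT eq_sym.
by apply: contra hz => z0; rewrite /h z0.
Qed.

Let hmE z : P (mixture_harmonic a b z) = h z * mixture (sqmod z).
Proof.
rewrite /mixture_harmonic /h; case: ifP => _; first by rewrite P0 mul0r.
by rewrite mulrAC mulrC P_real mulrC.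
Qed.

Lemma integrable_part : plane.-integrable setT (EFin \o (fun z => P (mixture_harmonic a b z))).
Proof.
have := @integrable_mixture _ _ R plane_sigma h sqmod w c mh (@measurable_sqmod R)
  mw mc w0 fin' total.
by apply: eq_integrable => // z _; rewrite /= hmE.
Qed.

Lemma Rintegral_part : \int[plane]_z P (mixture_harmonic a b z) =
  \int[mu]_v (w v * P (cint plane (gaussian_harmonic (c v) k a b))).
Proof.
under eq_Rintegral do rewrite hmE.
have := @Rintegral_mixture _ _ R plane_sigma h sqmod w c mh (@measurable_sqmod R)
  mw mc w0 fin' (fun v wv => ih (wc wv)) total.
move=> ->; apply: eq_Rintegral => v _.
have [->|wv] := eqVneq (w v) 0; first by rewrite !mul0r.
by congr (_ * _); exact: integral_h (wc wv).
Qed.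
End part.

Let slice_value (a b v : R) : R :=
  (2 * c v)^-1 ^+ k * (pi / c v * expR (- ((a ^+ 2 + b ^+ 2) / (4 * c v)))).

Let cint_slice a b v : w v != 0 -> cint plane (gaussian_harmonic (c v) k a b) =
  (slice_value a b v)%:C * (Complex 0 (-1) * (a%:C + Complex 0 1 * b%:C)) ^+ k.
Proof.
move=> wv; rewrite cint_gaussian_harmonic ?wc// exprMn -fmorphV -rmorphXn/=.
by rewrite -[LHS]mulrA [LHS]mulrC; congr (_ * _); rewrite -(rmorphM (real_complex R)).
Qed.

(** Slice by slice, each Gaussian contributes the same factor (-i(a+ib))^k times a nonnegative
    scalar. The factor leaves the integral over v, and a real mixture remains. *)
Lemma cint_mixture_harmonic a b :
  cintble plane (mixture_harmonic a b) /\
  cint plane (mixture_harmonic a b) =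
  (Complex 0 (-1) * (a%:C + Complex 0 1 * b%:C)) ^+ k *
  (\int[mu]_v (w v * ((2 * c v)^-1 ^+ k *
     (pi / c v * expR (- ((a ^+ 2 + b ^+ 2) / (4 * c v)))))))%:C.
Proof.
have [mXr mXi] := @measurable_plane_pointX R k.
have [mcr mci] := @measurable_cis_linear R a b.
have mRe : measurable_fun [set: mR * mR]
    (fun z => Re (plane_point z ^+ k * cis (- (a * z.1 + b * z.2)))).
  under eq_fun do rewrite Re_mul.
  by apply: measurable_funB; apply: measurable_funM.
have mIm : measurable_fun [set: mR * mR]
    (fun z => Im (plane_point z ^+ k * cis (- (a * z.1 + b * z.2)))).
  under eq_fun do rewrite Im_mul.
  by apply: measurable_funD; apply: measurable_funM.
have iRe d (d0 : 0 < d) := (cintble_gaussian_harmonic d0 k a b).1.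
have iIm d (d0 : 0 < d) := (cintble_gaussian_harmonic d0 k a b).2.
have i1 := integrable_part (erefl : Re 0 = 0) (@Re_le_cmodulus R) (@Re_realM R) mRe.
have i2 := integrable_part (erefl : Im 0 = 0) (@Im_le_cmodulus R) (@Im_realM R) mIm.
split; first by split.
set X := (Complex 0 (-1) * _) ^+ k.
have msv : measurable_fun [set: mR] (fun v : mR => w v * slice_value a b v).
  have m2c : measurable_fun [set: mR] (fun v : mR => (2 * c v)^-1).
    apply: (@measurableT_comp _ _ _ _ _ _ (fun x : R => x^-1)); first exact: measurable_invr.
    by apply: measurable_funM.
  have mic : measurable_fun [set: mR] (fun v : mR => (c v)^-1).
    by apply: (@measurableT_comp _ _ _ _ _ _ (fun x : R => x^-1)); first exact: measurable_invr.
  have m4c : measurable_fun [set: mR] (fun v : mR => (4 * c v)^-1).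
    apply: (@measurableT_comp _ _ _ _ _ _ (fun x : R => x^-1)); first exact: measurable_invr.
    by apply: measurable_funM.
  apply: measurable_funM; first exact: mw.
  apply: measurable_funM; first by apply: measurable_funX.
  apply: measurable_funM; first by apply: measurable_funM.
  by apply: measurable_expRN; apply: measurable_funM.
have sv0 v : 0 <= w v * slice_value a b v.
  have [->|wv] := eqVneq (w v) 0; first by rewrite mul0r.
  have cv := ltW (wc wv).
  by rewrite mulr_ge0// mulr_ge0 ?exprn_ge0 ?invr_ge0 ?mulr_ge0 ?expR_ge0 ?invr_ge0// ?pi_ge0.
apply: complexP.
  rewrite [LHS](Rintegral_part (erefl : Re 0 = 0) (@Re_le_cmodulus R) (@Re_realM R) mRe iRe (fun d _ => erefl)).
  rewrite (mulrC X) [RHS]Re_realM [RHS]mulrC -(ge0_RintegralZl (Re X) msv sv0).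
  apply: eq_Rintegral => v _; have [->|wv] := eqVneq (w v) 0; first by rewrite !mul0r mulr0.
  by rewrite (cint_slice a b wv) Re_realM mulrA mulrC.
rewrite [LHS](Rintegral_part (erefl : Im 0 = 0) (@Im_le_cmodulus R) (@Im_realM R) mIm iIm (fun d _ => erefl)).
rewrite (mulrC X) [RHS]Im_realM [RHS]mulrC -(ge0_RintegralZl (Im X) msv sv0).
apply: eq_Rintegral => v _; have [->|wv] := eqVneq (w v) 0; first by rewrite !mul0r mulr0.
by rewrite (cint_slice a b wv) Im_realM mulrA mulrC.
Qed.
End MixtureHarmonic.

(** * The test function and its image *)

Section Weights.
Context {R : realType}.
Notation mu := (@lebesgue_measure R).
Notation mR := (measurableTypeR R).

Definition tail (a e x : R) : R := if a < x then x `^ e else 0.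

Lemma tail_ge0 a e x : 0 <= tail a e x.
Proof. by rewrite /tail; case: ifP => // _; exact: powR_ge0. Qed.

Lemma measurable_tail a e : measurable_fun [set: mR] (tail a e).
Proof.
by apply: measurable_fun_ifT => //; exact: measurable_fun_ltr.
Qed.

Lemma measurable_expR_inv (c : R) : measurable_fun [set: mR] (fun x : mR => expR (- (c / x)) : mR).
Proof.
by apply: measurable_expRN; apply: measurable_funM => //; exact: measurable_invr.
Qed.

Lemma measurable_expR_lin (c : R) : measurable_fun [set: mR] (fun x : mR => expR (- (c * x)) : mR).
Proof.
by apply: measurable_expRN; apply: measurable_funM.
Qed.

(** For x > a the factor e^(1-a/x) is at least 1, so e times the integral of
    [integral_pow_gt_expR_inv] dominates. *)
Lemma integral_tail_lty (a s : R) : 0 < a -> 0 < s ->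
  (\int[mu]_x (tail a (- s - 1) x)%:E < +oo)%E.
Proof.
move=> a0 s0.
have mg : measurable_fun [set: mR] (fun x : mR => pow_gt 0 (- s - 1) x * expR (- (a / x))).
  by apply: measurable_funM; [exact: measurable_pow_gt|exact: measurable_expR_inv].
have g0 (x : mR) : 0 <= pow_gt 0 (- s - 1) x * expR (- (a / x)).
  by rewrite mulr_ge0 ?pow_gt_ge0 ?expR_ge0.
apply: (@ge0_integral_lty_le _ mR R mu _
   (fun x => expR 1 * (pow_gt 0 (- s - 1) x * expR (- (a / x))))).
- exact: measurable_tail.
- by apply: measurable_funM.
- move=> x; rewrite tail_ge0/= /tail; case: ifP => [ax|_]; last by rewrite mulr_ge0 ?expR_ge0.
  have x0 : 0 < x by exact: lt_trans ax.
  rewrite /pow_gt x0 subr0 mulrCA -expRD ler_peMr ?powR_ge0// -[X in X <= _]expR0 ler_expR subr_ge0.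
  by rewrite ler_pdivrMr// mul1r ltW.
- apply: ge0_integralZl_lty; [exact: expR_ge0|exact: mg|exact: g0|].
  by rewrite integral_pow_gt_expR_inv// ltry.
Qed.

(** Two critical ends. Up to a + 1, the bounds 1/x <= 1/a and e^(a+1-x) >= 1 lead to a Laplace
    integral, convergent since al < 1. Beyond, (x-a)^(-al) <= (a+1)^al x^(-al) leaves a tail,
    convergent since al > 0. *)
Lemma integral_pow_gt_inv_lty (a al : R) : 0 < a -> 0 < al < 1 ->
  (\int[mu]_x (pow_gt a (- al) x * x^-1)%:E < +oo)%E.
Proof.
move=> a0 /andP[al0 al1].
have mx : measurable_fun [set: mR] (fun x : mR => x^-1 : mR) by exact: measurable_invr.
have mp : measurable_fun [set: mR] (pow_gt a (- al)) by exact: measurable_pow_gt.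
have mt : measurable_fun [set: mR] (tail a (- al - 1)) by exact: measurable_tail.
have a10 : 0 < a + 1 by lra.
have mpe : measurable_fun [set: mR] (fun x : mR => pow_gt a (- al) x * expR (- (1 * x))).
  by apply: measurable_funM; [exact: mp|exact: measurable_expR_lin].
have pe0 (x : mR) : 0 <= pow_gt a (- al) x * expR (- (1 * x)).
  by rewrite mulr_ge0 ?pow_gt_ge0 ?expR_ge0.
have c10 : 0 <= expR (a + 1) / a by rewrite divr_ge0 ?expR_ge0 ?ltW.
apply: (@ge0_integral_lty_le _ mR R mu _ (fun x =>
   expR (a + 1) / a * (pow_gt a (- al) x * expR (- (1 * x)))
   + (a + 1) `^ al * tail a (- al - 1) x)).
- by apply: measurable_funM.
- by apply: measurable_funD; apply: measurable_funM.
- move=> x; rewrite /pow_gt /tail; case: ifP => [ax|_]; last by rewrite !mul0r !mulr0 addr0 lexx.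
  have x0 : 0 < x by exact: lt_trans ax.
  rewrite mulr_ge0 ?powR_ge0 ?invr_ge0 ?(ltW x0)//=.
  have [xa|xa] := leP x (a + 1).
    apply: (@le_trans _ _ (expR (a + 1) / a * ((x - a) `^ (- al) * expR (- (1 * x))))); last first.
      by rewrite lerDl mulr_ge0 ?powR_ge0.
    rewrite mulrCA ler_wpM2l ?powR_ge0// mulrAC -expRD.
    apply: (@le_trans _ _ a^-1); first by rewrite lef_pV2 ?posrE// ltW.
    rewrite ler_peMl ?invr_ge0 ?(ltW a0)// -[X in X <= _]expR0 ler_expR; lra.
  apply: (@le_trans _ _ ((a + 1) `^ al * x `^ (- al - 1))); last first.
    by rewrite lerDr mulr_ge0// mulr_ge0 ?powR_ge0 ?expR_ge0.
  rewrite powRB ?(gt_eqF x0) ?implybT// powRr1 ?(ltW x0)// mulrA ler_wpM2r ?invr_ge0 ?(ltW x0)//.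
  have xa0 : 0 < x - a by rewrite subr_gt0.
  rewrite !powRN -div1r ler_pdivrMr ?powR_gt0// mulrAC -powRM ?(ltW a10) ?(ltW xa0)//.
  rewrite ler_pdivlMr ?powR_gt0// mul1r.
  apply: ler_powRl; rewrite ?(ltW x0) ?(ltW al0)//.
  (* A rewriting of x <= (a+1)(x-a). *)
  have : 0 <= a * (x - a - 1) by rewrite mulr_ge0 ?(ltW a0)//; lra.
  lra.
- apply: ge0_integralD_lty.
  + by apply: measurable_funM.
  + by apply: measurable_funM.
  + by move=> x; rewrite mulr_ge0.
  + by move=> x; rewrite mulr_ge0 ?powR_ge0 ?tail_ge0.
  + apply: ge0_integralZl_lty; [exact: c10|exact: mpe|exact: pe0|].
    by rewrite integral_pow_gt_expR ?ltry// ltrN2.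
  + apply: ge0_integralZl_lty; [exact: powR_ge0|exact: mt|exact: tail_ge0|].
    exact: integral_tail_lty.
Qed.
End Weights.

Section Window.
Context {R : realType}.
Notation mu := (@lebesgue_measure R).
Notation mR := (measurableTypeR R).
Variables (d b : R).
Hypothesis d01 : 0 < d < 1.
Hypothesis b0 : 0 <= b.

Definition window (v : R) : R := pow_gt d b v - pow_gt 1 b v.

Let d0 : 0 < d. Proof. by case/andP: d01. Qed.
Let d1 : d < 1. Proof. by case/andP: d01. Qed.

Lemma measurable_window : measurable_fun [set: mR] window.
Proof. by apply: measurable_funB; exact: measurable_pow_gt. Qed.

Lemma window_le0 v : v <= d -> window v = 0.
Proof.
move=> vd; rewrite /window /pow_gt ltNge vd/= ltNge (le_trans vd (ltW d1))/= subr0//.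
Qed.

Lemma window_ge0 v : 0 <= window v.
Proof.
have h0 := d0; have h1 := d1; have hb := b0.
rewrite /window /pow_gt subr_ge0; case: ifP => [v1|_].
  rewrite (lt_trans d1 v1); apply: ler_powRl => //; lra.
by case: ifP => // _; exact: powR_ge0.
Qed.

Lemma window_le_pow v : window v <= pow_gt 0 b v.
Proof.
have h0 := d0; have h1 := d1; have hb := b0.
have [vd|vd] := leP v d; first by rewrite window_le0// pow_gt_ge0.
rewrite /window; apply: (@le_trans _ _ (pow_gt d b v)).
  by rewrite gerBl pow_gt_ge0.
rewrite /pow_gt vd (lt_trans d0 vd) subr0; apply: ler_powRl => //; lra.
Qed.

(** The difference of the two shifted powers decays one power faster than each of them. For v > 1
    this is 1 - (1-1/v)^b <= (1+b)/v: Bernoulli's inequality if b > 1, and u^b >= u on [0,1] if b <=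
    1. For v <= 1 it is v^b <= v^(b-1). *)
Lemma window_le_tail v : window v <= (1 + b) * tail d (b - 1) v.
Proof.
have h0 := d0; have h1 := d1; have hb := b0.
have b10 : 0 <= 1 + b by lra.
have [vd|vd] := leP v d; first by rewrite window_le0// mulr_ge0// tail_ge0.
have v0 : 0 < v by exact: lt_trans vd.
rewrite /tail vd.
have E : v `^ b = v * v `^ (b - 1).
  by rewrite powRB ?(gt_eqF v0) ?implybT// powRr1 ?(ltW v0)// mulrCA divff ?gt_eqF// mulr1.
have vb0 : 0 <= v `^ (b - 1) by exact: powR_ge0.
have [v1|v1] := leP v 1.
  apply: (@le_trans _ _ (v `^ b)).
    by have := window_le_pow v; rewrite /pow_gt v0 subr0.
  rewrite E ler_wpM2r//; lra.
rewrite /window /pow_gt vd v1.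
apply: (@le_trans _ _ (v `^ b * (1 - (1 - v^-1) `^ b))).
  have vi : v - 1 = v * (1 - v^-1) by rewrite mulrBr mulr1 divff// gt_eqF.
  have vi0 : 0 <= 1 - v^-1 by rewrite subr_ge0 invf_le1// ltW.
  rewrite mulrBr mulr1 -powRM ?(ltW v0)// -vi lerB//.
  apply: ler_powRl => //; lra.
have vi01 : 0 < v^-1 <= 1 by rewrite invr_gt0 v0/= invf_le1// ltW.
have H : 1 - (1 - v^-1) `^ b <= (1 + b) * v^-1.
  have [bl1|bg1] := leP b 1.
    have [u0|u0] := leP (1 - v^-1) 0.
      have -> : v^-1 = 1 by lra.
      by have := powR_ge0 (1 - 1 : R) b; lra.
    have u1 : 0 < 1 - v^-1 <= 1 by lra.
    have := ger_powR u1 bl1; rewrite powRr1 ?(ltW u0)// => h.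
    have : 0 <= b * v^-1 by rewrite mulr_ge0//; lra.
    by lra.
  have vi : 0 <= v^-1 <= 1 by lra.
  by have := bernoulli_powR (ltW bg1) vi; lra.
apply: (@le_trans _ _ (v `^ b * ((1 + b) * v^-1))); first by rewrite ler_wpM2l// powR_ge0.
by rewrite E; have -> : v * v `^ (b - 1) * ((1 + b) * v^-1) = (1 + b) * v `^ (b - 1)
  by field; rewrite gt_eqF.
Qed.
End Window.

Section TestFunction.
Context {R : realType}.
Notation mu := (@lebesgue_measure R).
Notation mR := (measurableTypeR R).
Notation plane := (plane_measure R).
Local Notation "x %:C" := (real_complex R x).

Lemma powR_add (v a b : R) : 0 < v -> v `^ a * v `^ b = v `^ (a + b).
Proof. by move=> v0; rewrite powRD// (gt_eqF v0) implybT. Qed.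

Lemma invr_powR (v : R) n : 0 < v -> v^-1 ^+ n = v `^ (- n%:R).
Proof. by move=> v0; rewrite exprVn -powR_invn// ltW. Qed.

Lemma cis0 : cis (0 : R) = 1.
Proof. by rewrite /cis cos0 sin0. Qed.

Lemma mixture_harmonic_cis k (w c : mR -> R) (a b : R) z :
  mixture_harmonic k w c 0 0 z * cis (- (a * z.1 + b * z.2)) = mixture_harmonic k w c a b z.
Proof.
rewrite /mixture_harmonic; case: ifP => _; first by rewrite mul0r.
by rewrite !mul0r addr0 oppr0 cis0 mulr1.
Qed.

Variables (k : nat) (al d : R).
Hypothesis k0 : (0 < k)%N.
Hypothesis al0 : 0 < al.
Hypothesis al12 : al <= 2^-1.
Hypothesis d01 : 0 < d < 1.
Let d0 : 0 < d. Proof. by case/andP: d01. Qed.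
Let pi0 : 0 < pi :> R. Proof. exact: pi_gt0. Qed.

Let b : R := k%:R / 2 - al.
Let b0 : 0 <= b.
Proof.
have : 1 <= k%:R :> R by rewrite ler1n.
by have := al12; rewrite /b; lra.
Qed.

(** The factor v^(-k-1) cancels the v^(k+1) that appears in the Fourier transform of z^k
    e^(-pi|z|^2/v), so that the transform has the bare [window] as its weight. *)
Definition source_weight (v : mR) : R := window d (k%:R / 2 - al) v * v^-1 ^+ k.+1.
Definition source := mixture_harmonic k source_weight (fun v => pi / v) 0 0.

Lemma source_weight_pos v : source_weight v != 0 -> 0 < v.
Proof.
apply: contraNT; rewrite -leNgt => v0.
by rewrite /source_weight window_le0 ?mul0r// (le_trans v0)// ltW.
Qed.

Lemma source_weight_ge0 v : 0 <= source_weight v.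
Proof.
have [vd|vd] := leP v d; first by rewrite /source_weight window_le0// mul0r.
by rewrite mulr_ge0 ?window_ge0// exprn_ge0// invr_ge0 ltW// (lt_trans d0).
Qed.

Lemma measurable_source_weight : measurable_fun [set: mR] source_weight.
Proof.
apply: measurable_funM; first exact: measurable_window.
by apply: measurable_funX; exact: measurable_invr.
Qed.

Lemma source_weight_le_tail v :
  source_weight v <= (1 + b) * tail d (- (k%:R / 2 + al + 1) - 1) v.
Proof.
have b10 : 0 <= 1 + b by have := b0; lra.
have [vd|vd] := leP v d.
  by rewrite /source_weight window_le0// mul0r mulr_ge0// tail_ge0.
have v0 : 0 < v by exact: lt_trans vd.
have H := window_le_tail d01 b0 v.
rewrite /source_weight invr_powR//.
apply: (le_trans (ler_wpM2r (powR_ge0 _ _) H)).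
rewrite /tail vd -mulrA powR_add//; apply: le_of_eq.
by congr (_ * _ `^ _); rewrite /b -[k.+1%:R]natr1; lra.
Qed.

Lemma source_weight_le_pow v :
  source_weight v <= pow_gt 0 (- (k%:R / 2 + al) - 1) v.
Proof.
have [vd|vd] := leP v d.
  by rewrite /source_weight window_le0// mul0r pow_gt_ge0.
have v0 : 0 < v by exact: lt_trans vd.
have H := window_le_pow d01 b0 v.
rewrite /source_weight invr_powR//.
apply: (le_trans (ler_wpM2r (powR_ge0 _ _) H)).
rewrite /pow_gt v0 subr0 powR_add//; apply: le_of_eq.
by congr (_ `^ _); rewrite /b -[k.+1%:R]natr1; lra.
Qed.

Lemma measurable_pi_div : measurable_fun [set: mR] (fun v : mR => pi / v : R).
Proof. by apply: measurable_funM => //; exact: measurable_invr. Qed.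

Lemma source_weight_pi v : source_weight v != 0 -> 0 < pi / v.
Proof. by move=> /source_weight_pos v0; rewrite divr_gt0. Qed.

Lemma source_mixture_fin t : 0 < t ->
  (\int[mu]_v (source_weight v * expR (- (pi / v * t)))%:E < +oo)%E.
Proof.
move=> t0.
have s0 : 0 < k%:R / 2 + al + 1.
  by rewrite ltr_wpDl// addr_ge0 ?divr_ge0// ltW.
apply: (@ge0_integral_lty_le _ mR R mu _ (fun v => (1 + b) * tail d (- (k%:R / 2 + al + 1) - 1) v)).
- apply: measurable_funM; first exact: measurable_source_weight.
  by apply: measurable_expRN; apply: measurable_funM => //; exact: measurable_pi_div.
- by apply: measurable_funM => //; exact: measurable_tail.
- move=> v; rewrite mulr_ge0 ?source_weight_ge0 ?expR_ge0//=.
  apply: le_trans (source_weight_le_tail v).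
  have [->|wv] := eqVneq (source_weight v) 0; first by rewrite mul0r.
  rewrite ler_piMr ?source_weight_ge0// -[X in _ <= X]expR0 ler_expR oppr_le0.
  by rewrite mulr_ge0 ?(ltW t0)// ltW// source_weight_pi.
- apply: ge0_integralZl_lty; [by have := b0; lra|exact: measurable_tail|exact: tail_ge0|].
  exact: integral_tail_lty.
Qed.

(** The tail bound of the weight has exponent -(k/2+al+2); against v^(k/2+1) it leaves v^(-al-1),
    integrable at infinity since al > 0. *)
Lemma source_total_fin :
  (\int[mu]_v (source_weight v * (pi / v) `^ (- (k%:R / 2 + 1)))%:E < +oo)%E.
Proof.
apply: (@ge0_integral_lty_le _ mR R mu _ (fun v =>
  (pi `^ (- (k%:R / 2 + 1)) * (1 + b)) * tail d (- al - 1) v)).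
- apply: measurable_funM; first exact: measurable_source_weight.
  exact: (measurableT_comp (@measurable_powR R _) measurable_pi_div).
- by apply: measurable_funM => //; exact: measurable_tail.
- move=> v; rewrite mulr_ge0 ?source_weight_ge0 ?powR_ge0//=.
  have b10 : 0 <= 1 + b by have := b0; lra.
  have [vd|vd] := leP v d.
    by rewrite /source_weight window_le0// !mul0r mulr_ge0 ?tail_ge0// mulr_ge0 ?powR_ge0.
  have v0 : 0 < v by exact: lt_trans vd.
  apply: (le_trans (ler_wpM2r (powR_ge0 _ _) (source_weight_le_tail v))).
  rewrite powRM ?invr_ge0 ?(ltW v0) ?(ltW pi0)// -(powR_inv1 (ltW v0)) -powRrM.
  rewrite /tail vd mulrACA (mulrC (1 + b)) ler_wpM2l//; first by rewrite mulr_ge0 ?powR_ge0.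
  rewrite powR_add//; apply: le_of_eq.
  by congr (_ `^ _); lra.
- apply: ge0_integralZl_lty; [|exact: measurable_tail|exact: tail_ge0|].
    by rewrite mulr_ge0 ?powR_ge0//; have := b0; lra.
  exact: integral_tail_lty.
Qed.

Lemma measurable_pi_mul : measurable_fun [set: mR] (fun v : mR => pi * v : R).
Proof. exact: measurable_funM. Qed.

Lemma window_pi v : window d b v != 0 -> 0 < pi * v.
Proof.
move=> wv; rewrite mulr_gt0// ltNge; apply: contra wv => v0.
by rewrite window_le0// (le_trans v0)// ltW.
Qed.

Lemma integral_pow_gt_pi (a e t : R) : -1 < e -> 0 < t ->
  (\int[mu]_v (pow_gt a e v * expR (- (pi * v * t)))%:E =
   (Gamma (e + 1) * (pi * t) `^ (- (e + 1)) * expR (- (pi * t * a)))%:E)%E.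
Proof.
move=> e1 t0; rewrite -(integral_pow_gt_expR a e1 (mulr_gt0 pi0 t0)).
by apply: eq_integral => v _; rewrite mulrAC.
Qed.

Lemma mixture_pow_gt (a e t : R) : -1 < e -> 0 < t ->
  mixture (pow_gt a e) (fun v => pi * v) t =
  Gamma (e + 1) * (pi * t) `^ (- (e + 1)) * expR (- (pi * t * a)).
Proof. by move=> e1 t0; rewrite /mixture /Rintegral integral_pow_gt_pi. Qed.

Lemma measurable_expR_pi (t : R) : measurable_fun [set: mR] (fun v : mR => expR (- (pi * v * t)) : R).
Proof.
by apply: measurable_expRN; apply: measurable_funM => //; exact: measurable_pi_mul.
Qed.

Lemma window_mixture_fin t : 0 < t ->
  (\int[mu]_v (window d b v * expR (- (pi * v * t)))%:E < +oo)%E.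
Proof.
move=> t0; apply: (@ge0_integral_lty_le _ mR R mu _ (fun v => pow_gt d b v * expR (- (pi * v * t)))).
- by apply: measurable_funM; [exact: measurable_window|exact: measurable_expR_pi].
- by apply: measurable_funM; [exact: measurable_pow_gt|exact: measurable_expR_pi].
- move=> v; rewrite mulr_ge0 ?expR_ge0 ?window_ge0//= ler_wpM2r ?expR_ge0//.
  by rewrite gerBl pow_gt_ge0.
- by rewrite integral_pow_gt_pi ?ltry//; have := b0; lra.
Qed.

Lemma window_total_fin :
  (\int[mu]_v (window d b v * (pi * v) `^ (- (k%:R / 2 + 1)))%:E < +oo)%E.
Proof.
have b10 : 0 <= 1 + b by have := b0; lra.
apply: (@ge0_integral_lty_le _ mR R mu _ (fun v =>
  (pi `^ (- (k%:R / 2 + 1)) * (1 + b)) * tail d (- (al + 1) - 1) v)).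
- apply: measurable_funM; first exact: measurable_window.
  exact: (measurableT_comp (@measurable_powR R _) measurable_pi_mul).
- by apply: measurable_funM => //; exact: measurable_tail.
- move=> v; rewrite mulr_ge0 ?window_ge0 ?powR_ge0//=.
  have [vd|vd] := leP v d.
    by rewrite window_le0// !mul0r mulr_ge0 ?tail_ge0// mulr_ge0 ?powR_ge0.
  have v0 : 0 < v by exact: lt_trans vd.
  apply: (le_trans (ler_wpM2r (powR_ge0 _ _) (window_le_tail d01 b0 v))).
  rewrite powRM ?(ltW v0) ?(ltW pi0)//.
  rewrite /tail vd mulrACA (mulrC (1 + b)) ler_wpM2l//; first by rewrite mulr_ge0 ?powR_ge0.
  rewrite powR_add//; apply: le_of_eq.
  by congr (_ `^ _); rewrite /b; lra.
- apply: ge0_integralZl_lty; [|exact: measurable_tail|exact: tail_ge0|].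
    by rewrite mulr_ge0 ?powR_ge0.
  by apply: integral_tail_lty => //; rewrite addr_gt0.
Qed.

Definition window_harmonic := mixture_harmonic k (window d (k%:R / 2 - al)) (fun v => pi * v) 0 0.

Lemma fourier_source xi : fourier source xi = Complex 0 (-1) ^+ k * window_harmonic xi.
Proof.
have [_ E] := @cint_mixture_harmonic R k source_weight _ measurable_source_weight
  measurable_pi_div source_weight_ge0 source_weight_pi source_mixture_fin source_total_fin
  (2 * pi * xi.1) (2 * pi * xi.2).
transitivity (cint plane (mixture_harmonic k source_weight (fun v => pi / v)
    (2 * pi * xi.1) (2 * pi * xi.2))).
  apply: eq_cint => x; rewrite -mixture_harmonic_cis /dot; congr (_ * cis _); ring.
rewrite {}E.
have pe : 2 * pi != 0 :> R by rewrite mulf_neq0// gt_eqF.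
have -> : (2 * pi * xi.1)%:C + Complex 0 1 * (2 * pi * xi.2)%:C =
    (2 * pi)%:C * plane_point xi.
  by apply: complexP; rewrite ?Re_add ?Im_add ?Re_mul ?Im_mul/=; ring.
have -> : \int[mu]_v (source_weight v * ((2 * (pi / v))^-1 ^+ k *
    (pi / (pi / v) * expR (- (((2 * pi * xi.1) ^+ 2 + (2 * pi * xi.2) ^+ 2) / (4 * (pi / v))))))) =
    (2 * pi) ^- k * mixture (window d b) (fun v => pi * v) (sqmod xi).
  rewrite /mixture -ge0_RintegralZl; last 2 first.
  - by apply: measurable_funM; [exact: measurable_window|exact: measurable_expR_pi].
  - by move=> v; rewrite mulr_ge0 ?expR_ge0 ?window_ge0.
  apply: eq_Rintegral => v _; rewrite /source_weight -/b.
  have [vd|vd] := leP v d; first by rewrite window_le0// !mul0r mulr0.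
  have v0 : v != 0 by rewrite gt_eqF// (lt_trans d0).
  have pn : pi != 0 :> R by rewrite gt_eqF.
  have [-> [-> ->]] : ((2 * pi * xi.1) ^+ 2 + (2 * pi * xi.2) ^+ 2) / (4 * (pi / v)) =
      pi * v * sqmod xi /\ (2 * (pi / v))^-1 = (2 * pi)^-1 * v /\ pi / (pi / v) = v.
    rewrite /sqmod; move: (@pi R) pn => P Pn.
    by split; [|split]; field; rewrite ?v0 ?Pn.
  rewrite exprMn (exprVn (2 * pi)) (exprSr v^-1).
  have vk : v^-1 ^+ k * v ^+ k = 1 by rewrite -exprMn mulVf// expr1n.
  transitivity ((v^-1 ^+ k * v ^+ k) * (v^-1 * v) *
     ((2 * pi) ^- k * (window d b v * expR (- (pi * v * sqmod xi))))).
    move: (v^-1 ^+ k) (v ^+ k) ((2 * pi) ^- k) (expR _) => A B C E; ring.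
  by rewrite vk mulVf// !mul1r.
rewrite exprMn -mulrA; congr (_ * _).
(* At the origin [window_harmonic] is 0 by convention, and the computed transform vanishes as well
   since k > 0. *)
rewrite /window_harmonic /mixture_harmonic; case: eqVneq => [x0|x0].
  have -> : plane_point xi = 0.
    have [h1 h2] : xi.1 = 0 /\ xi.2 = 0.
      by move: x0; rewrite /sqmod; move: (xi.1) (xi.2) => x y xy; split; nra.
    by rewrite /plane_point h1 h2.
  by rewrite mulr0 expr0n eqn0Ngt k0 mul0r.
have -> M : ((2 * pi)%:C * plane_point xi) ^+ k * ((2 * pi) ^- k * M)%:C =
    plane_point xi ^+ k * M%:C.
  have nz : (2 * pi)%:C ^+ k * ((2 * pi) ^- k)%:C = 1.
    by rewrite -rmorphXn -rmorphM/= mulfV ?expf_neq0.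
  by rewrite (exprMn k (2 * pi)%:C) (rmorphM (real_complex R) _ M) mulrACA nz mul1r.
by rewrite !mul0r addr0 oppr0 cis0 mulr1.
Qed.
End TestFunction.

Section MixtureFreq0.
Context {R : realType}.
Variables (k : nat) (w c : measurableTypeR R -> R).

Lemma mixture_harmonic_at0 a b z : sqmod z = 0 -> mixture_harmonic k w c a b z = 0.
Proof. by move=> z0; rewrite /mixture_harmonic z0 eqxx. Qed.

Lemma mixture_harmonic_freq0 z : sqmod z != 0 -> mixture_harmonic k w c 0 0 z =
  plane_point z ^+ k * real_complex R (mixture w c (sqmod z)).
Proof.
move=> z0; rewrite /mixture_harmonic (negbTE z0).
by rewrite (mul0r z.1) (mul0r z.2) addr0 oppr0 cis0 mulr1.
Qed.
End MixtureFreq0.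

(** * The image of the test function under the multiplier *)

Section MultiplierImage.
Context {R : realType}.
Notation mu := (@lebesgue_measure R).
Notation mR := (measurableTypeR R).
Notation plane := (plane_measure R).
Local Notation "x %:C" := (real_complex R x).
Variables (k : nat) (al d : R).
Hypothesis k0 : (0 < k)%N.
Hypothesis al0 : 0 < al.
Hypothesis al12 : al <= 2^-1.
Hypothesis d01 : 0 < d < 1.
Let d0 : 0 < d. Proof. by case/andP: d01. Qed.
Let pi0 : 0 < pi :> R. Proof. exact: pi_gt0. Qed.
Let al01 : 0 < al < 1.
Proof. by have h := al12; rewrite al0/=; lra. Qed.
Let b0 : 0 <= k%:R / 2 - al.
Proof.
have : 1 <= k%:R :> R by rewrite ler1n.
by have := al12; lra.
Qed.

Local Notation source := (source k al d).

Lemma cintble_source_cis (a b : R) :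
  cintble plane (fun z => source z * cis (- (a * z.1 + b * z.2))).
Proof.
have [H _] := @cint_mixture_harmonic R k _ _ (@measurable_source_weight R k al d)
  (@measurable_pi_div R) (source_weight_ge0 k0 al12 d01) (source_weight_pi d01)
  (source_mixture_fin k0 al0 al12 d01) (source_total_fin k0 al0 al12 d01) a b.
rewrite (_ : (fun z => _) = mixture_harmonic k (source_weight k al d) (fun v => pi / v) a b)//.
by apply/funext => z; rewrite /source mixture_harmonic_cis.
Qed.

Lemma cintble_window_harmonic : cintble plane (window_harmonic k al d).
Proof.
exact: (@cint_mixture_harmonic R k _ _ (@measurable_window R d _)
  (@measurable_pi_mul R) (window_ge0 d01 b0) (window_pi d01)
  (window_mixture_fin k0 al12 d01) (window_total_fin k0 al0 al12 d01) 0 0).1.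
Qed.

Lemma fourier_sourceZ (c : R[i]) xi :
  fourier (fun z => c * source z) xi = c * (Complex 0 (-1) ^+ k * window_harmonic k al d xi).
Proof.
rewrite -fourier_source//.
have H := cintble_source_cis (2 * pi * xi.1) (2 * pi * xi.2).
have E : (fun z => source z * cis (- (2 * pi * dot z xi))) =
    (fun z => source z * cis (- (2 * pi * xi.1 * z.1 + 2 * pi * xi.2 * z.2))).
  by apply/funext => z; rewrite /dot; congr (_ * cis _); ring.
rewrite /fourier -[LHS]/(cint plane _) -[cintegral _]/(cint plane _) E -cintZ//.
by apply: eq_cint => z; rewrite -mulrA (congr1 (fun f => f z) E).
Qed.

Lemma fourier_class_source (c : R[i]) : fourier_class (fun z => c * source z).
Proof.
split.
  suff -> : (fun z => c * source z) = (fun z => c * (source z * cis (- (0 * z.1 + 0 * z.2)))).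
    by have H := cintbleZ c (cintble_source_cis 0 0); exact: H.
  by apply/funext => z; rewrite !mul0r addr0 oppr0 cis0 mulr1.
suff -> : fourier (fun z => c * source z) =
    (fun xi => c * (Complex 0 (-1) ^+ k * window_harmonic k al d xi)).
  by have H := cintbleZ c (cintbleZ (Complex 0 (-1) ^+ k) cintble_window_harmonic); exact: H.
by apply/funext => xi; rewrite fourier_sourceZ.
Qed.

(** The inverse Fourier transform, in terms of t = |z|^2, of the radial mixture with weight
    (v-a)_+^(-al) and rates pi v: the Gaussian e^(-pi v|xi|^2) contributes the factor 1/v and the
    rate pi/v. *)
Definition spike (a t : R) : R :=
  mixture (fun v : mR => pow_gt a (- al) v * v^-1) (fun v => pi / v) t.

Local Notation spike_harmonic a := (mixture_harmonic 0 (pow_gt a (- al)) (fun v => pi * v)).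

Lemma cint_spike_harmonic (a u v : R) : 0 < a ->
  cintble plane (spike_harmonic a u v) /\
  cint plane (spike_harmonic a u v) = (spike a ((u ^+ 2 + v ^+ 2) / (4 * pi ^+ 2)))%:C.
Proof.
move=> a0.
have wc x : pow_gt a (- al) x != 0 -> 0 < pi * x.
  rewrite /pow_gt; case: ifP => [ax _|]; last by rewrite eqxx.
  by rewrite mulr_gt0// (lt_trans a0).
have fin t : 0 < t -> (\int[mu]_v (pow_gt a (- al) v * expR (- (pi * v * t)))%:E < +oo)%E.
  by move=> t0; rewrite integral_pow_gt_pi ?ltry// ltrN2; case/andP: al01.
have tot : (\int[mu]_v (pow_gt a (- al) v * (pi * v) `^ (- (0%:R / 2 + 1)))%:E < +oo)%E.
  have -> : (\int[mu]_v (pow_gt a (- al) v * (pi * v) `^ (- (0%:R / 2 + 1)))%:E =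
      \int[mu]_v (pi^-1 * (pow_gt a (- al) v * v^-1))%:E)%E.
    apply: eq_integral => x _; congr EFin; rewrite mul0r add0r.
    have [->|/wc x0] := eqVneq (pow_gt a (- al) x) 0; first by rewrite !mul0r mulr0.
    by rewrite powR_inv1 ?(ltW x0)// invfM mulrCA.
  apply: ge0_integralZl_lty; last exact: integral_pow_gt_inv_lty.
  - by rewrite invr_ge0 ltW.
  - by apply: measurable_funM; [exact: measurable_pow_gt|exact: measurable_invr].
  - move=> x; rewrite /pow_gt; case: ifP => [ax|_]; last by rewrite mul0r.
    by rewrite mulr_ge0 ?powR_ge0// invr_ge0 ltW// (lt_trans a0).
have [H E] := @cint_mixture_harmonic R 0 _ _ (@measurable_pow_gt R a (- al))
  (@measurable_pi_mul R) (pow_gt_ge0 a (- al)) wc fin tot u v.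
split=> //; rewrite E expr0 mul1r; congr (_ %:C).
apply: eq_Rintegral => x _; have [->|/wc x0] := eqVneq (pow_gt a (- al) x) 0.
  by rewrite !mul0r.
have xn : x != 0 by apply: contraTneq x0 => ->; rewrite mulr0 ltxx.
have pn : pi != 0 :> R by rewrite gt_eqF.
rewrite expr0 mul1r -[in RHS]mulrA; congr (_ * _).
move: (@pi R) pn => P Pn.
by congr (_ * expR (- _)); field; rewrite ?xn ?Pn.
Qed.

Let C1 : R := Gamma (k%:R / 2 - al + 1) / Gamma (1 - al) * pi `^ (- (k%:R / 2)).

(** By [mixture_pow_gt] every term is a Gamma value, a power of pi t and e^(-pi a t) with a = d or a
    = 1. The factor t^(k/2) takes the exponent -(b+1) to -(1-al) and leaves the exponential alone;
    [C1] collects the change of constants. *)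
Lemma window_mixtureE t : 0 < t ->
  t `^ (k%:R / 2) * mixture (window d (k%:R / 2 - al)) (fun v => pi * v) t =
  C1 * (mixture (pow_gt d (- al)) (fun v => pi * v) t -
        mixture (pow_gt 1 (- al)) (fun v => pi * v) t).
Proof.
move=> t0; set b := k%:R / 2 - al.
have pt : 0 < pi * t by rewrite mulr_gt0.
have b1 : -1 < b by have := b0; rewrite -/b; lra.
have al1 : - 1 < - al by have /andP[] := al01; lra.
have G1 : Gamma (1 - al) != 0 by rewrite gt_eqF// Gamma_gt0//; have /andP[] := al01; lra.
have -> : mixture (window d b) (fun v => pi * v) t =
    mixture (pow_gt d b) (fun v => pi * v) t - mixture (pow_gt 1 b) (fun v => pi * v) t.
  rewrite /mixture.
  have I a : mu.-integrable setT (EFin \o (fun v : mR => pow_gt a b v * expR (- (pi * v * t)))).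
    apply/integrableP; split.
      apply/measurable_EFinP; apply: measurable_funM; first exact: measurable_pow_gt.
      exact: measurable_expR_pi.
    under eq_integral => v _.
      rewrite /= ger0_norm ?mulr_ge0 ?expR_ge0 ?pow_gt_ge0//.
      over.
    by rewrite integral_pow_gt_pi ?ltry.
  by rewrite -RintegralB//; apply: eq_Rintegral => v _; rewrite -mulrBl.
rewrite !mixture_pow_gt// -!mulrBr !mulrA; congr (_ * _).
rewrite (addrC (- al)) /C1 -/b mulrAC.
have -> : - (b + 1) = - (k%:R / 2) + - (1 - al) by rewrite /b; lra.
rewrite -powR_add// powRM ?(ltW pi0) ?(ltW t0)//.
have tk : t `^ (k%:R / 2) * t `^ (- (k%:R / 2)) = 1 by rewrite powR_add// subrr powRr0.
transitivity ((t `^ (k%:R / 2) * t `^ (- (k%:R / 2))) * (Gamma (b + 1) *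
   (pi `^ (- (k%:R / 2)) * (pi * t) `^ (- (1 - al))))).
  ring.
rewrite tk mul1r.
move: (Gamma (b + 1)) (Gamma (1 - al)) G1 (pi `^ _) ((pi * t) `^ _) => A B Bn C E.
by field.
Qed.

Lemma riesz_symbol_point (xi : R * R) : sqmod xi != 0 ->
  riesz_symbol xi * plane_point xi = (cmodulus (plane_point xi))%:C.
Proof.
move=> x0; rewrite /riesz_symbol; set M := cmodulus _.
have M2 : M * M = sqmod xi.
  by rewrite /M cmodulus_point -expr2 sqr_sqrtr// sqmod_ge0.
have M0 : M != 0 by apply: contraNneq x0 => M0; rewrite -M2 M0 mul0r.
have M0' : M%:C != 0 by rewrite fmorph_eq0.
apply: (mulfI M0'); rewrite -(rmorphM (real_complex R)) M2.
transitivity (conjc (plane_point xi) * plane_point xi).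
  by rewrite -mulrA mulrCA; congr (_ * _); rewrite mulrA mulfV// mul1r.
by apply: complexP; rewrite /sqmod ?Re_mul ?Im_mul/=; ring.
Qed.

Lemma riesz_window_harmonic (xi : R * R) :
  riesz_symbol xi ^+ k * window_harmonic k al d xi =
  C1%:C * (spike_harmonic d 0 0 xi - spike_harmonic 1 0 0 xi).
Proof.
have [x0|x0] := eqVneq (sqmod xi) 0.
  by rewrite /window_harmonic !mixture_harmonic_at0// subrr !mulr0.
have t0 : 0 < sqmod xi by rewrite lt_neqAle eq_sym x0 sqmod_ge0.
have Es a : spike_harmonic a 0 0 xi =
    (mixture (pow_gt a (- al)) (fun v => pi * v) (sqmod xi))%:C.
  by rewrite (mixture_harmonic_freq0 0 _ _ x0) expr0 mul1r.
rewrite (Es d) (Es 1) /window_harmonic (mixture_harmonic_freq0 k _ _ x0) mulrA.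
rewrite -(exprMn k (riesz_symbol xi)) (riesz_symbol_point x0).
rewrite -rmorphXn -cmodulusX cmodulus_pointX -rmorphB -!rmorphM/=.
by rewrite window_mixtureE.
Qed.

Lemma multiplier_source (c : R[i]) x :
  multiplier_op (fun xi => riesz_symbol xi ^+ k) (fun z => c * source z) x =
  c * (Complex 0 (-1) ^+ k * (C1 * (spike d (sqmod x) - spike 1 (sqmod x)))%:C).
Proof.
(* Mixtures carry the phase e^(-i ...), so the inverse transform at x is their integral at the
   frequency -2 pi x; only the squares of the frequencies survive. *)
have [id Ed] := cint_spike_harmonic (- (2 * pi * x.1)) (- (2 * pi * x.2)) d0.
have [i1 E1] := cint_spike_harmonic (- (2 * pi * x.1)) (- (2 * pi * x.2)) (@ltr01 R).
have tE : ((- (2 * pi * x.1)) ^+ 2 + (- (2 * pi * x.2)) ^+ 2) / (4 * pi ^+ 2) = sqmod x.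
  have pn : pi != 0 :> R by rewrite gt_eqF.
  by rewrite /sqmod; move: (@pi R) pn => P Pn; field.
rewrite tE in Ed E1.
pose K : R[i] := c * (Complex 0 (-1) ^+ k * C1%:C).
transitivity (cint plane (fun xi =>
    K * spike_harmonic d (- (2 * pi * x.1)) (- (2 * pi * x.2)) xi +
    (- K) * spike_harmonic 1 (- (2 * pi * x.1)) (- (2 * pi * x.2)) xi)).
  apply: eq_cint => xi; rewrite fourier_sourceZ.
  have -> : 2 * pi * dot x xi = - (- (2 * pi * x.1) * xi.1 + - (2 * pi * x.2) * xi.2).
    by rewrite /dot; ring.
  rewrite -!(mixture_harmonic_cis _ _ _ (- (2 * pi * x.1))).
  set e := cis _; clearbody e.
  transitivity (c * (Complex 0 (-1) ^+ k * (riesz_symbol xi ^+ k * window_harmonic k al d xi)) * e).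
    move: (riesz_symbol xi ^+ k) (Complex 0 (-1) ^+ k) (window_harmonic k al d xi) => A B E.
    by ring.
  rewrite riesz_window_harmonic /K.
  move: (Complex 0 (-1) ^+ k) (C1%:C) (spike_harmonic d 0 0 xi) (spike_harmonic 1 0 0 xi).
  by move=> A B E F; ring.
have iK := cintbleZ K id; have iNK := cintbleZ (- K) i1.
have EK := etrans (cintZ K id) (congr1 ( *%R K) Ed).
have ENK := etrans (cintZ (- K) i1) (congr1 ( *%R (- K)) E1).
have ED := cintD iK iNK.
apply: (etrans ED); apply: (etrans (congr2 +%R EK ENK)).
rewrite /K; move: (spike d _) (spike 1 _) (Complex 0 (-1) ^+ k) C1 => s1 s2 A C2.
have -> : (C2 * (s1 - s2))%:C = C2%:C * (s1%:C - s2%:C) by rewrite rmorphM rmorphB.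
by ring.
Qed.
End MultiplierImage.

(** * Norm estimates *)

Section MixtureEstimates.
Context {R : realType}.
Notation mu := (@lebesgue_measure R).
Notation mR := (measurableTypeR R).

Lemma measurable_mixture (w c : mR -> R) : measurable_fun setT w -> measurable_fun setT c ->
  (forall v, 0 <= w v) -> measurable_fun [set: R] (mixture w c).
Proof.
move=> mw mc w0.
have m1 : measurable_fun [set: mR * mR] (fun z : mR * mR => z.1 : mR) by exact: measurable_fst.
have m2 : measurable_fun [set: mR * mR] (fun z : mR * mR => z.2 : mR) by exact: measurable_snd.
have mk : measurable_fun [set: mR * mR]
    (fun z : mR * mR => (w z.2 * expR (- (c z.2 * z.1)))%:E).
  apply/measurable_EFinP; apply: measurable_funM; first exact: (measurableT_comp mw m2).
  apply: measurable_expRN; apply: measurable_funM; last exact: m1.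
  exact: (measurableT_comp mc m2).
have k0 z : (0 <= (w z.2 * expR (- (c z.2 * z.1)))%:E)%E.
  by rewrite lee_fin mulr_ge0 ?expR_ge0.
have := @measurable_fun_fubini_tonelli_F _ _ mR mR R mu _ mk k0.
move=> /(measurableT_comp (@fine_measurable R _ measurableT)).
exact.
Qed.

Lemma measurable_pow_gt_expR_inv (a e c : R) :
  measurable_fun [set: mR] (fun v : mR => pow_gt a e v * expR (- (c / v))).
Proof. by apply: measurable_funM; [exact: measurable_pow_gt|exact: measurable_expR_inv]. Qed.

Lemma mixture_le_pow_gt (w : mR -> R) r s t :
  measurable_fun setT w -> (forall v, 0 <= w v) -> 0 < s -> 0 < t -> 0 <= r ->
  (forall v, w v <= r * pow_gt 0 (- s - 1) v) ->
  mixture w (fun v => pi / v) t <= r * (Gamma s * (pi * t) `^ (- s)).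
Proof.
move=> mw w0 s0 t0 r0 wr.
have pt : 0 < pi * t by rewrite mulr_gt0// pi_gt0.
have -> : r * (Gamma s * (pi * t) `^ (- s)) =
    \int[mu]_v (r * (pow_gt 0 (- s - 1) v * expR (- (pi * t / v)))).
  rewrite ge0_RintegralZl; last 2 first.
  - exact: measurable_pow_gt_expR_inv.
  - by move=> v; rewrite mulr_ge0 ?pow_gt_ge0 ?expR_ge0.
  by rewrite /Rintegral integral_pow_gt_expR_inv.
apply: ge0_le_Rintegral.
- apply: measurable_funM => //.
  by apply: measurable_expRN; apply: measurable_funM => //; exact: measurable_pi_div.
- by apply: measurable_funM => //; exact: measurable_pow_gt_expR_inv.
- move=> v; rewrite mulr_ge0 ?expR_ge0//= mulrA mulrAC (mulrAC _ t).
  by rewrite ler_wpM2r ?expR_ge0.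
- apply: ge0_integralZl_lty => //.
  + exact: measurable_pow_gt_expR_inv.
  + by move=> v; rewrite mulr_ge0 ?pow_gt_ge0 ?expR_ge0.
  + by rewrite integral_pow_gt_expR_inv// ltry.
Qed.
End MixtureEstimates.

(** * Pointwise upper bounds for the test function *)

Section SourceEstimates.
Context {R : realType}.
Notation mu := (@lebesgue_measure R).
Notation mR := (measurableTypeR R).
Variables (k : nat) (al d : R).
Hypothesis k0 : (0 < k)%N.
Hypothesis al0 : 0 < al.
Hypothesis al12 : al <= 2^-1.
Hypothesis d01 : 0 < d < 1.
Let d0 : 0 < d. Proof. by case/andP: d01. Qed.
Let pi0 : 0 < pi :> R. Proof. exact: pi_gt0. Qed.
Let b0 : 0 <= k%:R / 2 - al.
Proof.
have : 1 <= k%:R :> R by rewrite ler1n.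
by have := al12; lra.
Qed.
Let s0 : 0 < k%:R / 2 + al.
Proof. by rewrite ltr_wpDl// divr_ge0. Qed.

Definition source_modulus (t : R) : R :=
  t `^ (k%:R / 2) * mixture (source_weight k al d) (fun v => pi / v) t.

Lemma source_modulus_ge0 t : 0 <= source_modulus t.
Proof.
rewrite mulr_ge0 ?powR_ge0// Rintegral_ge0// => v.
by rewrite mulr_ge0 ?expR_ge0// source_weight_ge0.
Qed.

Lemma measurable_source_modulus : measurable_fun [set: R] source_modulus.
Proof.
apply: measurable_funM; first exact: measurable_powR.
apply: measurable_mixture; [exact: measurable_source_weight|exact: measurable_pi_div|].
exact: source_weight_ge0.
Qed.

Lemma cmodulus_source z : cmodulus (source k al d z) = source_modulus (sqmod z).
Proof.
have [z0|z0] := eqVneq (sqmod z) 0.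
  rewrite /source mixture_harmonic_at0// /source_modulus z0 powR0 ?mul0r.
    by rewrite cmodulusE/= expr0n/= addr0 sqrtr0.
  by rewrite mulf_neq0// ?invr_eq0// pnatr_eq0 -lt0n.
rewrite /source mixture_harmonic_freq0// cmodulusM cmodulus_real cmodulus_pointX.
congr (_ * _); rewrite ger0_norm// Rintegral_ge0// => v.
by rewrite mulr_ge0 ?expR_ge0// source_weight_ge0.
Qed.

(** The factor of t^(-al) when the window is replaced by the full power v^b: the weight is then
    v^(-s-1) with s = k/2 + al, and its mixture is Gamma(s) (pi t)^(-s). *)
Definition source_const : R := Gamma (k%:R / 2 + al) * pi `^ (- (k%:R / 2 + al)).

Lemma source_modulus_le_powR t : 0 < t ->
  source_modulus t <= source_const * t `^ (- al).
Proof.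
move=> t0.
have H := @mixture_le_pow_gt R (source_weight k al d) 1 _ t
  (@measurable_source_weight R k al d) (source_weight_ge0 k0 al12 d01) s0 t0 ler01.
have {}H := H (fun v => _); rewrite mul1r in H.
apply: (le_trans (ler_wpM2l (powR_ge0 _ _) (H _))).
  by move=> v; rewrite mul1r source_weight_le_pow.
rewrite powRM ?(ltW pi0) ?(ltW t0)// /source_const; apply: le_of_eq.
rewrite mulrCA -[RHS]mulrA; congr (_ * _); rewrite mulrCA; congr (_ * _).
rewrite powR_add//.
by congr (_ `^ _); lra.
Qed.

Definition source_tail_const : R := (1 + (k%:R / 2 - al)) *
  (Gamma (k%:R / 2 + al + 1) * pi `^ (- (k%:R / 2 + al + 1))).

Lemma source_tail_const_ge0 : 0 <= source_tail_const.
Proof.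
have s1 : 0 < k%:R / 2 + al + 1 by rewrite addr_gt0.
have b10 : 0 <= 1 + (k%:R / 2 - al) by have := b0; lra.
by rewrite mulr_ge0// mulr_ge0 ?powR_ge0// ltW// Gamma_gt0.
Qed.

(** The faster decay of the weight from [window_le_tail] becomes an extra factor 1/t, which makes
    the p-th power integrable at infinity. *)
Lemma source_modulus_tail t : 0 < t ->
  source_modulus t <= source_tail_const * t `^ (- al - 1).
Proof.
have s1 : 0 < k%:R / 2 + al + 1 by rewrite addr_gt0.
have b10 : 0 <= 1 + (k%:R / 2 - al) by have := b0; lra.
move=> t0.
have H := @mixture_le_pow_gt R (source_weight k al d) (1 + (k%:R / 2 - al)) _ t
  (@measurable_source_weight R k al d) (source_weight_ge0 k0 al12 d01) s1 t0 b10.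
have W v : source_weight k al d v <=
    (1 + (k%:R / 2 - al)) * pow_gt 0 (- (k%:R / 2 + al + 1) - 1) v.
  apply: (le_trans (source_weight_le_tail k0 al12 d01 v)); rewrite ler_wpM2l//.
  rewrite /tail /pow_gt subr0; case: ifP => [dv|_]; first by rewrite (lt_trans d0 dv).
  by case: ifP => // _; exact: powR_ge0.
apply: (le_trans (ler_wpM2l (powR_ge0 _ _) (H W))).
rewrite powRM ?(ltW pi0) ?(ltW t0)// /source_tail_const; apply: le_of_eq.
rewrite mulrCA -[RHS]mulrA; congr (_ * _); rewrite mulrCA -[RHS]mulrA; congr (_ * _).
rewrite mulrCA; congr (_ * _); rewrite powR_add//.
by congr (_ `^ _); lra.
Qed.

(** The weight lives on v > d, where e^(-pi t/v) <= 1 <= e^pi e^(-pi d/v). So the mixture at t is at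
    most e^pi times the one at d, which is bounded by [source_modulus_le_powR]. *)
Lemma source_modulus_small t : 0 < t -> t <= d ->
  source_modulus t <= expR pi * source_const * d `^ (- al).
Proof.
move=> t0 td; apply: (@le_trans _ _ (expR pi * source_modulus d)); last first.
  by rewrite -mulrA ler_wpM2l ?expR_ge0// source_modulus_le_powR.
rewrite /source_modulus mulrCA; apply: ler_pM; rewrite ?powR_ge0//.
- by rewrite Rintegral_ge0// => v; rewrite mulr_ge0 ?expR_ge0// source_weight_ge0.
- by apply: ler_powRl; [rewrite divr_ge0|exact: ltW|].
have mk u : measurable_fun [set: mR] (fun v : mR => source_weight k al d v * expR (- (pi / v * u))).
  apply: measurable_funM; first exact: measurable_source_weight.
  by apply: measurable_expRN; apply: measurable_funM => //; exact: measurable_pi_div.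
have k00 u (v : mR) : 0 <= source_weight k al d v * expR (- (pi / v * u)).
  by rewrite mulr_ge0 ?expR_ge0// source_weight_ge0.
rewrite /mixture -ge0_RintegralZl//.
apply: ge0_le_Rintegral; [exact: mk|by apply: measurable_funM => //; exact: mk| |].
  move=> v; rewrite k00/=.
  have [vd|vd] := leP v d; first by rewrite /source_weight window_le0// !mul0r mulr0.
  have v0 : 0 < v by exact: lt_trans vd.
  rewrite mulrCA ler_wpM2l ?source_weight_ge0// -expRD ler_expR.
  have h1 : pi / v * d <= pi by rewrite mulrAC ler_pdivrMr// ler_wpM2l ?(ltW pi0)// ltW.
  have h2 : 0 <= pi / v * t by rewrite mulr_ge0 ?divr_ge0 ?(ltW pi0) ?(ltW v0) ?(ltW t0).
  by lra.
apply: ge0_integralZl_lty; [exact: expR_ge0|exact: mk|exact: k00|].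
exact: source_mixture_fin.
Qed.
End SourceEstimates.

(** * Pointwise bounds for the image *)

Section SpikeEstimates.
Context {R : realType}.
Notation mu := (@lebesgue_measure R).
Notation mR := (measurableTypeR R).
Variables (al d : R).
Hypothesis al01 : 0 < al < 1.
Hypothesis d01 : 0 < d < 1.
Let d0 : 0 < d. Proof. by case/andP: d01. Qed.
Let pi0 : 0 < pi :> R. Proof. exact: pi_gt0. Qed.
Let al0 : 0 < al. Proof. by case/andP: al01. Qed.

Let mi (a : R) : measurable_fun [set: mR] (fun v : mR => pow_gt a (- al) v * v^-1).
Proof. by apply: measurable_funM; [exact: measurable_pow_gt|exact: measurable_invr]. Qed.

Let i0 (a : R) (v : mR) : 0 < a -> 0 <= pow_gt a (- al) v * v^-1.
Proof.
move=> a0; rewrite /pow_gt; case: ifP => [av|_]; last by rewrite mul0r.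
by rewrite mulr_ge0 ?powR_ge0// invr_ge0 ltW// (lt_trans a0).
Qed.

Let mk (a t : R) : measurable_fun [set: mR]
  (fun v : mR => pow_gt a (- al) v * v^-1 * expR (- (pi / v * t))).
Proof.
apply: measurable_funM; first exact: mi.
by apply: measurable_expRN; apply: measurable_funM => //; exact: measurable_pi_div.
Qed.

Let k_le (a t : R) (v : mR) : 0 < a -> 0 <= t ->
  0 <= pow_gt a (- al) v * v^-1 * expR (- (pi / v * t)) <= pow_gt a (- al) v * v^-1.
Proof.
move=> a0 t0; rewrite mulr_ge0 ?i0 ?expR_ge0//= /pow_gt; case: ifP => [av|_]; last by rewrite !mul0r.
have v0 : 0 < v by exact: lt_trans av.
rewrite ler_piMr ?mulr_ge0 ?powR_ge0 ?invr_ge0 ?(ltW v0)//.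
rewrite -[X in _ <= X]expR0 ler_expR oppr_le0.
by rewrite mulr_ge0 ?divr_ge0 ?(ltW pi0) ?(ltW v0).
Qed.

Let spike_fin (a t : R) : 0 < a -> 0 <= t ->
  (\int[mu]_v (pow_gt a (- al) v * v^-1 * expR (- (pi / v * t)))%:E < +oo)%E.
Proof.
move=> a0 t0; apply: (ge0_integral_lty_le (mk a t) (mi a)) => [v|].
  exact: k_le.
exact: integral_pow_gt_inv_lty.
Qed.

Definition spike_bound (a : R) : R := \int[mu]_v (pow_gt a (- al) v * v^-1).

Lemma spike_ge0 a t : 0 < a -> 0 <= spike al a t.
Proof. by move=> a0; apply: Rintegral_ge0 => v; rewrite mulr_ge0 ?i0 ?expR_ge0. Qed.

Lemma spike_le a t : 0 < a -> 0 <= t -> spike al a t <= spike_bound a.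
Proof.
move=> a0 t0; apply: ge0_le_Rintegral; [exact: mk|exact: mi| |].
  by move=> v; exact: k_le.
exact: integral_pow_gt_inv_lty.
Qed.

Lemma measurable_spike a : 0 < a -> measurable_fun [set: R] (spike al a).
Proof.
move=> a0; apply: measurable_mixture; [exact: mi|exact: measurable_pi_div|].
by move=> v; exact: i0.
Qed.

(** The weights satisfy v^(-al-1) <= (v-d)_+^(-al)/v + d v^(-al-2): for v > d since v - d < v and
    the exponent is negative, for v <= d since d/v >= 1. The pure powers integrate exactly. *)
Lemma spike_lower t : 0 < t ->
  Gamma al * (pi * t) `^ (- al) <=
  spike al d t + d * (Gamma (al + 1) * (pi * t) `^ (- (al + 1))).
Proof.
move=> t0; have pt : 0 < pi * t by rewrite mulr_gt0.
have al1 : 0 < al + 1 by have := al0; lra.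
have E s : 0 < s -> Gamma s * (pi * t) `^ (- s) =
    \int[mu]_v (pow_gt 0 (- s - 1) v * expR (- (pi * t / v))).
  by move=> s0; rewrite /Rintegral integral_pow_gt_expR_inv.
rewrite !E// -ge0_RintegralZl; last 2 first.
- exact: measurable_pow_gt_expR_inv.
- by move=> v; rewrite mulr_ge0 ?pow_gt_ge0 ?expR_ge0.
have m2 : measurable_fun [set: mR]
    (fun v : mR => d * (pow_gt 0 (- (al + 1) - 1) v * expR (- (pi * t / v)))).
  by apply: measurable_funM => //; exact: measurable_pow_gt_expR_inv.
have n2 (v : mR) : 0 <= d * (pow_gt 0 (- (al + 1) - 1) v * expR (- (pi * t / v))).
  by rewrite mulr_ge0 ?(ltW d0)// mulr_ge0 ?pow_gt_ge0 ?expR_ge0.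
have f2 : (\int[mu]_v (d * (pow_gt 0 (- (al + 1) - 1) v * expR (- (pi * t / v))))%:E < +oo)%E.
  apply: ge0_integralZl_lty; [exact: ltW|exact: measurable_pow_gt_expR_inv| |].
    by move=> v; rewrite mulr_ge0 ?pow_gt_ge0 ?expR_ge0.
  by rewrite integral_pow_gt_expR_inv// ltry.
have n1 (v : mR) : 0 <= pow_gt d (- al) v * v^-1 * expR (- (pi / v * t)).
  by rewrite mulr_ge0 ?i0 ?expR_ge0.
have f1 := spike_fin d0 (ltW t0).
rewrite /spike /mixture -(ge0_RintegralD (mk d t) m2 n1 n2 f1 f2).
apply: ge0_le_Rintegral.
- exact: measurable_pow_gt_expR_inv.
- by apply: measurable_funD; [exact: mk|exact: m2].
- move=> v; rewrite mulr_ge0 ?pow_gt_ge0 ?expR_ge0//=.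
  rewrite (mulrAC pi v^-1) mulrA -mulrDl ler_wpM2r ?expR_ge0//.
  rewrite /pow_gt !subr0; case: ifP => [v0|v0]; last first.
    by case: ifP => [dv|_]; [rewrite (lt_trans d0 dv) in v0|rewrite mul0r mulr0 addr0].
  have vE : v `^ (- al - 1) = v `^ (- al) * v^-1.
    by rewrite -(powR_inv1 (ltW v0)) powR_add.
  have [dv|vd] := ltP d v.
    apply: (@le_trans _ _ ((v - d) `^ (- al) * v^-1)); last first.
      by rewrite lerDl mulr_ge0 ?(ltW d0) ?powR_ge0.
    have vd0 : 0 < v - d by rewrite subr_gt0.
    rewrite vE ler_wpM2r ?invr_ge0 ?(ltW v0)// !powRN lef_pV2 ?posrE ?powR_gt0//.
    by apply: ler_powRl; rewrite ?(ltW al0) ?(ltW vd0)//; have := d0; lra.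
  rewrite mul0r add0r.
  have -> : v `^ (- (al + 1) - 1) = v `^ (- al - 1) * v^-1.
    by rewrite -(powR_inv1 (ltW v0)) powR_add//; congr (_ `^ _); lra.
  rewrite mulrCA ler_peMr ?powR_ge0// ler_pdivlMr// mul1r//.
- by apply: ge0_integralD_lty => //; exact: mk.
Qed.

(* Each spike decays only like t^(-al), which is not p-integrable; the
   difference gains a factor 1/v on the weight, hence 1/t on the mixture. *)
Let jump_le (v : R) :
  `|pow_gt d (- al) v - pow_gt 1 (- al) v| <=
  (pow_gt d (- al) v + pow_gt 1 (- al) v) * v^-1.
Proof.
have d1 : d < 1 by case/andP: d01.
rewrite /pow_gt; have [dv|vd] := ltP d v; last first.
  by rewrite ltNge (le_trans vd (ltW d1))/= subrr normr0 addr0 mul0r.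
have v0 : 0 < v by exact: lt_trans dv.
have [v1|v1] := ltP 1 v; last first.
  by rewrite subr0 addr0 ger0_norm ?powR_ge0// ler_peMr ?powR_ge0// invf_ge1.
have x0 : 0 < v - 1 by rewrite subr_gt0.
have y0 : 0 < v - d by rewrite subr_gt0.
have xy : v - 1 <= v - d by lra.
have le1 : (v - d) `^ (- al) <= (v - 1) `^ (- al).
  rewrite !powRN lef_pV2 ?posrE ?powR_gt0//.
  by apply: ler_powRl; rewrite ?(ltW al0) ?(ltW x0).
rewrite ler0_norm ?subr_le0// opprB.
have H : (v - 1) `^ (- al) - (v - d) `^ (- al) <= (v - 1) `^ (- al) * v^-1; last first.
  by apply: (le_trans H); rewrite ler_wpM2r ?invr_ge0 ?(ltW v0)// lerDr powR_ge0.
pose u := (v - 1) / (v - d).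
have u0 : 0 < u by rewrite divr_gt0.
have u1 : u <= 1 by rewrite ler_pdivrMr// mul1r.
have -> : (v - d) `^ (- al) = (v - 1) `^ (- al) * u `^ al.
  rewrite /u powRM ?(ltW x0) ?invr_ge0 ?(ltW y0)// mulrA powR_add// addNr powRr0 mul1r.
  by rewrite -(powR_inv1 (ltW y0)) -powRrM mulN1r.
rewrite -[X in X - _]mulr1 -mulrBr ler_wpM2l ?powR_ge0//.
have ual : u <= u `^ al.
  have u01 : 0 < u <= 1 by rewrite u0.
  have al1 : al <= 1 by case/andP: al01 => _ /ltW.
  by have := ger_powR u01 al1; rewrite powRr1 ?(ltW u0).
apply: (@le_trans _ _ (1 - u)); first by lra.
have -> : 1 - u = (1 - d) / (v - d) by rewrite /u; field; rewrite gt_eqF.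
rewrite ler_pdivrMr// mulrC ler_pdivlMr//.
have : 0 <= d * (v - 1) by rewrite mulr_ge0 ?(ltW d0) ?(ltW x0).
by lra.
Qed.

Let mexp_le (x : R) : 0 < x -> expR (- x) <= x^-1.
Proof.
move=> x0; rewrite expRN lef_pV2 ?posrE ?expR_gt0//.
by have := expR_ge1Dx x; lra.
Qed.

(** The factor 1/v gained in [jump_le] meets e^(-x) <= 1/x at x = pi t/v, and v cancels. The
    constant depends on d, so the bound serves only for finiteness. *)
Lemma spike_diff_le t : 0 < t ->
  `|spike al d t - spike al 1 t| <= (spike_bound d + spike_bound 1) / (pi * t).
Proof.
move=> t0; have pt : 0 < pi * t by rewrite mulr_gt0.
have dle := k_le _ d0 (ltW t0); have ole := k_le _ (@ltr01 R) (ltW t0).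
have int a : 0 < a -> mu.-integrable setT
    (EFin \o (fun v : mR => pow_gt a (- al) v * v^-1 * expR (- (pi / v * t)))).
  move=> a0; apply/integrableP; split; first by apply/measurable_EFinP; exact: mk.
  apply: le_lt_trans (spike_fin a0 (ltW t0)); apply: le_of_eq.
  by apply: eq_integral => v _; rewrite /= ger0_norm// mulr_ge0 ?i0 ?expR_ge0.
rewrite /spike /mixture -RintegralB//; [|exact: int|exact: int].
have fd := integral_pow_gt_inv_lty d0 al01; have f1 := integral_pow_gt_inv_lty (@ltr01 R) al01.
have E : (spike_bound d + spike_bound 1) / (pi * t) = \int[mu]_v
    ((pi * t)^-1 * (pow_gt d (- al) v * v^-1 + pow_gt 1 (- al) v * v^-1)).
  rewrite ge0_RintegralZl; last 2 first.
  - by apply: measurable_funD; exact: mi.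
  - by move=> v; rewrite addr_ge0 ?i0.
  by rewrite mulrC (ge0_RintegralD (mi d) (mi 1) (fun v => i0 v d0)
    (fun v => i0 v (@ltr01 R)) fd f1).
apply: (@le_trans _ _ (\int[mu]_v `|pow_gt d (- al) v * v^-1 * expR (- (pi / v * t)) -
    pow_gt 1 (- al) v * v^-1 * expR (- (pi / v * t))|)).
  by apply: le_normr_Rintegral => //; apply: integrableRB; exact: int.
rewrite E; apply: ge0_le_Rintegral.
- by apply: measurableT_comp => //; apply: measurable_funB; exact: mk.
- by apply: measurable_funM => //; apply: measurable_funD; exact: mi.
- move=> v; rewrite normr_ge0/=.
  have [vd|vd] := leP v d.
    have d1 : d < 1 by case/andP: d01.
    rewrite /pow_gt ltNge vd ltNge (le_trans vd (ltW d1))/= !mul0r subrr normr0 addr0 mulr0//.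
  have v0 : 0 < v by exact: lt_trans vd.
  have X0 : 0 < pi / v * t by rewrite mulr_gt0// divr_gt0.
  rewrite -!mulrBl !normrM (ger0_norm (expR_ge0 _)) (@ger0_norm _ v^-1) ?invr_ge0 ?(ltW v0)//.
  rewrite -mulrDl; set D := `|_|; set S := pow_gt d _ v + _.
  have DS : D <= S * v^-1 by exact: jump_le.
  have eE : v^-1 * expR (- (pi / v * t)) <= (pi * t)^-1.
    apply: (@le_trans _ _ (v^-1 * (pi / v * t)^-1)).
      by rewrite ler_wpM2l ?invr_ge0 ?(ltW v0)// mexp_le.
    apply: le_of_eq.
    have vn : v != 0 by rewrite gt_eqF.
    have tn : t != 0 by rewrite gt_eqF.
    have pn : pi != 0 :> R by rewrite gt_eqF.
    by move: (@pi R) pn => P Pn; field; rewrite ?vn ?tn ?Pn.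
  rewrite -mulrA [leRHS]mulrC.
  have D0 : 0 <= D by exact: normr_ge0.
  have ve0 : 0 <= v^-1 * expR (- (pi / v * t)) by rewrite mulr_ge0 ?invr_ge0 ?expR_ge0 ?(ltW v0).
  exact: ler_pM.
- apply: ge0_integralZl_lty.
  + by rewrite invr_ge0 ltW.
  + by apply: measurable_funD; exact: mi.
  + by move=> v; rewrite addr_ge0 ?i0.
  + exact: (ge0_integralD_lty (mi d) (mi 1) (fun v => i0 v d0) (fun v => i0 v (@ltr01 R)) fd f1).
Qed.
End SpikeEstimates.

Section Cut.
Context {R : realType}.
Notation mu := (@lebesgue_measure R).
Notation mR := (measurableTypeR R).

Definition cut (a b : R) (g : R -> R) (t : R) : R := if a <= t <= b then g t else 0.

Lemma integral_cut a b g :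
  (\int[mu]_t (cut a b g t)%:E = \int[mu]_(t in `[a, b]) (g t)%:E)%E.
Proof.
rewrite [RHS]integral_mkcond; apply: eq_integral => t _; rewrite patchE /cut.
case: ifPn => [tab|tab]; first by rewrite mem_set//= in_itv.
by rewrite memNset//= in_itv/=; exact/negP.
Qed.

Lemma cut_ge0 a b g t : (forall t, 0 <= g t) -> 0 <= cut a b g t.
Proof. by move=> g0; rewrite /cut; case: ifP. Qed.

Lemma measurable_cut a b g : measurable_fun [set: mR] g -> measurable_fun [set: mR] (cut a b g).
Proof.
move=> mg; apply: measurable_fun_ifT => //.
by apply: measurable_and; [exact: measurable_fun_ler|exact: measurable_fun_ler].
Qed.

Lemma integral_cut_cst b r : 0 <= b ->
  (\int[mu]_t (cut 0 b (cst r) t)%:E = (r * b)%:E)%E.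
Proof.
move=> b0; rewrite integral_cut.
transitivity (\int[mu]_(t in `[0%R, b]) (cst r%:E t))%E; first by [].
rewrite integral_cst//= lebesgue_measure_itv/= lte_fin.
move: b0; rewrite le_eqVlt => /predU1P[<-|b0]; first by rewrite ltxx mule0 mulr0.
by rewrite b0 oppr0 addr0.
Qed.

Lemma integral_cutV d : 0 < d < 1 ->
  (\int[mu]_t (cut d 1 (@powR R ^~ (-1)) t)%:E = (- ln d)%:E)%E.
Proof.
move=> /andP[d0 d1]; rewrite integral_cut.
have -> : - ln d = ln 1 - ln d by rewrite ln1 sub0r.
apply: (FTC2_segment d1).
- move=> t /andP[dt _]; have t0 : 0 < t by exact: lt_le_trans dt.
  by rewrite powR_inv1 ?(ltW t0)//; exact: is_derive1_ln.
- move=> t /andP[dt _]; apply: continuous_powRl; exact: lt_le_trans dt.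
Qed.

Lemma integral_cut_powR d e : 0 < d < 1 -> e + 1 != 0 ->
  (\int[mu]_t (cut d 1 (@powR R ^~ e) t)%:E = ((1 - d `^ (e + 1)) / (e + 1))%:E)%E.
Proof.
move=> /andP[d0 d1] e1; rewrite integral_cut.
rewrite mulrBl; have -> : 1 / (e + 1) = 1 `^ (e + 1) * (e + 1)^-1 by rewrite powR1.
apply: (@FTC2_segment R (fun t => t `^ (e + 1) * (e + 1)^-1) _ _ _ d1).
- move=> t /andP[dt _]; have t0 : 0 < t by exact: lt_le_trans dt.
  have D := is_derive1_powR (e + 1) t0.
  have H := @is_deriveM R R (@powR R ^~ (e + 1)) (cst (e + 1)^-1) t 1 _ _ D
    (is_derive_cst (e + 1)^-1 t 1).
  apply: (@is_derive_eq _ _ _ _ _ _ _ _ H).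
  by rewrite scaler0 add0r addrK /GRing.scale/= mulrA mulVf// mul1r.
- move=> t /andP[dt _]; apply: continuous_powRl; exact: lt_le_trans dt.
Qed.

Lemma integral_tail_sq : (\int[mu]_t (tail 1 (- 2) t)%:E < +oo)%E :> Prop.
Proof.
have -> : (- 2 = - 1 - 1 :> R) by lra.
by apply: integral_tail_lty.
Qed.
End Cut.

(** * Growth of the norms in ln(1/d) *)

Section SourceLp.
Context {R : realType}.
Notation mu := (@lebesgue_measure R).
Notation mR := (measurableTypeR R).
Variables (k : nat) (p : R).
Hypothesis k0 : (0 < k)%N.
Hypothesis p2 : 2 <= p.
Let p0 : 0 < p. Proof. exact: lt_le_trans p2. Qed.
Let al0 : 0 < p^-1. Proof. by rewrite invr_gt0. Qed.
Let al12 : p^-1 <= 2^-1. Proof. by rewrite lef_pV2 ?posrE. Qed.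
Let al01 : 0 < p^-1 < 1.
Proof. by rewrite al0/=; have := al12; lra. Qed.

(** The contribution from outside [d, 1]. On ]0, d] the p-th power of the bound
    [source_modulus_small] is a constant over d, on an interval of length d; beyond 1 the tail is
    integrable. Neither part depends on d. *)
Definition source_Lp_const : R :=
  (expR pi * source_const k p^-1) `^ p +
  source_tail_const k p^-1 `^ p * \int[mu]_t tail 1 (- 2) t.

Lemma source_const_gt0 : 0 < source_const k p^-1.
Proof.
by rewrite mulr_gt0 ?powR_gt0 ?pi_gt0// Gamma_gt0// ltr_wpDl// divr_ge0.
Qed.

Lemma powR_powRV (r t : R) : 0 <= r -> 0 < t -> (r * t `^ (- p^-1)) `^ p = r `^ p * t `^ (-1).
Proof.
move=> r0 t0; rewrite powRM ?powR_ge0// -powRrM mulNr mulVf//.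
by rewrite gt_eqF.
Qed.

Lemma source_Lp_le d : 0 < d < 1 ->
  (\int[mu]_(t in `]0%R, +oo[) (source_modulus k p^-1 d t `^ p)%:E <=
   (source_const k p^-1 `^ p * (- ln d) + source_Lp_const)%:E)%E.
Proof.
move=> d01; have /andP[d0 d1] := d01.
set B := source_const k p^-1; set C := source_tail_const k p^-1.
have B0 : 0 < B by exact: source_const_gt0.
have C0 : 0 <= C by exact: source_tail_const_ge0.
have F0 t : 0 <= source_modulus k p^-1 d t by exact: source_modulus_ge0.
pose K := (expR pi * B) `^ p * d^-1.
have K0 : 0 <= K by rewrite mulr_ge0 ?powR_ge0 ?invr_ge0 ?(ltW d0).
have m1 : measurable_fun [set: mR] (cut 0 d (cst K)) by apply: measurable_cut.
have m2 : measurable_fun [set: mR] (fun t => B `^ p * cut d 1 (@powR R ^~ (-1)) t).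
  by apply: measurable_funM => //; apply: measurable_cut; exact: measurable_powR.
have m3 : measurable_fun [set: mR] (fun t => C `^ p * tail 1 (- 2) t).
  by apply: measurable_funM => //; exact: measurable_tail.
have n1 t : 0 <= cut 0 d (cst K) t by apply: cut_ge0.
have n2 t : 0 <= B `^ p * cut d 1 (@powR R ^~ (-1)) t.
  by rewrite mulr_ge0 ?powR_ge0// cut_ge0// => x; exact: powR_ge0.
have n3 t : 0 <= C `^ p * tail 1 (- 2) t by rewrite mulr_ge0 ?powR_ge0 ?tail_ge0.
have mF : measurable_fun [set: mR] (fun t => source_modulus k p^-1 d t `^ p).
  exact: (measurableT_comp (@measurable_powR R p) (measurable_source_modulus k0 al12 d01)).
have T0 := integral_EFin_ge0 (m := mu) (@tail_ge0 R 1 (- 2)).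
rewrite -integral_gtr0.
apply: (@le_trans _ _ (\int[mu]_t (cut 0 d (cst K) t +
   (B `^ p * cut d 1 (@powR R ^~ (-1)) t + C `^ p * tail 1 (- 2) t))%:E)%E).
  under eq_integral do rewrite -EFinM.
  apply: ge0_le_integral_EFin.
  - apply: measurable_funM; last exact: mF.
    by apply: measurable_fun_ifT => //; exact: measurable_fun_ltr.
  - by apply: measurable_funD => //; apply: measurable_funD.
  - move=> t; rewrite mulr_ge0 ?powR_ge0//=; last by case: ifP.
    have [t0|t0] := ltP 0 t; last by rewrite mul0r addr_ge0// addr_ge0.
    rewrite mul1r.
    have [td|td] := leP t d.
      apply: (@le_trans _ _ (cut 0 d (cst K) t)); last by rewrite lerDl addr_ge0.
      rewrite /cut td (ltW t0)/= /K -(powR_inv1 (ltW d0)) -powR_powRV//; last first.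
        by rewrite mulr_ge0 ?expR_ge0 ?(ltW B0).
      apply: ler_powRl; [exact: ltW|exact: F0|exact: source_modulus_small].
    have [t1|t1] := leP t 1.
      apply: (@le_trans _ _ (B `^ p * cut d 1 (@powR R ^~ (-1)) t)); last first.
        by rewrite addrCA lerDl addr_ge0.
      rewrite /cut (ltW td) t1/= -powR_powRV ?(ltW B0)//.
      apply: ler_powRl; [exact: ltW|exact: F0|exact: source_modulus_le_powR].
    apply: (@le_trans _ _ (C `^ p * tail 1 (- 2) t)); last by rewrite addrA lerDr addr_ge0.
    (* The p-th power of the tail bound is C^p t^(-1-p), and 1 + p >= 2. *)
    apply: (@le_trans _ _ ((C * t `^ (- p^-1 - 1)) `^ p)).
      apply: ler_powRl; [exact: ltW|exact: F0|exact: source_modulus_tail].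
    rewrite powRM ?powR_ge0// ler_wpM2l ?powR_ge0// /tail t1 -powRrM.
    apply: ler_powR; first exact: ltW.
    rewrite mulrBl mulNr mulVf ?gt_eqF//; have := p2; lra.
have n23 t : 0 <= B `^ p * cut d 1 (@powR R ^~ (-1)) t + C `^ p * tail 1 (- 2) t.
  by rewrite addr_ge0.
rewrite (ge0_integralD_EFin m1 (measurable_funD m2 m3) n1 n23).
rewrite (ge0_integralD_EFin m2 m3 n2 n3).
have mc : measurable_fun [set: mR] (cut d 1 (@powR R ^~ (-1))).
  by apply: measurable_cut; exact: measurable_powR.
have nc t : 0 <= cut d 1 (@powR R ^~ (-1)) t by apply: cut_ge0 => x; exact: powR_ge0.
have mt : measurable_fun [set: mR] (tail (1 : R) (- 2)) by exact: measurable_tail.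
rewrite (ge0_integralZl_EFin mc nc (powR_ge0 B p)).
rewrite (ge0_integralZl_EFin mt (@tail_ge0 R _ _) (powR_ge0 C p)).
rewrite integral_cut_cst ?(ltW d0)// integral_cutV//.
have -> : (\int[mu]_t (tail 1 (- 2) t)%:E = (\int[mu]_t tail 1 (- 2) t)%:E)%E.
  by rewrite fineK// ge0_fin_numE// integral_tail_sq.
rewrite -!EFinM -!EFinD lee_fin /source_Lp_const /K divfK ?gt_eqF//.
by rewrite addrCA.
Qed.
End SourceLp.

Section JumpLp.
Context {R : realType}.
Notation mu := (@lebesgue_measure R).
Notation mR := (measurableTypeR R).
Variable p : R.
Hypothesis p2 : 2 <= p.
Let p0 : 0 < p. Proof. exact: lt_le_trans p2. Qed.
Let al0 : 0 < p^-1. Proof. by rewrite invr_gt0. Qed.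
Let al01 : 0 < p^-1 < 1.
Proof.
by rewrite al0/= invf_lt1//; have := p2; lra.
Qed.
Let pi0 : 0 < pi :> R. Proof. exact: pi_gt0. Qed.
Let K1 : R := spike_bound p^-1 1.
Let G : R := Gamma p^-1.

Let K_ge0 a : 0 < a -> 0 <= spike_bound p^-1 a.
Proof.
by move=> a0; apply: le_trans (spike_le al01 a0 (lexx 0)); exact: spike_ge0.
Qed.

(** Bernoulli's inequality at y/x gives x^p - p x^(p-1) y <= (x-y)^p; when y >= x the error term
    alone exceeds x^p. The error is linear in y, so its integral can be kept bounded in d. *)
Lemma powR_le_addr (x y g : R) : 0 < x -> 0 <= y -> 0 <= g -> x <= g + y ->
  x `^ p <= g `^ p + p * (x `^ (p - 1) * y).
Proof.
move=> x0 y0 g0 xgy.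
have xpE : x `^ p = x `^ (p - 1) * x.
  by rewrite -[X in _ * X](powRr1 (ltW x0)) powR_add// subrK.
have p1 : 1 <= p by have := p2; lra.
have xp0 : 0 <= x `^ (p - 1) by exact: powR_ge0.
have [xy|yx] := leP x y.
  rewrite xpE; apply: (@le_trans _ _ (p * (x `^ (p - 1) * y))); last by rewrite lerDr powR_ge0.
  rewrite mulrCA ler_wpM2l//; apply: (le_trans xy).
  by rewrite ler_peMl.
have u01 : 0 <= y / x <= 1 by rewrite divr_ge0 ?(ltW x0)//= ler_pdivrMr// mul1r ltW.
have H := ler_wpM2l (powR_ge0 x p) (bernoulli_powR p1 u01).
have u1 : 0 <= 1 - y / x by case/andP: u01 => _; rewrite subr_ge0.
rewrite -powRM ?(ltW x0)// in H.
have xE : x * (1 - y / x) = x - y by field; rewrite gt_eqF.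
have gE : (x - y) `^ p <= g `^ p by apply: ler_powRl; [exact: ltW|rewrite subr_ge0 ltW|lra].
rewrite xE in H; have {}H := le_trans H gE.
rewrite -lerBlDr; apply: le_trans H; rewrite mulrBr mulr1 lerB//.
rewrite [X in X * (p * _)]xpE; apply: le_of_eq.
by move: (x `^ (p - 1)) => X; field; rewrite gt_eqF.
Qed.

(** The coefficients of p x^(p-1) y in [powR_le_addr] for x = G (pi t)^(-1/p). The deficit of
    [spike_lower] contributes d t^(-2), with integral 1 - d over [d, 1]; the bound [K1] of the spike
    at 1 contributes t^(1/p-1), with integral at most p. The sum is free of d. *)
Definition jump_const1 : R := p * (G `^ (p - 1) * (Gamma (p^-1 + 1) * pi `^ (- 2))).
Definition jump_const2 : R := p * (G `^ (p - 1) * (K1 * pi `^ (p^-1 - 1))).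
Definition jump_Lp_const : R := jump_const1 + jump_const2 * p.

Let G0 : 0 < G. Proof. exact: Gamma_gt0. Qed.

Let Gp : 0 < Gamma (p^-1 + 1).
Proof. exact: Gamma_gt0 (addr_gt0 al0 ltr01). Qed.

Let c10 : 0 <= jump_const1.
Proof.
exact: mulr_ge0 (ltW p0) (mulr_ge0 (powR_ge0 _ _) (mulr_ge0 (ltW Gp) (powR_ge0 _ _))).
Qed.

Let c20 : 0 <= jump_const2.
Proof. by rewrite mulr_ge0 ?(ltW p0)// mulr_ge0 ?powR_ge0// mulr_ge0 ?powR_ge0// K_ge0. Qed.

Section fixed_d.
Variable d : R.
Hypothesis d01 : 0 < d < 1.
Let d0 : 0 < d. Proof. by case/andP: d01. Qed.

Definition jump (t : R) : R := spike p^-1 d t - spike p^-1 1 t.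

Lemma measurable_jump : measurable_fun [set: R] jump.
Proof. by apply: measurable_funB; apply: measurable_spike. Qed.

Let mjp : measurable_fun [set: mR] (fun t => `|jump t| `^ p).
Proof.
apply: (@measurableT_comp _ _ _ _ _ _ (@powR R ^~ p)); first exact: measurable_powR.
by apply: measurableT_comp => //; exact: measurable_jump.
Qed.

Let mind : measurable_fun [set: mR] (fun t : mR => ((if 0 < t then 1 else 0) * `|jump t| `^ p) : mR).
Proof.
apply: measurable_funM; last exact: mjp.
by apply: measurable_fun_ifT => //; exact: measurable_fun_ltr.
Qed.

Let indE : (\int[mu]_(t in `]0%R, +oo[) (`|jump t| `^ p)%:E =
  \int[mu]_t ((if 0 < t then 1 else 0) * `|jump t| `^ p)%:E)%E.
Proof. by rewrite -integral_gtr0. Qed.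

Let ind0 t : 0 <= (if 0 < t then 1 else 0) * `|jump t| `^ p.
Proof. by rewrite mulr_ge0 ?powR_ge0//; case: ifP. Qed.

(** The spike at d is the jump plus the spike at 1. Hence the main term x of [spike_lower] is at
    most the modulus of the jump plus y, where y joins the deficit of that lemma to the bound [K1]
    of the spike at 1. *)
Let jump_pointwise t : 0 < t ->
  G `^ p * pi^-1 * t `^ (-1) <=
  `|jump t| `^ p + (jump_const1 * d * t `^ (- 2) + jump_const2 * t `^ (p^-1 - 1)).
Proof.
move=> t0; have pt : 0 < pi * t by rewrite mulr_gt0.
pose x := G * (pi * t) `^ (- p^-1).
pose y := d * (Gamma (p^-1 + 1) * (pi * t) `^ (- (p^-1 + 1))) + K1.
have x0 : 0 < x by rewrite mulr_gt0 ?powR_gt0.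
have y0 : 0 <= y.
  exact: addr_ge0 (mulr_ge0 (ltW d0) (mulr_ge0 (ltW Gp) (powR_ge0 _ _))) (K_ge0 ltr01).
have xy : x <= `|jump t| + y.
  have H := spike_lower al01 d01 t0.
  have Hs := spike_le al01 (@ltr01 R) (ltW t0).
  have Hj := ler_norm (jump t).
  apply: (le_trans H); rewrite /y [leRHS]addrCA [leLHS]addrC lerD2l.
  rewrite -(subrK (spike p^-1 1 t) (spike p^-1 d t)).
  exact: lerD Hj Hs.
have := powR_le_addr x0 y0 (normr_ge0 _) xy.
have pn : p != 0 by rewrite gt_eqF.
have -> : x `^ p = G `^ p * pi^-1 * t `^ (-1).
  rewrite /x powR_powRV ?(ltW G0)// powRM ?(ltW pi0) ?(ltW t0)//.
  by rewrite mulrA (powR_inv1 (ltW pi0)).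
have -> : x `^ (p - 1) = G `^ (p - 1) * (pi * t) `^ (p^-1 - 1).
  rewrite /x powRM ?(ltW G0) ?powR_ge0// -powRrM; congr (_ * _ `^ _).
  by field.
move=> H; apply: (le_trans H); rewrite lerD2l; apply: le_of_eq.
have E2 : (pi * t) `^ (p^-1 - 1) * (pi * t) `^ (- (p^-1 + 1)) = pi `^ (- 2) * t `^ (- 2).
  rewrite powR_add// -powRM ?(ltW pi0) ?(ltW t0)//; congr (_ `^ _); lra.
have E1 : (pi * t) `^ (p^-1 - 1) = pi `^ (p^-1 - 1) * t `^ (p^-1 - 1).
  by rewrite powRM ?(ltW pi0) ?(ltW t0).
transitivity (p * G `^ (p - 1) * (d * Gamma (p^-1 + 1) *
  ((pi * t) `^ (p^-1 - 1) * (pi * t) `^ (- (p^-1 + 1))) + K1 * (pi * t) `^ (p^-1 - 1))).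
  rewrite /y; move: (G `^ _) (Gamma _) (_ `^ (- (p^-1 + 1))) ((pi * t) `^ (p^-1 - 1)) => A B C E.
  by ring.
rewrite E2 E1 /jump_const1 /jump_const2.
move: (G `^ _) (Gamma _) (pi `^ (- 2)) (t `^ (- 2)) (pi `^ (p^-1 - 1)) (t `^ (p^-1 - 1)).
by move=> A B C E F H'; ring.
Qed.

Lemma jump_Lp_ge :
  ((G `^ p * pi^-1 * (- ln d))%:E <=
   \int[mu]_(t in `]0%R, +oo[) (`|jump t| `^ p)%:E + jump_Lp_const%:E)%E.
Proof.
have d1 : d < 1 by case/andP: d01.
have mc e : measurable_fun [set: mR] (cut d 1 (@powR R ^~ e)).
  by apply: measurable_cut; exact: measurable_powR.
have nc e t : 0 <= cut d 1 (@powR R ^~ e) t by apply: cut_ge0 => x; exact: powR_ge0.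
have Gp0 : 0 <= G `^ p * pi^-1 by rewrite mulr_ge0 ?powR_ge0 ?invr_ge0 ?(ltW pi0).
have c1d : 0 <= jump_const1 * d by rewrite mulr_ge0 ?(ltW d0).
have m1 : measurable_fun [set: mR] (fun t => jump_const1 * d * cut d 1 (@powR R ^~ (- 2)) t).
  by apply: measurable_funM.
have m2 : measurable_fun [set: mR] (fun t => jump_const2 * cut d 1 (@powR R ^~ (p^-1 - 1)) t).
  by apply: measurable_funM.
have n1 t : 0 <= jump_const1 * d * cut d 1 (@powR R ^~ (- 2)) t by rewrite mulr_ge0.
have n2 t : 0 <= jump_const2 * cut d 1 (@powR R ^~ (p^-1 - 1)) t by rewrite mulr_ge0.
have n12 t := addr_ge0 (n1 t) (n2 t).
have m12 := measurable_funD m1 m2.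
apply: (@le_trans _ _ (\int[mu]_t ((if 0 < t then 1 else 0) * `|jump t| `^ p +
  (jump_const1 * d * cut d 1 (@powR R ^~ (- 2)) t +
   jump_const2 * cut d 1 (@powR R ^~ (p^-1 - 1)) t))%:E)%E).
  rewrite EFinM -(integral_cutV d01) -(ge0_integralZl_EFin (mc _) (nc _) Gp0).
  apply: ge0_le_integral_EFin.
  - by apply: measurable_funM.
  - by apply: measurable_funD.
  - move=> t; rewrite mulr_ge0//= /cut; case: ifPn => [/andP[dt t1]|_]; last first.
      by rewrite !mulr0 !addr0.
    have t0 : 0 < t by exact: lt_le_trans dt.
    by rewrite t0 mul1r; exact: jump_pointwise.
rewrite (ge0_integralD_EFin mind m12 ind0 n12) -indE; apply: leeD => //.
rewrite (ge0_integralD_EFin m1 m2 n1 n2).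
rewrite (ge0_integralZl_EFin (mc _) (nc _) c1d) (ge0_integralZl_EFin (mc _) (nc _) c20).
rewrite (integral_cut_powR d01); last by lra.
rewrite (integral_cut_powR d01); last by rewrite subrK gt_eqF.
rewrite -!EFinM -EFinD lee_fin subrK; apply: lerD.
  have -> : (- 2 + 1 = - 1 :> R) by lra.
  rewrite (powR_inv1 (ltW d0)) -mulrA ler_piMr//.
  have -> : d * ((1 - d^-1) / -1) = 1 - d by field; rewrite gt_eqF.
  by have := d0; lra.
rewrite invrK ler_wpM2l// ler_piMl ?(ltW p0)//.
by rewrite gerBl powR_ge0.
Qed.

(** Makes the radial integral a real number, so that it can be moved across inequalities. Its bounds
    depend on d: a constant up to t = 1, then a multiple of t^(-p), which is below t^(-2). *)
Lemma jump_Lp_lty : (\int[mu]_(t in `]0%R, +oo[) (`|jump t| `^ p)%:E < +oo)%E.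
Proof.
pose M := spike_bound p^-1 d + spike_bound p^-1 1.
have M0 : 0 <= M by rewrite addr_ge0 ?K_ge0.
have mt : measurable_fun [set: mR] (tail (1 : R) (- 2)) by exact: measurable_tail.
have m1 : measurable_fun [set: mR] (cut 0 1 (cst (M `^ p))) by apply: measurable_cut.
have Mp : 0 <= (M / pi) `^ p by exact: powR_ge0.
have m2 : measurable_fun [set: mR] (fun t => (M / pi) `^ p * tail 1 (- 2) t).
  by apply: measurable_funM.
have n1 t : 0 <= cut 0 1 (cst (M `^ p)) t by apply: cut_ge0 => x; exact: powR_ge0.
have n2 t : 0 <= (M / pi) `^ p * tail 1 (- 2) t by rewrite mulr_ge0 ?tail_ge0.
rewrite indE; apply: (ge0_integral_lty_le mind (measurable_funD m1 m2)).
  move=> t; rewrite ind0/=; have [t0|t0] := ltP 0 t; last by rewrite mul0r addr_ge0.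
  rewrite mul1r; have [t1|t1] := leP t 1.
    apply: (@le_trans _ _ (cut 0 1 (cst (M `^ p)) t)); last by rewrite lerDl.
    rewrite /cut (ltW t0) t1/=; apply: ler_powRl; [exact: ltW|exact: normr_ge0|].
    have h1 := spike_le al01 d0 (ltW t0); have h2 := spike_le al01 (@ltr01 R) (ltW t0).
    apply: (le_trans (ler_normB _ _)).
    by rewrite (ger0_norm (spike_ge0 _ _ d0)) (ger0_norm (spike_ge0 _ _ ltr01)); exact: lerD.
  apply: (@le_trans _ _ ((M / pi) `^ p * tail 1 (- 2) t)); last by rewrite lerDr.
  apply: (@le_trans _ _ ((M / (pi * t)) `^ p)).
    by apply: ler_powRl; [exact: ltW|exact: normr_ge0|exact: spike_diff_le].
  have -> : M / (pi * t) = M / pi * t `^ (-1).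
    by rewrite (powR_inv1 (ltW t0)) invfM mulrA.
  rewrite powRM ?powR_ge0 ?divr_ge0 ?(ltW pi0)// ler_wpM2l// /tail t1 -powRrM.
  apply: ler_powR; first exact: ltW.
  by have := p2; lra.
rewrite (ge0_integralD_EFin m1 m2 n1 n2) integral_cut_cst//.
rewrite (ge0_integralZl_EFin mt (@tail_ge0 R _ _) Mp).
apply: lte_add_pinfty; first exact: ltry.
apply: lte_mul_pinfty => //; exact: integral_tail_sq.
Qed.
End fixed_d.
End JumpLp.

Section LpNorm.
Context {R : realType}.
Notation mR := (measurableTypeR R).
Notation plane := (plane_measure R).
Variable p : R.
Hypothesis p0 : 0 < p.
Implicit Types f : R * R -> R[i].

Lemma poweR_Lp_norm f :
  (Lp_norm p f `^ p = \int[plane]_z (cmodulus (f z) `^ p)%:E)%E.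
Proof.
have pn : p != 0 by rewrite gt_eqF.
rewrite [LHS](poweR_Lnorm _ _ pn); apply: eq_integral => z _.
by rewrite abse_EFin ger0_norm ?cmodulus_ge0.
Qed.

Lemma Lp_norm_ge0 f : (0 <= Lp_norm p f)%E.
Proof. exact: Lnorm_ge0. Qed.

Lemma Lp_normE f :
  (Lp_norm p f = (\int[plane]_z (cmodulus (f z) `^ p)%:E) `^ p^-1)%E.
Proof.
rewrite -poweR_Lp_norm -poweRrM mulfV ?gt_eqF// poweRE oner_eq0/=.
have := Lp_norm_ge0 f; case: (Lp_norm p f) => //= r r0.
by rewrite powRr1.
Qed.

Lemma Lp_norm0 : Lp_norm p (fun=> 0) = 0%E.
Proof.
rewrite Lp_normE; under eq_integral.
  move=> z _; rewrite cmodulusE/= expr0n/= addr0 sqrtr0 powR0 ?gt_eqF//. over.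
by rewrite integral0 poweR_EFin powR0// gt_eqF// invr_gt0.
Qed.
End LpNorm.

(** * The lower bound for the operator norm *)

Section LowerBound.
Context {R : realType}.
Notation mu := (@lebesgue_measure R).
Notation mR := (measurableTypeR R).
Notation plane := (plane_measure R).
Local Notation "x %:C" := (real_complex R x).
Variables (k : nat) (p : R).
Hypothesis k0 : (0 < k)%N.
Hypothesis p2 : 2 <= p.
Let p0 : 0 < p. Proof. exact: lt_le_trans p2. Qed.
Let al0 : 0 < p^-1. Proof. by rewrite invr_gt0. Qed.
Let al12 : p^-1 <= 2^-1. Proof. by rewrite lef_pV2 ?posrE. Qed.
Let al01 : 0 < p^-1 < 1.
Proof. by rewrite al0/=; have := al12; lra. Qed.

Definition image_const : R :=
  Gamma (k%:R / 2 - p^-1 + 1) / Gamma (1 - p^-1) * pi `^ (- (k%:R / 2)).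

Lemma image_const_gt0 : 0 < image_const.
Proof.
rewrite mulr_gt0 ?powR_gt0 ?pi_gt0// divr_gt0// Gamma_gt0//.
  have h : 0 <= k%:R / 2 :> R by rewrite divr_ge0.
  by have := al12; lra.
by have := al12; lra.
Qed.

Section fixed_d.
Variable d : R.
Hypothesis d01 : 0 < d < 1.
Variable c : R.
Hypothesis c0 : 0 < c.

Let f (z : R * R) : R[i] := c%:C * source k p^-1 d z.
Let g : R * R -> R[i] := multiplier_op (fun xi => riesz_symbol xi ^+ k) f.

Let cmodulus_f z : cmodulus (f z) = c * source_modulus k p^-1 d (sqmod z).
Proof.
by rewrite /f cmodulusM cmodulus_real gtr0_norm// (cmodulus_source k0 al12 d01).
Qed.

Let gE z : g z = c%:C * (Complex 0 (-1) ^+ k * (image_const * jump p d (sqmod z))%:C).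
Proof. exact: (multiplier_source k0 al0 al12 d01). Qed.

Let cmodulus_g z : cmodulus (g z) = c * image_const * `|jump p d (sqmod z)|.
Proof.
rewrite gE !cmodulusM cmodulusX !cmodulus_real (gtr0_norm c0) normrM.
rewrite (gtr0_norm image_const_gt0).
have -> : cmodulus (Complex 0 (-1) : R[i]) = 1.
  by rewrite cmodulusE/= expr0n/= add0r sqrrN expr1n sqrtr1.
by rewrite expr1n mul1r mulrA.
Qed.

Let mf : cmeasurable f.
Proof.
have [[i1 i2] _] := fourier_class_source k0 al0 al12 d01 c%:C.
by split; apply/measurable_EFinP; [exact: (measurable_int _ i1)|exact: (measurable_int _ i2)].
Qed.

Let mg : cmeasurable g.
Proof.
pose K := c%:C * (Complex 0 (-1) ^+ k * image_const%:C).
have E z : g z = (jump p d (sqmod z))%:C * K.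
  rewrite gE /K; move: (Complex 0 (-1) ^+ k) (jump _ _ _) image_const => A j I.
  have -> : (I * j)%:C = I%:C * j%:C by rewrite rmorphM.
  by move: (I%:C) (j%:C) => I' j'; ring.
have mj := measurable_radial (@measurable_jump R p d d01).
split.
  rewrite (_ : (fun x => _) = (fun x => jump p d (sqmod x) * Re K)).
    exact: measurable_funM.
  by apply/funext => x; rewrite E Re_realM.
rewrite (_ : (fun x => _) = (fun x => jump p d (sqmod x) * Im K)).
  exact: measurable_funM.
by apply/funext => x; rewrite E Im_realM.
Qed.

(** The equation for [c] normalises the upper bound of the p-th power of the norm of [f] to 1, so
    that [f] competes in the supremum. [J] is the radial integral of the p-th power of the jump. *)
Lemma multiplier_source_Lp (c3 : R) : 0 < c3 ->
  (forall f : R -> \bar R, measurable_fun setT f -> (forall x, (0 <= f x)%E) ->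
  (\int[plane]_z f (sqmod z) = c3%:E * \int[mu]_(t in `]0%R, +oo[) f t)%E) ->
  c3 * c `^ p * (source_const k p^-1 `^ p * (- ln d) + source_Lp_const k p) = 1 ->
  exists J : R,
    [/\ Gamma p^-1 `^ p * pi^-1 * (- ln d) <= J + jump_Lp_const p,
        ((c3 * (c * image_const) `^ p * J)%:E = Lp_norm p g `^ p)%E &
        (Lp_norm p g <= riesz_power_norm k p)%E].
Proof.
move=> c30 radial cE.
have cp0 : 0 <= c `^ p by exact: powR_ge0.
have mF : measurable_fun [set: R] (fun t => source_modulus k p^-1 d t `^ p).
  exact: (measurableT_comp (@measurable_powR R p) (measurable_source_modulus k0 al12 d01)).
have mJ : measurable_fun [set: R] (fun t => `|jump p d t| `^ p).
  apply: (measurableT_comp (@measurable_powR R p)).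
  by apply: measurableT_comp => //; exact: measurable_jump.
have scale (r : R) (h : R -> R) : measurable_fun [set: R] h -> (forall t, 0 <= h t) ->
    0 <= r -> (\int[plane]_z (r * h (sqmod z))%:E =
    c3%:E * (r%:E * \int[mu]_(t in `]0%R, +oo[) (h t)%:E))%E.
  move=> mh h0 r0.
  rewrite (radial (fun t => (r * h t)%:E)); last 2 first.
  - by apply/measurable_EFinP; apply: measurable_funM.
  - by move=> t; rewrite lee_fin mulr_ge0.
  congr (_ * _)%E; under eq_integral do rewrite EFinM.
  rewrite ge0_integralZl; [by []|exact: measurable_itvR| | |by rewrite lee_fin].
  - by apply/measurable_EFinP; exact: (measurable_funS measurableT).
  - by move=> t _; rewrite lee_fin.
have Nf : (Lp_norm p f <= 1)%E.
  have -> : 1%E = (1 `^ p^-1)%E :> \bar R by rewrite poweR1r.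
  rewrite Lp_normE//; apply: gt0_ler_poweR.
  - exact: ltW.
  - rewrite in_itv/= leey andbT; apply: integral_ge0 => z _.
    by rewrite lee_fin powR_ge0.
  - by rewrite in_itv/= leey lee_fin ler01.
  under eq_integral => z _.
    rewrite cmodulus_f powRM ?(ltW c0) ?(source_modulus_ge0 k0 al12 d01)//.
    over.
  rewrite (scale _ _ mF (fun t => powR_ge0 _ _) cp0).
  have H := source_Lp_le k0 p2 d01.
  have := lee_wpmul2l (_ : (0 <= (c3 * c `^ p)%:E)%E) H.
  rewrite lee_fin mulr_ge0 ?(ltW c30)// => /(_ isT).
  by rewrite -EFinM cE EFinM muleA.
have Ng : (Lp_norm p g `^ p = (c3 * (c * image_const) `^ p)%:E *
    \int[mu]_(t in `]0%R, +oo[) (`|jump p d t| `^ p)%:E)%E.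
  have ci0 : 0 <= c * image_const by rewrite mulr_ge0 ?(ltW c0) ?(ltW image_const_gt0).
  rewrite poweR_Lp_norm//.
  under eq_integral => z _.
    rewrite cmodulus_g powRM ?normr_ge0//.
    over.
  by rewrite (scale _ _ mJ (fun t => powR_ge0 _ _) (powR_ge0 _ _)) EFinM muleA.
have Jge0 : (0 <= \int[mu]_(t in `]0%R, +oo[) (`|jump p d t| `^ p)%:E)%E.
  by apply: integral_ge0 => t _; rewrite lee_fin powR_ge0.
have Jlty := jump_Lp_lty p2 d01; have Jge := jump_Lp_ge p2 d01.
move: Ng Jge0 Jlty Jge.
case: (\int[mu]_(t in `]0%R, +oo[) (`|jump p d t| `^ p)%:E)%E => [J| |]// Ng _ _ Jge.
exists J; split => //.
apply: ereal_sup_ubound; exists f, g; split=> //.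
have Ngfin : (Lp_norm p g < +oo)%E.
  rewrite ltey; apply/eqP => Ngoo; move: Ng; rewrite Ngoo poweRE gt_eqF//=.
have fLp : in_Lp p f by split => //; exact: le_lt_trans Nf (ltry 1).
(* [f] lies in the Fourier class, so the constant sequence is an admissible approximation and the
   image is given by the integral itself. *)
split=> //; exists (fun=> f); split.
- by move=> n; split => //; exact: fourier_class_source.
- rewrite (_ : (fun x => f x - f x) = fun=> 0); last by apply/funext => x; rewrite subrr.
  by rewrite Lp_norm0//; exact: cvg_cst.
- rewrite (_ : (fun x => _ - g x) = fun=> 0); last by apply/funext => x; rewrite subrr.
  by rewrite Lp_norm0//; exact: cvg_cst.
Qed.
End fixed_d.

(** [source_const] is the factor of |z|^(-2/p) in the modulus of the test function, and the
    right-hand side is the one in the modulus of its image; the Gamma quotient is their ratio. *)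
Lemma image_const_ratio (q : R) : p^-1 + q^-1 = 1 ->
  (Gamma p^-1 * Gamma (q^-1 + k%:R / 2)) / (Gamma q^-1 * Gamma (p^-1 + k%:R / 2)) *
  source_const k p^-1 = image_const * Gamma p^-1 * pi `^ (- p^-1).
Proof.
move=> pq; have -> : q^-1 = 1 - p^-1 by lra.
rewrite /image_const /source_const (addrC p^-1).
have -> : 1 - p^-1 + k%:R / 2 = k%:R / 2 - p^-1 + 1 by ring.
have G1 : Gamma (k%:R / 2 + p^-1) != 0.
  by rewrite gt_eqF// Gamma_gt0// ltr_wpDl// divr_ge0.
have G2 : Gamma (1 - p^-1) != 0 by rewrite gt_eqF// Gamma_gt0//; have := al12; lra.
rewrite opprD -powR_add ?pi_gt0//.
move: (Gamma p^-1) (Gamma (k%:R / 2 - p^-1 + 1)) (Gamma (k%:R / 2 + p^-1)) G1.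
move: (Gamma (1 - p^-1)) G2 (pi `^ (- (k%:R / 2))) (pi `^ (- p^-1)).
by move=> A A0 B C D E F F0; field; rewrite A0 F0.
Qed.

(** Were the norm a number N below the quotient Q, the test functions would yield (QB)^p L <= (NB)^p
    L + O(1) for every L = ln(1/d), which fails for large L. *)
Lemma riesz_power_norm_ge (q : R) : p^-1 + q^-1 = 1 ->
  (((Gamma p^-1 * Gamma (q^-1 + k%:R / 2)) /
    (Gamma q^-1 * Gamma (p^-1 + k%:R / 2)))%:E <= riesz_power_norm k p)%E.
Proof.
move=> pq; have QE := image_const_ratio pq; set Q := (Gamma p^-1 * _ / _) in QE *.
rewrite leNgt; apply/negP => NQ.
have [c3 c30 radial] := @plane_integral_radial R.
set B := source_const k p^-1 in QE; set c2 := source_Lp_const k p.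
set c1 := jump_Lp_const p; set I := image_const in QE.
have B0 : 0 < B by exact: source_const_gt0.
have I0 : 0 < I by exact: image_const_gt0.
have Bp0 : 0 < B `^ p by rewrite powR_gt0.
have c20 : 0 <= c2.
  rewrite /c2 addr_ge0 ?powR_ge0// mulr_ge0 ?powR_ge0// Rintegral_ge0// => t.
  exact: tail_ge0.
(* [NQ] makes the norm a real number N, and d = e^(-L) turns ln(1/d) into L. Both sides of the
   resulting inequality are affine in L. *)
have key (L : R) : 0 < L -> exists2 N : R,
    (riesz_power_norm k p = N%:E) & 0 <= N /\ (Q * B) `^ p * L - I `^ p * c1 <= N `^ p * (B `^ p * L + c2).
  move=> L0; pose d := expR (- L).
  have d01 : 0 < d < 1 by rewrite expR_gt0/= -[X in _ < X]expR0 ltr_expR oppr_lt0.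
  have dL : - ln d = L by rewrite /d expRK opprK.
  have Y0 : 0 < B `^ p * L + c2 by rewrite ltr_pwDl// mulr_gt0.
  (* The solution of the normalisation c3 c^p (B^p L + c2) = 1; with it c3 drops out of the bound
     for the image. *)
  pose c := (c3 * (B `^ p * L + c2)) `^ (- p^-1).
  have cc0 : 0 < c by rewrite powR_gt0// mulr_gt0.
  have cp : c `^ p = (c3 * (B `^ p * L + c2))^-1.
    rewrite /c -powRrM mulNr mulVf ?gt_eqF// powR_inv1// ltW// mulr_gt0//.
  have cE : c3 * c `^ p * (source_const k p^-1 `^ p * (- ln d) + source_Lp_const k p) = 1.
    by rewrite dL cp -/B -/c2 mulrAC mulfV// gt_eqF// mulr_gt0.
  have [J [J1 J2 J3]] := multiplier_source_Lp d01 cc0 c30 radial cE.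
  have Ng0 := Lp_norm_ge0 p (multiplier_op (fun xi => riesz_symbol xi ^+ k)
    (fun z => c%:C * source k p^-1 d z)).
  move: NQ J2 J3 Ng0.
  case: (riesz_power_norm k p) => [N| |]// NQ; case: (Lp_norm p _) => [n| |]// J2 J3 Ng0.
  exists N => //; rewrite lee_fin in J3; rewrite lee_fin in Ng0.
  have N0 : 0 <= N by exact: le_trans J3.
  split=> //; move: J2; rewrite poweR_EFin => -[J2].
  have nN : n `^ p <= N `^ p by apply: ler_powRl => //; exact: ltW.
  have JY : I `^ p * J <= N `^ p * (B `^ p * L + c2).
    rewrite -ler_pdivrMr//; apply: le_trans nN; rewrite -J2.
    rewrite powRM ?(ltW cc0) ?(ltW I0)// cp; apply: le_of_eq.
    move: (B `^ p * L + c2) Y0 (I `^ p) => Y Y0 Ip; field.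
    by rewrite !gt_eqF.
  apply: le_trans JY.
  rewrite dL in J1.
  have -> : (Q * B) `^ p * L = I `^ p * (Gamma p^-1 `^ p * pi^-1 * L).
    have IG : 0 <= I * Gamma p^-1 := mulr_ge0 (ltW I0) (ltW (Gamma_gt0 al0)).
    rewrite QE (powRM _ IG (powR_ge0 _ _)).
    rewrite (powRM _ (ltW I0) (ltW (Gamma_gt0 al0))) -powRrM mulNr mulVf ?gt_eqF//.
    by rewrite powR_inv1 ?pi_ge0// !mulrA.
  by rewrite -mulrBr ler_wpM2l ?powR_ge0// lerBlDr.
have [N NE [N0 _]] := key 1 ltr01.
rewrite NE lte_fin in NQ.
have QB : (N * B) `^ p < (Q * B) `^ p.
  have Q0 : 0 <= Q by exact: ltW (le_lt_trans N0 NQ).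
  have N1 : N * B \is Num.nneg by rewrite nnegrE; exact: mulr_ge0 N0 (ltW B0).
  have Q1 : Q * B \is Num.nneg by rewrite nnegrE; exact: mulr_ge0 Q0 (ltW B0).
  apply: gt0_ltr_powR => //.
  by rewrite (ltr_pM2r B0).
have D0 : 0 < (Q * B) `^ p - (N * B) `^ p by rewrite subr_gt0.
(* [e] exceeds the sum of the bounded terms by 1, so L = e divided by the difference of the slopes
   contradicts [key]. *)
pose e := I `^ p * `|c1| + N `^ p * c2 + 1.
have e0 : 0 < e by rewrite ltr_wpDl// addr_ge0// mulr_ge0 ?powR_ge0.
have [N' N'E [_ ]] := key (e / ((Q * B) `^ p - (N * B) `^ p)) (divr_gt0 e0 D0).
have -> : N' = N by apply: EFin_inj; rewrite -N'E -NE.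
set L := e / _.
have LE : L * ((Q * B) `^ p - (N * B) `^ p) = e by rewrite /L divfK// gt_eqF.
rewrite (mulrDr (N `^ p)) (mulrA (N `^ p)) -(powRM _ N0 (ltW B0)) => H.
have Ic : I `^ p * c1 <= I `^ p * `|c1| by rewrite ler_wpM2l ?powR_ge0// ler_norm.
move: LE H Ic; rewrite /e; move: (I `^ p * c1) (I `^ p * `|c1|) (N `^ p * c2).
move: ((Q * B) `^ p) ((N * B) `^ p) => x y a b' c' LE H Ic.
by move: LE H; lra.
Qed.
End LowerBound.

Local Close Scope classical_set_scope.

Theorem theorem6p1 (R : realType) (p q : R) (k : nat)
    (hp : 2 <= p) (hpq : p^-1 + q^-1 = 1) (hk : (0 < k)%N) :
  (((Gamma p^-1 * Gamma (q^-1 + k%:R / 2)) /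
    (Gamma q^-1 * Gamma (p^-1 + k%:R / 2)))%:E <= riesz_power_norm k p)%E /\
  2^-1 * k%:R `^ (1 - 2 / p) * (p - 1) <=
    (Gamma p^-1 * Gamma (q^-1 + k%:R / 2)) /
    (Gamma q^-1 * Gamma (p^-1 + k%:R / 2)).
Proof. by split; [exact: riesz_power_norm_ge|exact: Gamma_quotient_ge]. Qed.
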